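(* (i) Let $T\subset\mathbb{R}^d$ be compact, let $X=(X(t),\,t\in T)$ be a real-valued centered Gaussian random field on $T$ with continuous sample paths, and let $a\neq b$ be points of $T$ such that $T$ contains some path from $a$ to $b$. Set $$\Psi_{a,b}(u)=P\big(\exists\,\xi\in\mathcal{P}(a,b):\ \xi(v)\in T \text{ and } X(\xi(v))>u \text{ for all } 0\le v\le 1\big).$$ Then $$\lim_{u\to\infty}\frac{1}{u^2}\log\Psi_{a,b}(u)=-\frac12\, C_X(a,b),$$ where $$C_X(a,b)=\inf\big\{E H^2:\ H\in\mathcal{L},\ \text{and for some } \xi\in\mathcal{P}(a,b),\ \xi(v)\in T \text{ and } w_H(\xi(v))>1 \text{ for all } 0\le v\le 1\big\}.$$ (ii) Let $X=(X(t),\,t\in\mathbb{R}^d)$ be a real-valued centered stationary Gaussian random field with continuous sample paths, covariance function $R_X(t)=\mathrm{Cov}(X(0),X(t))$ and spectral measure $F_X$, and assume $\limsup_{\|t\|\to\infty}R_X(t)\le 0$. Let $a\in\mathbb{R}^d$, $a\ne 0$, and $\Psi_a(u)=P(\exists\,\xi\in\mathcal{P}(0,a):\ X(\xi(v))>u \text{ for all } 0\le v\le1)$. Then $$\lim_{u\to\infty}\frac{1}{u^2}\log\Psi_a(u)=-\frac12\,C_X(a),$$ where $$C_X(a)=\inf\Big\{\int_{\mathbb{R}^d}|h(x)|^2F_X(dx):\ h\in\mathcal{H}_F,\ \text{and for some }\xi\in\mathcal{P}(0,a),\ \int_{\mathbb{R}^d}e^{i(\xi(v),x)}\overline{h(x)}\,F_X(dx)>1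 \text{ for all } 0\le v\le 1\Big\}.$$
   Context: For $a,b\in\mathbb{R}^d$, $\mathcal{P}(a,b)$ is the set of paths from $a$ to $b$, i.e. continuous maps $\xi:[0,1]\to\mathbb{R}^d$ with $\xi(0)=a$, $\xi(1)=b$. For a field $X$ on a parameter set $T$, $\mathcal{L}$ denotes the closure in $L^2(P)$ of the set of finite linear combinations $\sum_j a_jX(t_j)$ ($a_j\in\mathbb{R}$, $t_j\in T$), and for $H\in\mathcal{L}$, $w_H(t)=E(X(t)H)$, $t\in T$. In the stationary case the spectral measure $F_X$ is the finite symmetric Borel measure on $\mathbb{R}^d$ with $R_X(t)=\int e^{i(t,x)}F_X(dx)$, and $\mathcal{H}_F$ denotes the set of functions $h\in L^2(F_X)$ (complex-valued) with even real part and odd imaginary part. The infimum of an empty set is $+\infty$ (so the limit is then $-\infty$). *)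

(* Defs.v *)
From HB Require Import structures.
From mathcomp Require Import all_boot all_order all_algebra.
From mathcomp Require Import all_classical all_reals all_analysis.
Set Implicit Arguments. Unset Strict Implicit. Unset Printing Implicit Defensive.
Import Order.TTheory GRing.Theory Num.Def Num.Theory.
Import numFieldNormedType.Exports.
Local Open Scope classical_set_scope.
Local Open Scope ring_scope.

Section Defs.
Context {R : realType}.

Definition is_path (d : nat) (a b : 'rV[R]_d) (xi : R -> 'rV[R]_d) : Prop :=
  {within `[0%R, 1%R], continuous xi} /\ xi 0 = a /\ xi 1 = b.

Definition lincomb (d : nat) (Omega : Type) (X : 'rV[R]_d -> Omega -> R)
  (s : seq ('rV[R]_d * R)) : Omega -> R :=
  fun w => \sum_(p <- s) p.2 * X p.1 w.

Definition centered_gaussian_rv (dO : measure_display) (Omega : measurableType dO)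
  (P : probability Omega R) (Y : Omega -> R) : Prop :=
  measurable_fun setT Y /\
  exists s : R, forall A : set R, measurable A ->
    P (Y @^-1` A) = (if s == 0 then \d_(0:R) A else normal_prob 0 s A).

Definition centered_gaussian_field (dO : measure_display) (Omega : measurableType dO)
  (P : probability Omega R) (d : nat) (T : set 'rV[R]_d)
  (X : 'rV[R]_d -> Omega -> R) : Prop :=
  (forall t, T t -> measurable_fun setT (X t)) /\
  forall s : seq ('rV[R]_d * R), (forall p, p \in s -> T p.1) ->
    centered_gaussian_rv P (lincomb X s).

Definition in_L (dO : measure_display) (Omega : measurableType dO)
  (P : probability Omega R) (d : nat) (T : set 'rV[R]_d)
  (X : 'rV[R]_d -> Omega -> R) (H : Omega -> R) : Prop :=
  measurable_fun setT H /\
  forall e : R, 0 < e -> exists s : seq ('rV[R]_d * R),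
    (forall p, p \in s -> T p.1) /\
    ('E_P[fun w => ((H w - lincomb X s w) ^+ 2)%R] < e%:E)%E.

Definition w_H (dO : measure_display) (Omega : measurableType dO)
  (P : probability Omega R) (d : nat) (X : 'rV[R]_d -> Omega -> R)
  (H : Omega -> R) (t : 'rV[R]_d) : \bar R :=
  ('E_P[fun w => (X t w * H w)%R])%E.

Definition C_ab (dO : measure_display) (Omega : measurableType dO)
  (P : probability Omega R) (d : nat) (T : set 'rV[R]_d)
  (X : 'rV[R]_d -> Omega -> R) (a b : 'rV[R]_d) : \bar R :=
  ereal_inf [set ('E_P[fun w => (H w ^+ 2)%R])%E | H in
    [set H | in_L P T X H /\
      exists xi, is_path a b xi /\
        forall v, v \in `[0%R, 1%R] -> T (xi v) /\ (1%:E < w_H P X H (xi v))%E]].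

Definition Psi_ab (dO : measure_display) (Omega : measurableType dO)
  (P : probability Omega R) (d : nat) (T : set 'rV[R]_d)
  (X : 'rV[R]_d -> Omega -> R) (a b : 'rV[R]_d) (u : R) : \bar R :=
  P [set w | exists xi, is_path a b xi /\
        forall v, v \in `[0%R, 1%R] -> T (xi v) /\ u < X (xi v) w].

Definition elog (x : \bar R) : \bar R :=
  if x == 0%E then -oo%E else (ln (fine x))%:E.

Definition logratio (p : \bar R) (u : R) : \bar R :=
  (elog p * (u ^- 2)%:E)%E.

(** ---- spectral side: R^d as d.-tuple R with its product (= Borel) sigma-algebra *)

Definition dotvt (d : nat) (t : 'rV[R]_d) (x : d.-tuple R) : R :=
  \sum_(i < d) t ord0 i * tnth x i.

Definition tneg (d : nat) (x : d.-tuple R) : d.-tuple R := map_tuple -%R x.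

Definition cov_fun (dO : measure_display) (Omega : measurableType dO)
  (P : probability Omega R) (d : nat) (X : 'rV[R]_d -> Omega -> R)
  (t : 'rV[R]_d) : \bar R :=
  covariance P (X 0) (X t).

(** stationarity of a (centered Gaussian) field: the covariance of X(s), X(t)
    depends only on t - s *)
Definition stationary (dO : measure_display) (Omega : measurableType dO)
  (P : probability Omega R) (d : nat) (X : 'rV[R]_d -> Omega -> R) : Prop :=
  forall s t, covariance P (X s) (X t) = cov_fun P X (t - s).

(** F is the spectral measure of X: finite (by its type), symmetric, and
    R_X(t) = int e^{i(t,x)} F(dx)  (real and imaginary parts). *)
Definition is_spectral_measure (dO : measure_display) (Omega : measurableType dO)
  (P : probability Omega R) (d : nat) (X : 'rV[R]_d -> Omega -> R)
  (F : {finite_measure set (d.-tuple R) -> \bar R}) : Prop :=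
  (forall A : set (d.-tuple R), measurable A -> F (@tneg d @^-1` A) = F A) /\
  forall t, cov_fun P X t = (\int[F]_x (cos (dotvt t x))%:E)%E /\
            (\int[F]_x (sin (dotvt t x))%:E)%E = 0%E.

(** h = hr + i hi belongs to H_F *)
Definition in_HF (d : nat) (F : {finite_measure set (d.-tuple R) -> \bar R})
  (hr hi : d.-tuple R -> R) : Prop :=
  measurable_fun setT hr /\ measurable_fun setT hi /\
  (\int[F]_x ((hr x) ^+ 2 + (hi x) ^+ 2)%:E < +oo)%E /\
  (forall x, hr (tneg x) = hr x) /\ (forall x, hi (tneg x) = - hi x).

(** C_X(a).  For h = hr + i hi:
    e^{i(t,x)} conj(h(x)) = (cos(t,x) hr + sin(t,x) hi) + i (sin(t,x) hr - cos(t,x) hi),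
    and "(complex number) > 1" means: imaginary part 0 and real part > 1. *)
Definition C_a (d : nat) (F : {finite_measure set (d.-tuple R) -> \bar R})
  (a : 'rV[R]_d) : \bar R :=
  ereal_inf [set (\int[F]_x ((h.1 x) ^+ 2 + (h.2 x) ^+ 2)%:E)%E | h in
    [set h : (d.-tuple R -> R) * (d.-tuple R -> R) | in_HF F h.1 h.2 /\
      exists xi, is_path 0 a xi /\
        forall v, v \in `[0%R, 1%R] ->
          (1%:E < \int[F]_x (cos (dotvt (xi v) x) * h.1 x
                              + sin (dotvt (xi v) x) * h.2 x)%:E)%E /\
          (\int[F]_x (sin (dotvt (xi v) x) * h.1 x
                       - cos (dotvt (xi v) x) * h.2 x)%:E)%E = 0%E]].

Definition Psi_a (dO : measure_display) (Omega : measurableType dO)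
  (P : probability Omega R) (d : nat) (X : 'rV[R]_d -> Omega -> R)
  (a : 'rV[R]_d) (u : R) : \bar R :=
  P [set w | exists xi, is_path 0 a xi /\
        forall v, v \in `[0%R, 1%R] -> u < X (xi v) w].

End Defs.

(* Main.v *)
(* On a compact set, Fernique's inequality makes the oscillation of the field on a fine
   mesh exceed delta u only with probability exp(- K u^2) with K as large as we like, so
   that path events may be replaced by events on the finitely many points of a net.

   Upper bound: if the field is above u at a set S of net points shadowing a path, then so
   is every convex combination Y of these values, and Chernoff's inequality gives
   exp(- u^2 / (2 E Y^2)).  The combination of minimal variance satisfies
   E (X(t) Y) >= E Y^2 for t in S, hence Y / E Y^2, slightly enlarged, is admissible in the
   variational problem and E Y^2 is at most about 1 / C.

   Lower bound: an admissible H makes every convex combination Y of the field along its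
   path satisfy E (H Y) >= 1, hence E H^2 E Y^2 >= 1 by Cauchy-Schwarz.  The minimal
   combination on a net of that path then yields an H' in the linear span of the field
   with no larger energy and E (X(t) H') >= 1 on the net, and an exponential change of
   measure along u H' shows that the probability is at least exp(- u^2 (E H^2 + eps) / 2).

   For the stationary field on R^d everything takes place in a large ball.  The linear
   span of the field is carried by X(t) |-> exp(i (t, x)) into the spectral L^2 space.  A
   path which leaves the ball crosses many concentric spheres at nearly uncorrelated
   points, whose average has arbitrarily small variance. *)

Require Import Defs.
From HB Require Import structures.
From mathcomp Require Import all_boot all_order all_algebra.
From mathcomp Require Import all_classical all_reals all_analysis.
From mathcomp Require Import measurable_realfun ring lra.
Set Implicit Arguments.
Unset Strict Implicit.
Unset Printing Implicit Defensive.
Import Order.TTheory GRing.Theory Num.Def Num.Theory.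
Import numFieldNormedType.Exports.
Local Open Scope classical_set_scope.
Local Open Scope ring_scope.

(** * Gaussian measures on the line *)

Section NormalDensity.
Context {R : realType}.
Implicit Types (m s x y r : R).
Local Notation mu := lebesgue_measure.

(** Only finite linear combinations of the field are known to be Gaussian. The invariance of two
    independent copies under rotation by 45 degrees, on which Fernique's inequality rests, must
    therefore be extracted from integrals of cosines; this is why a Cramer-Wold argument comes
    before it.

    The two bounds meet by convex duality: the least energy of an H with E (X(t) H) >= 1 along a
    path is the reciprocal of the least variance of a convex combination along that path. Reading
    this duality on finite nets replaces a weak compactness argument in L^2 by the minimisation of a
    quadratic form on a simplex.

    The size of a net, the number of its subsets and factors such as 1/2 do not depend on u, so they
    vanish at scale u^2. Every estimate therefore concedes an eps and holds only beyond some
    threshold [u0]. The strict inequality in the definition of C and the passage between net and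
    path cost factors close to 1; a level strictly below or above C is fixed beforehand to pay for
    them. *)

Lemma ge0_integral_normal_prob m s (f : R -> \bar R) :
  measurable_fun [set: R] f -> (forall x, (0 <= f x)%E) ->
  (\int[normal_prob m s]_x f x =
   \int[mu]_x (f x * (normal_pdf m s x)%:E))%E.
Proof.
move=> mf f0.
rewrite -(Radon_Nikodym_SigmaFinite.change_of_variables (normal_prob_dominates m s))//=.
apply: ae_eq_integral => //.
- apply: emeasurable_funM => //; apply: (measurable_int mu).
  by apply: Radon_Nikodym_SigmaFinite.f_integrable; exact: normal_prob_dominates.
- apply: emeasurable_funM => //=; apply/measurableT_comp => //=.
  exact: measurable_normal_pdf.
- apply: ae_eqe_mul2l => /=.
  apply: integral_ae_eq => //=.
  + by apply: Radon_Nikodym_SigmaFinite.f_integrable; exact: normal_prob_dominates.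
  + by apply/measurable_EFinP; exact: measurable_normal_pdf.
  + move=> E _ mE.
    by rewrite -Radon_Nikodym_SigmaFinite.f_integral//; exact: normal_prob_dominates.
Qed.

Lemma ge0_integral_translation a (g : R -> R) :
  continuous g -> (forall x, 0 <= g x) ->
  (\int[mu]_x (g (x + a))%:E = \int[mu]_x (g x)%:E)%E.
Proof.
move=> cg g0.
have dF x : is_derive x 1 (fun x : R => x + a) 1.
  by apply: is_derive_eq; rewrite addr0.
have F'E : (fun x : R => x + a)^`()%classic = cst 1.
  by apply/funext => x; rewrite derive1E derive_val.
rewrite [RHS](increasing_ge0_integration_by_substitutionT (F := fun x : R => x + a) (G := g))//.
- by apply: eq_integral => x _; rewrite F'E /= mulr1.
- by move=> x y xy; rewrite ltrD2r.
- by rewrite F'E => ?; exact: cvg_cst.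
- by rewrite F'E; exact: is_cvg_cst.
- by rewrite F'E; exact: is_cvg_cst.
- exact: cvg_addrr_Ny.
- exact: cvg_addrr.
Qed.

Lemma normal_mgf m s : s != 0 ->
  (\int[normal_prob m s]_x (expR x)%:E = (expR (m + s ^+ 2 / 2))%:E)%E.
Proof.
move=> s0; rewrite ge0_integral_normal_prob//.
have H x : ((expR x)%:E * (normal_pdf m s x)%:E =
   (expR (m + s ^+ 2 / 2))%:E * (normal_pdf (m + s ^+ 2) s x)%:E)%E.
  rewrite -!EFinM; congr EFin; rewrite !normal_pdfE// /normal_fun.
  rewrite mulrCA [RHS]mulrCA; congr (_ * _); rewrite -!expRD; congr expR.
  by field.
under eq_integral do rewrite H.
rewrite ge0_integralZl//=; first by rewrite integral_normal_pdf mule1.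
- by apply/measurable_EFinP; exact: measurable_normal_pdf.
- by move=> x _; rewrite lee_fin normal_pdf_ge0.
- by apply/measurable_EFinP; exact: measurable_expR.
Qed.

(* Tilting N(0,s) by exp(theta x^2) turns it into N(0, r s). *)
Lemma normal_exp_sqr s r : s != 0 -> 0 < r ->
  (\int[normal_prob 0 s]_x (expR ((1 - r ^- 2) / (s ^+ 2 *+ 2) * x ^+ 2))%:E
     = r%:E)%E.
Proof.
move=> s0 r0; rewrite ge0_integral_normal_prob//; last first.
  apply/measurable_EFinP/measurableT_comp => //.
  by apply: measurable_funM => //; exact: measurable_funX.
have r0' : r != 0 by rewrite gt_eqF.
have rs0 : r * s != 0 by rewrite mulf_neq0.
have H x : ((expR ((1 - r ^- 2) / (s ^+ 2 *+ 2) * x ^+ 2))%:E *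
     (normal_pdf 0 s x)%:E = r%:E * (normal_pdf 0 (r * s) x)%:E)%E.
  rewrite -!EFinM; congr EFin; rewrite !normal_pdfE// /normal_fun.
  rewrite [LHS]mulrCA -expRD [RHS]mulrA; congr (_ * expR _); last first.
    by field; rewrite r0' s0.
  rewrite /normal_peak.
  have -> : (r * s) ^+ 2 * pi *+ 2 = r ^+ 2 * (s ^+ 2 * pi *+ 2) by ring.
  by rewrite (@sqrtrM _ (r ^+ 2)) ?sqr_ge0// sqrtr_sqr gtr0_norm// invfM mulrA divff// mul1r.
under eq_integral do rewrite H.
rewrite ge0_integralZl//=; first by rewrite integral_normal_pdf mule1.
- by apply/measurable_EFinP; exact: measurable_normal_pdf.
- by move=> x _; rewrite lee_fin normal_pdf_ge0.
- by rewrite lee_fin ltW.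
Qed.

(** The tilt with r = 2 has a positive exponent c, and c x^2 <= exp(c x^2) makes its integrand a
    dominating function. *)
Lemma normal_sqr_integrable s : s != 0 ->
  (normal_prob 0 s).-integrable setT (fun x => (x ^+ 2)%:E).
Proof.
move=> s0.
have r2 : (0 : R) < 2 by [].
pose c := (1 - (2:R) ^- 2) / (s ^+ 2 *+ 2).
have c0 : 0 < c.
  rewrite divr_gt0//; last by rewrite pmulrn_rgt0// exprn_even_gt0.
  by rewrite subr_gt0 invf_lt1 ?exprn_gt0// expr2; lra.
have mc : measurable_fun [set: R] (fun x : R => expR (c * x ^+ 2)).
  by apply: measurableT_comp => //; apply: measurable_funM => //;
     exact: measurable_funX.
have ie : (normal_prob 0 s).-integrable setT
    (fun x => c^-1%:E * (expR (c * x ^+ 2))%:E)%E.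
  apply: integrableZl => //; apply/integrableP; split.
    exact/measurable_EFinP.
  under eq_integral do rewrite gee0_abs ?lee_fin ?expR_ge0//.
  by rewrite (normal_exp_sqr s0 r2) ltry.
apply: (le_integrable _ _ _ ie) => //.
- by apply/measurable_EFinP; exact: measurable_funX.
- move=> x _; rewrite -EFinM !abse_EFin lee_fin ger0_norm ?sqr_ge0//.
  rewrite ger0_norm; last by rewrite mulr_ge0// ?expR_ge0// invr_ge0 ltW.
  rewrite ler_pdivlMl//.
  by apply: (le_trans _ (expR_ge1Dx _)); rewrite lerDr.
Qed.

(** Integrating 1 + c x^2 <= exp(c x^2) against the tilting identity gives an inequality valid for
    every r > 0, with equality at r = 1. The two sides are then tangent at 1, which forces m = s^2
    without differentiating under the integral. Dividing by r - 1 on either side of 1 gives [key2]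
    and [key3]. *)
Lemma normal_variance s : s != 0 ->
  \int[normal_prob 0 s]_x (x ^+ 2) = s ^+ 2.
Proof.
move=> s0; set m := Rintegral _ _ _.
have s2 : 0 < s ^+ 2 by rewrite exprn_even_gt0.
have key r : 0 < r -> 1 + (1 - r ^- 2) / (s ^+ 2 *+ 2) * m <= r.
  move=> r0; set c := _ / _.
  have mc : measurable_fun [set: R] (fun x : R => expR (c * x ^+ 2)).
    by apply: measurableT_comp => //; apply: measurable_funM => //;
       exact: measurable_funX.
  have -> : r = \int[normal_prob 0 s]_x (expR (c * x ^+ 2)).
    by rewrite /Rintegral normal_exp_sqr.
  have i1 : (normal_prob 0 s).-integrable setT (EFin \o (fun x : R => 1%R)).
    exact: finite_measure_integrable_cst.
  have i2 : (normal_prob 0 s).-integrable setT (EFin \o (fun x => c * x ^+ 2)).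
    by under [_ \o _]eq_fun do rewrite /= EFinM; apply: integrableZl => //;
       exact: normal_sqr_integrable.
  have -> : 1 + c * m = \int[normal_prob 0 s]_x (1 + c * x ^+ 2).
    rewrite RintegralD// RintegralZl//; last exact: normal_sqr_integrable.
    by rewrite Rintegral_cst//= probability_setT mulr1.
  apply: le_Rintegral => //; last by move=> x _; exact: expR_ge1Dx.
  - by under [_ \o _]eq_fun do rewrite /= EFinD; exact: integrableD.
  - apply/integrableP; split; first exact/measurable_EFinP.
    under eq_integral do rewrite gee0_abs ?lee_fin ?expR_ge0//.
    by rewrite (normal_exp_sqr s0 r0) ltry.
have key2 r : 0 < r -> (r - 1) * ((r + 1) * m) <= (r - 1) * (2 * s ^+ 2 * r ^+ 2).
  move=> r0; have := key _ r0; rewrite -lerBrDl => /(ler_wpM2r (ltW (exprn_gt0 2 r0))).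
  move=> /(ler_wpM2r (ltW s2)).
  have -> : (1 - r ^- 2) / (s ^+ 2 *+ 2) * m * r ^+ 2 * s ^+ 2 =
     2^-1 * ((r - 1) * ((r + 1) * m)) by field; rewrite (gt_eqF r0) s0.
  rewrite mulrC ler_pdivrMr// => /le_trans; apply.
  by rewrite [leRHS](_ : _ = (r - 1) * r ^+ 2 * s ^+ 2 * 2)//; ring.
have {}key2 r : 1 < r -> (r + 1) * m <= 2 * s ^+ 2 * r ^+ 2.
  move=> r1; have := key2 r (lt_trans ltr01 r1).
  by rewrite ler_pM2l// subr_gt0.
have key3 r : 0 < r < 1 -> 2 * s ^+ 2 * r ^+ 2 <= (r + 1) * m.
  move=> /andP[r0 r1]; have := key r r0.
  rewrite -lerBrDl => /(ler_wpM2r (ltW (exprn_gt0 2 r0))).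
  move=> /(ler_wpM2r (ltW s2)).
  have -> : (1 - r ^- 2) / (s ^+ 2 *+ 2) * m * r ^+ 2 * s ^+ 2 =
     2^-1 * ((r - 1) * ((r + 1) * m)) by field; rewrite (gt_eqF r0) s0.
  rewrite mulrC ler_pdivrMr//.
  have -> : (r - 1) * r ^+ 2 * s ^+ 2 * 2 = (r - 1) * (2 * s ^+ 2 * r ^+ 2) by ring.
  by rewrite ler_nM2l// subr_lt0.
have m0 : 0 <= m by apply: Rintegral_ge0 => x _; exact: sqr_ge0.
(* A gap e between m and s^2 is contradicted by r = 1 - t or r = 1 + t for such a t. *)
have t_gt0 e : 0 < e -> exists t, [/\ 0 < t, t < 1 & 4 * s ^+ 2 * t < e].
  move=> e0; exists (e / (4 * s ^+ 2 + e)).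
  have p0 : 0 < 4 * s ^+ 2 + e by lra.
  split; first exact: divr_gt0.
    by rewrite ltr_pdivrMr// mul1r ltrDr; lra.
  by rewrite mulrA ltr_pdivrMr//; nra.
have [|sm|//] := ltgtP m (s ^+ 2).
- rewrite -subr_gt0 => /t_gt0[t [t0 t1 ht]].
  have : 0 < 1 - t < 1 by apply/andP; split; lra.
  by move=> /key3; nra.
- have := sm; rewrite -subr_gt0 => /t_gt0[t [t0 t1 ht]].
  have : 1 < 1 + t by lra.
  by move=> /key2; nra.
Qed.

End NormalDensity.

Section GaussLaw.
Context {R : realType}.
Implicit Types (m s x y r v : R).
Local Notation mu := lebesgue_measure.

(** Completing the square in x factors the joint density into the law of the sum at z and the
    conditional law of the first variable given that the sum is z; integrating x out leaves the
    former. *)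
Lemma normal_pdf_convolution s1 s2 x z : s1 != 0 -> s2 != 0 ->
  let v := s1 ^+ 2 + s2 ^+ 2 in
  normal_pdf 0 s1 x * normal_pdf 0 s2 (z - x) =
  normal_pdf 0 (Num.sqrt v) z *
  normal_pdf (s1 ^+ 2 / v * z) (s1 * s2 / Num.sqrt v) x.
Proof.
move=> s10 s20 v.
have v0 : 0 < v by rewrite addr_gt0// exprn_even_gt0.
have r0 : Num.sqrt v != 0 by rewrite gt_eqF// sqrtr_gt0.
have rv : Num.sqrt v ^+ 2 = v by rewrite sqr_sqrtr// ltW.
rewrite !normal_pdfE//; last by rewrite mulf_neq0 ?invr_eq0// mulf_neq0.
rewrite /normal_fun mulrACA [RHS]mulrACA -!expRD; congr (_ * expR _); last first.
  have -> : (s1 * s2 / Num.sqrt v) ^+ 2 = s1 ^+ 2 * s2 ^+ 2 / v.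
    by rewrite !exprMn exprVn rv.
  rewrite rv /v; field.
  by rewrite s10 s20/= -/v gt_eqF.
rewrite /normal_peak -!invfM -!sqrtrM; try by rewrite mulrn_wge0// mulr_ge0 ?sqr_ge0// pi_ge0.
congr (Num.ExtraDef.sqrtr _)^-1.
rewrite !exprMn exprVn rv; field.
by rewrite gt_eqF.
Qed.

Lemma normal_convolution s1 s2 (g : R -> R) : s1 != 0 -> s2 != 0 ->
  continuous g -> (forall x, 0 <= g x) ->
  (\int[normal_prob 0 s1]_x \int[normal_prob 0 s2]_y (g (x + y))%:E =
   \int[normal_prob 0 (Num.sqrt (s1 ^+ 2 + s2 ^+ 2))]_z (g z)%:E)%E.
Proof.
move=> s10 s20 cg g0; set v := s1 ^+ 2 + _.
have v0 : 0 < v by rewrite addr_gt0// exprn_even_gt0.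
have r0 : Num.sqrt v != 0 by rewrite gt_eqF// sqrtr_gt0.
have mg : measurable_fun [set: R] g by exact: continuous_measurable_fun.
have mG : measurable_fun setT (fun p : measurableTypeR R * measurableTypeR R => (g (p.1 + p.2))%:E).
  apply/measurable_EFinP; apply: measurableT_comp => //.
  exact: measurable_funD.
have inner x : (\int[normal_prob 0 s2]_y (g (x + y))%:E =
   \int[mu]_z (g z * normal_pdf 0 s2 (z - x))%:E)%E.
  rewrite ge0_integral_normal_prob; last 2 first.
  - apply/measurable_EFinP; apply: measurableT_comp => //.
    exact: measurable_funD.
  - by move=> y; rewrite lee_fin.
  rewrite -(@ge0_integral_translation _ x (fun z => g z * normal_pdf 0 s2 (z - x))); last 2 first.
  - move=> z; apply: cvgM; first exact: cg.
    apply: (cvg_comp (fun z => z - x) (normal_pdf 0 s2)).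
      by apply: cvgB; [exact: cvg_id|exact: cvg_cst].
    exact: continuous_normal_pdf.
  - by move=> z; rewrite mulr_ge0// normal_pdf_ge0.
  by apply: eq_integral => y _; rewrite -EFinM addrK addrC.
rewrite ge0_integral_normal_prob; last 2 first.
- apply: (@measurable_fun_fubini_tonelli_F _ _ (measurableTypeR R) (measurableTypeR R) R (normal_prob 0 s2 : probability (measurableTypeR R) R) (fun p => (g (p.1 + p.2))%:E)) => //.
  by move=> p; rewrite lee_fin.
- by move=> x; apply: integral_ge0 => y _; rewrite lee_fin.
have mpdf (s : R) : measurable_fun [set: R] (normal_pdf 0 s) by exact: measurable_normal_pdf.
transitivity (\int[mu]_x \int[mu]_z (normal_pdf 0 s1 x * (g z * normal_pdf 0 s2 (z - x)))%:E)%E.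
  apply: eq_integral => x _; rewrite inner muleC -ge0_integralZl//.
  - apply/measurable_EFinP; apply: measurable_funM => //.
    apply: measurableT_comp => //; exact: measurable_funB.
  - by move=> z _; rewrite lee_fin mulr_ge0// normal_pdf_ge0.
  - by rewrite lee_fin normal_pdf_ge0.
rewrite (@fubini_tonelli _ _ (measurableTypeR R) (measurableTypeR R) R mu mu (fun p => (normal_pdf 0 s1 p.1 * (g p.2 * normal_pdf 0 s2 (p.2 - p.1)))%:E))/=; last 2 first.
- apply/measurable_EFinP; apply: measurable_funM.
    exact: (measurableT_comp (mpdf s1) measurable_fst).
  apply: measurable_funM; first exact: (measurableT_comp mg measurable_snd).
  by apply: (measurableT_comp (mpdf s2)); exact: measurable_funB.
- by move=> p; rewrite lee_fin !mulr_ge0// normal_pdf_ge0.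
rewrite [RHS]ge0_integral_normal_prob; last 2 first.
- exact/measurable_EFinP.
- by move=> y; rewrite lee_fin.
apply: eq_integral => z _.
transitivity (\int[mu]_x ((g z * normal_pdf 0 (Num.sqrt v) z)%:E *
   (normal_pdf (s1 ^+ 2 / v * z) (s1 * s2 / Num.sqrt v) x)%:E))%E.
  apply: eq_integral => x _; rewrite -!EFinM; congr EFin.
  by rewrite mulrCA normal_pdf_convolution// mulrA.
rewrite ge0_integralZl//=; first by rewrite integral_normal_pdf mule1 -EFinM.
- by apply/measurable_EFinP; exact: measurable_normal_pdf.
- by move=> x _; rewrite lee_fin normal_pdf_ge0.
- by rewrite lee_fin mulr_ge0// normal_pdf_ge0.
Qed.

(** Indexed by the variance, so that convolution adds indices, with the degenerate law included at
    0. *)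
Definition gauss v : probability (measurableTypeR R) R :=
  if v == 0 then (\d_(0 : measurableTypeR R) : probability (measurableTypeR R) R)
  else (normal_prob 0 (Num.sqrt v) : probability (measurableTypeR R) R).

Lemma gauss_mgf v : 0 <= v -> (\int[gauss v]_x (expR x)%:E = (expR (v / 2))%:E)%E.
Proof.
move=> v0; rewrite /gauss; case: eqVneq => [->|vn0].
  rewrite integral_dirac//= ?diracT ?mul1e ?mul0r//.
  by apply/measurable_EFinP; exact: measurable_expR.
rewrite normal_mgf ?add0r ?sqr_sqrtr// gt_eqF// sqrtr_gt0 lt_neqAle eq_sym.
exact/andP.
Qed.

Lemma gauss_sqr v : 0 <= v -> (\int[gauss v]_x (x ^+ 2)%:E = v%:E)%E.
Proof.
move=> v0; rewrite /gauss; case: eqVneq => [->|vn0].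
  rewrite integral_dirac//= ?diracT ?mul1e ?expr0n//.
  by apply/measurable_EFinP; exact: measurable_funX.
have r0 : Num.sqrt v != 0 by rewrite gt_eqF// sqrtr_gt0 lt_neqAle eq_sym; exact/andP.
rewrite -(@fineK _ (\int[_]_x _)%E).
  by have := normal_variance r0; rewrite /Rintegral sqr_sqrtr// => ->.
exact/integrable_fin_num/normal_sqr_integrable.
Qed.

Lemma gauss_convolution v1 v2 (g : R -> R) : 0 <= v1 -> 0 <= v2 ->
  continuous g -> (forall x, 0 <= g x) ->
  (\int[gauss v1]_x \int[gauss v2]_y (g (x + y))%:E =
   \int[gauss (v1 + v2)]_z (g z)%:E)%E.
Proof.
move=> v10 v20 cg g0.
have mg : measurable_fun [set: R] (fun x => (g x)%:E).
  by apply/measurable_EFinP; exact: continuous_measurable_fun.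
have [->|v2n] := eqVneq v2 0.
  rewrite addr0; apply: eq_integral => x _.
  rewrite /gauss eqxx integral_dirac//= ?diracT ?mul1e ?addr0//.
  apply: (measurableT_comp mg); exact: measurable_funD.
have [->|v1n] := eqVneq v1 0.
  rewrite add0r {1}/gauss eqxx integral_dirac//= ?diracT ?mul1e.
    by apply: eq_integral => y _; rewrite add0r.
  apply: (@measurable_fun_fubini_tonelli_F _ _ (measurableTypeR R) (measurableTypeR R) R (gauss v2) (fun p => (g (p.1 + p.2))%:E)).
    by apply: (measurableT_comp mg); exact: measurable_funD.
  by move=> *; rewrite lee_fin.
have s0 v : 0 <= v -> v != 0 -> Num.sqrt v != 0.
  by move=> v0 vn; rewrite gt_eqF// sqrtr_gt0 lt_neqAle eq_sym; exact/andP.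
rewrite /gauss (negbTE v1n) (negbTE v2n) paddr_eq0// (negbTE v1n)/=.
have := normal_convolution (s0 _ v10 v1n) (s0 _ v20 v2n) cg g0.
by rewrite (sqr_sqrtr v10) (sqr_sqrtr v20) => H; exact: H.
Qed.

End GaussLaw.

(** * Gaussian spaces *)

Section GaussianVariable.
Context {dO : measure_display} {Omega : measurableType dO} {R : realType}.
Variable P : probability Omega R.
Implicit Types (Y Z : Omega -> R).
Local Notation E f := (\int[P]_w f w).

(** The parameter of the definition may be negative; the density sees only its square. *)
Lemma gaussian_law Y : centered_gaussian_rv P Y ->
  exists2 v, 0 <= v & forall A : set (measurableTypeR R), measurable A -> P (Y @^-1` A) = gauss v A.
Proof.
move=> [mY [s Hs]]; exists (s ^+ 2); first exact: sqr_ge0.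
move=> A mA; rewrite Hs// /gauss sqrf_eq0; case: eqVneq => [s0|s0]; first by [].
rewrite /normal_prob; apply: eq_integral => x _; congr EFin.
have r0 : Num.sqrt (s ^+ 2) != 0 by rewrite sqrtr_sqr normr_eq0.
by rewrite !normal_pdfE// /normal_peak /normal_fun sqr_sqrtr// sqr_ge0.
Qed.

Lemma gaussian_transfer Y v (g : R -> \bar R) : measurable_fun setT Y ->
  (forall A : set (measurableTypeR R), measurable A -> P (Y @^-1` A) = gauss v A) ->
  measurable_fun [set: R] g -> (forall x, (0 <= g x)%E) ->
  (\int[P]_w g (Y w) = \int[gauss v]_x g x)%E.
Proof.
move=> mY HY mg g0.
rewrite -(preimage_setT Y).
rewrite -(@ge0_integral_pushforward _ _ _ (measurableTypeR R) _ Y mY P setT g)//.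
by apply: eq_measure_integral => A mA _; exact: HY.
Qed.

Lemma gaussian_facts Y : centered_gaussian_rv P Y ->
  [/\ 0 <= E (fun w => Y w ^+ 2),
      P.-integrable setT (EFin \o (fun w => Y w ^+ 2)),
      (\int[P]_w (expR (Y w))%:E = (expR (E (fun w => Y w ^+ 2) / 2))%:E)%E
    & forall g : R -> \bar R, measurable_fun [set: R] g -> (forall x, (0 <= g x)%E) ->
      (\int[P]_w g (Y w) = \int[gauss (E (fun w => Y w ^+ 2))]_x g x)%E].
Proof.
move=> GY; have mY := GY.1; have [v v0 HY] := gaussian_law GY.
have HT := gaussian_transfer mY HY.
have E2 : (\int[P]_w (Y w ^+ 2)%:E = v%:E)%E.
  rewrite (HT (fun x => (x ^+ 2)%:E)) ?gauss_sqr//.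
    by apply/measurable_EFinP; exact: measurable_funX.
  by move=> x; rewrite lee_fin sqr_ge0.
have -> : E (fun w => Y w ^+ 2) = v by rewrite /Rintegral E2.
split => //.
- apply/integrableP; split.
    by apply/measurable_EFinP; exact: measurable_funX.
  under eq_integral do rewrite gee0_abs ?lee_fin ?sqr_ge0//.
  by rewrite E2 ltry.
- rewrite (HT (fun x => (expR x)%:E)) ?gauss_mgf//.
    by apply/measurable_EFinP; exact: measurable_expR.
Qed.

Definition gaussian_space (G : set (Omega -> R)) :=
  (forall Y, G Y -> centered_gaussian_rv P Y) /\
  (forall a Y Z, G Y -> G Z -> G (fun w => a * Y w + Z w)) /\ G (fun=> 0).

Variable G : set (Omega -> R).
Hypothesis HG : gaussian_space G.

Lemma gspace_measurable Y : G Y -> measurable_fun setT Y.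
Proof. by move=> /HG.1[]. Qed.

Lemma gspace0 : G (fun=> 0).
Proof. exact: HG.2.2. Qed.

Lemma gspaceZ a Y : G Y -> G (fun w => a * Y w).
Proof.
move=> GY; rewrite (_ : (fun w => _) = (fun w => a * Y w + 0)).
  by apply: HG.2.1 => //; exact: gspace0.
by apply/funext => w; rewrite addr0.
Qed.

Lemma gspaceD Y Z : G Y -> G Z -> G (fun w => Y w + Z w).
Proof.
move=> GY GZ; rewrite (_ : (fun w => _) = (fun w => 1 * Y w + Z w)); first exact: HG.2.1.
by apply/funext => w; rewrite mul1r.
Qed.

Lemma gspaceB Y Z : G Y -> G Z -> G (fun w => Y w - Z w).
Proof.
move=> GY GZ; rewrite (_ : (fun w => _) = (fun w => -1 * Z w + Y w)); first exact: HG.2.1.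
by apply/funext => w; rewrite mulN1r addrC.
Qed.

Lemma gspace_sum n (a : 'I_n -> R) (f : 'I_n -> Omega -> R) :
  (forall i, G (f i)) -> G (fun w => \sum_i a i * f i w).
Proof.
move=> Gf; have G0 := gspace0.
elim: n a f Gf => [a f _|n IH a f Gf].
  by rewrite (_ : (fun w => _) = (fun=> 0))//; apply/funext => w; rewrite big_ord0.
rewrite (_ : (fun w => _) = (fun w => a ord0 * f ord0 w +
   \sum_(i < n) a (lift ord0 i) * f (lift ord0 i) w)); last first.
  by apply/funext => w; rewrite big_ord_recl.
by apply: HG.2.1 => //; apply: IH.
Qed.

Definition ip Y Z : R := E (fun w => Y w * Z w).

Lemma ipC Y Z : ip Y Z = ip Z Y.
Proof. by apply: eq_Rintegral => w _; rewrite mulrC. Qed.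

Lemma integrable_mul_sqr Y Z : measurable_fun setT Y -> measurable_fun setT Z ->
  P.-integrable setT (EFin \o (fun w => Y w ^+ 2)) ->
  P.-integrable setT (EFin \o (fun w => Z w ^+ 2)) ->
  P.-integrable setT (EFin \o (fun w => Y w * Z w)).
Proof.
move=> mY mZ iY iZ.
have := integrableD measurableT iY iZ.
apply: le_integrable => //.
- by apply/measurable_EFinP; exact: measurable_funM.
- move=> w _ /=; rewrite lee_fin [leRHS]ger0_norm ?addr_ge0 ?sqr_ge0//.
  rewrite normrM -(real_normK (num_real (Y w))) -(real_normK (num_real (Z w))).
  have := sqr_ge0 (`|Y w| - `|Z w|); have := normr_ge0 (Y w); have := normr_ge0 (Z w).
  by nra.
Qed.

Lemma ip_integrable Y Z : G Y -> G Z ->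
  P.-integrable setT (EFin \o (fun w => Y w * Z w)).
Proof.
move=> GY GZ; have [_ iY _ _] := gaussian_facts (HG.1 _ GY).
have [_ iZ _ _] := gaussian_facts (HG.1 _ GZ).
by apply: integrable_mul_sqr => //; exact: gspace_measurable.
Qed.

Lemma ip_linear a Y Z W : G Y -> G Z -> G W ->
  ip (fun w => a * Y w + Z w) W = a * ip Y W + ip Z W.
Proof.
move=> GY GZ GW; rewrite /ip -RintegralZl//; last exact: ip_integrable.
rewrite -RintegralD//; last 2 first.
- have := integrableZl measurableT a (ip_integrable GY GW).
  exact: eq_integrable.
- exact: ip_integrable.
by apply: eq_Rintegral => w _; ring.
Qed.

Lemma ipZ a Y W : G Y -> G W -> ip (fun w => a * Y w) W = a * ip Y W.
Proof.
move=> GY GW; rewrite /ip -RintegralZl//; last exact: ip_integrable.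
by apply: eq_Rintegral => w _; rewrite mulrA.
Qed.

Lemma ipB Y Z W : G Y -> G Z -> G W ->
  ip (fun w => Y w - Z w) W = ip Y W - ip Z W.
Proof.
move=> GY GZ GW; rewrite (_ : (fun w => _) = (fun w => -1 * Z w + Y w)).
  by rewrite ip_linear// mulN1r addrC.
by apply/funext => w; rewrite mulN1r addrC.
Qed.

Lemma ip_sum n (a : 'I_n -> R) (f : 'I_n -> Omega -> R) W :
  (forall i, G (f i)) -> G W ->
  ip (fun w => \sum_i a i * f i w) W = \sum_i a i * ip (f i) W.
Proof.
move=> Gf GW; have G0 := gspace0.
elim: n a f Gf => [a f _|n IH a f Gf].
  rewrite big_ord0 /ip (@eq_Rintegral _ _ _ _ _ (fun=> 0)) ?Rintegral_cst//= ?mul0r//.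
  by move=> w _; rewrite big_ord0 mul0r.
rewrite big_ord_recl (_ : (fun w => _) = (fun w => a ord0 * f ord0 w +
   \sum_(i < n) a (lift ord0 i) * f (lift ord0 i) w)); last first.
  by apply/funext => w; rewrite big_ord_recl.
rewrite ip_linear ?IH//; apply: gspace_sum => //.
Qed.

Lemma ip_ge0 Y : 0 <= ip Y Y.
Proof. by apply: Rintegral_ge0 => w _; rewrite -expr2 sqr_ge0. Qed.

Lemma ip_sqr Y : ip Y Y = E (fun w => Y w ^+ 2).
Proof. by apply: eq_Rintegral => w _; rewrite expr2. Qed.

Lemma gspace_mgf Y : G Y ->
  (\int[P]_w (expR (Y w))%:E = (expR (ip Y Y / 2))%:E)%E.
Proof. by move=> GY; have [_ _ -> _] := gaussian_facts (HG.1 _ GY); rewrite ip_sqr. Qed.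

(** Y and -Y both lie in the space and have the same second moment, hence the same law, so the
    positive and negative parts of Y have equal finite integrals. Integrability comes from |Y| <=
    Y^2 + 1. *)
Lemma gspace_mean0 Y : G Y -> E Y = 0 /\ P.-integrable setT (EFin \o Y).
Proof.
move=> GY; have [_ iY _ HY] := gaussian_facts (HG.1 _ GY).
have GNY := gspaceZ (-1) GY.
have [_ _ _ HNY] := gaussian_facts (HG.1 _ GNY).
have mY := gspace_measurable GY.
have iY1 : P.-integrable setT (EFin \o Y).
  have iZ : P.-integrable setT (EFin \o (fun w : Omega => (1 : R) ^+ 2)).
    exact: finite_measure_integrable_cst.
  have := integrable_mul_sqr mY (measurable_cst (1 : R)) iY iZ.
  by apply: eq_integrable => // w _ /=; rewrite mulr1.
split => //.
have E2 : E (fun w => (-1 * Y w) ^+ 2) = E (fun w => Y w ^+ 2).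
  by apply: eq_Rintegral => w _; rewrite mulN1r sqrrN.
have mg : measurable_fun [set: R] (fun x : R => (maxr x 0)%:E).
  by apply/measurable_EFinP; exact: measurable_maxr.
have g0 (x : R) : (0 <= (maxr x 0)%:E)%E by rewrite lee_fin le_max lexx orbT.
have H := HY _ mg g0; rewrite -E2 -(HNY _ mg g0) in H.
rewrite /Rintegral integralE.
rewrite (_ : (\int[P]_x (fun x => (Y x)%:E)^\+ x)%E = (\int[P]_w (maxr (Y w) 0)%:E)%E); last first.
  by apply: eq_integral => w _; rewrite funeposE -EFin_max.
rewrite (_ : (\int[P]_x (fun x => (Y x)%:E)^\- x)%E = (\int[P]_w (maxr (Y w) 0)%:E)%E); last first.
  by rewrite H; apply: eq_integral => w _; rewrite funenegE -EFin_max mulN1r.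
rewrite subee//.
rewrite (_ : (\int[P]_w (maxr (Y w) 0)%:E)%E = (\int[P]_x (EFin \o Y)^\+ x)%E); last first.
  by apply: eq_integral => w _; rewrite funeposE /= -EFin_max.
exact: integrable_pos_fin_num.
Qed.

Lemma gspace_law Y (A : set (measurableTypeR R)) : G Y -> measurable A ->
  P (Y @^-1` A) = gauss (ip Y Y) A.
Proof.
move=> GY mA; have [_ _ _ HY] := gaussian_facts (HG.1 _ GY).
have <- : (\int[gauss (ip Y Y)]_x (\1_A x)%:E = gauss (ip Y Y) A)%E.
  by rewrite integral_indic// setIT.
rewrite ip_sqr -(HY (fun x => (\1_A x)%:E)); last 2 first.
- by apply/measurable_EFinP; exact: measurable_indic.
- by move=> x; rewrite lee_fin.
transitivity (\int[P]_w (\1_(Y @^-1` A) w)%:E)%E => //.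
rewrite integral_indic// ?setIT//.
by rewrite -[X in measurable X]setTI; exact: gspace_measurable.
Qed.

End GaussianVariable.

(** * Equality in law from characteristic functions *)

Section ThresholdPolynomials.
Context {R : realType}.
Implicit Types (x y : R).

Lemma bernoulli_sub y n : 0 <= y <= 1 -> 1 - n%:R * y <= (1 - y) ^+ n.
Proof.
move=> /andP[y0 y1]; elim: n => [|n IH]; first by rewrite mul0r subr0 expr0.
rewrite exprS; apply: (@le_trans _ _ ((1 - y) * (1 - n%:R * y))); last first.
  by rewrite ler_wpM2l// subr_ge0.
by rewrite -natr1; have := ler0n R n; nra.
Qed.

(* For large n this is close to the indicator of x < 1/2 on [0, 1]; the factor n in
   the exponent handles the point x = 1/2. *)
Definition threshold_poly n x : R := (1 - x ^+ n) ^+ (n * 2 ^ n).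

Lemma threshold_poly_itv n x : 0 <= x <= 1 -> 0 <= threshold_poly n x <= 1.
Proof.
move=> /andP[x0 x1]; have p0 : 0 <= x ^+ n by rewrite exprn_ge0.
have p1 : x ^+ n <= 1 by rewrite exprn_ile1.
by rewrite exprn_ge0 ?subr_ge0//= exprn_ile1 ?subr_ge0// gerBl.
Qed.

Lemma cvg_inv_nat (C : R) : C / n.+1%:R @[n --> \oo] --> 0.
Proof.
rewrite -(mulr0 C); apply: cvgMr; exact: cvg_harmonic.
Qed.

(** Below 1/2, Bernoulli's inequality leaves an error n (2x)^n, which tends to 0. From 1/2 on, 1 - y
    <= exp(-y) bounds the value by exp(- n (2x)^n) <= exp(-n) <= 1/n. *)
Lemma threshold_poly_cvg x : 0 <= x <= 1 ->
  threshold_poly n.+1 x @[n --> \oo] --> ((x < 2^-1)%R%:R : R).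
Proof.
move=> /andP[x0 x1]; have [xlt|xge] := ltP x 2^-1.
- have [x00|xn0] := eqVneq x 0.
    apply: cvg_near_cst; near=> n.
    by rewrite /threshold_poly x00 expr0n/= subr0 expr1n.
  pose t := - ln (2 * x).
  have x2 : 0 < 2 * x by rewrite mulr_gt0// lt_neqAle eq_sym xn0.
  have t0 : 0 < t by rewrite oppr_gt0 ln_lt0// x2/=; lra.
  apply: (@squeeze_cvgr _ _ _ _ (fun n => 1 - (4 / t ^+ 2) / n.+1%:R) (fun=> 1)); last 2 first.
  + by rewrite -[X in _ --> X]subr0; apply: cvgB; [exact: cvg_cst|exact: cvg_inv_nat].
  + exact: cvg_cst.
  near=> n; apply/andP; split; last first.
    by have /andP[] := @threshold_poly_itv n.+1 x (introT andP (conj x0 x1)).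
  apply: le_trans (bernoulli_sub _ _); last first.
    by rewrite exprn_ge0// exprn_ile1.
  rewrite lerB// natrM natrX -mulrA -exprMn.
  have -> : 2 * x = expR (- t) by rewrite opprK lnK.
  rewrite -expRM_natl.
  have n0 : (0 : R) < n.+1%:R by rewrite ltr0n.
  have -> : expR (n.+1%:R * - t) = (expR (n.+1%:R * t)) ^-1 by rewrite mulrN expRN.
  set y := n.+1%:R * t.
  have y0 : 0 < y by rewrite mulr_gt0.
  (* With 2x = exp(-t) and y = n t, this quadratic growth turns n (2x)^n into at most 4 / (t^2
     n). *)
  have hy : (y / 2) ^+ 2 <= expR y.
    rewrite (_ : y = (y / 2) *+ 2); last by field.
    rewrite -mulr_natl expRM_natl (_ : 2%:R * (y / 2) / 2 = y / 2); last by field.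
    rewrite lerXn2r ?nnegrE ?divr_ge0 ?expR_ge0 ?ltW//.
    by apply: le_lt_trans (expR_gt1Dx _); rewrite ?lerDr// gt_eqF// divr_gt0.
  rewrite ler_pdivrMr ?expR_gt0//.
  apply: (@le_trans _ _ ((4 / t ^+ 2) / n.+1%:R * (y / 2) ^+ 2)).
    by rewrite le_eqVlt; apply/orP; left; apply/eqP; rewrite /y; field; rewrite !gt_eqF.
  by rewrite ler_wpM2l// divr_ge0 ?ltW// divr_gt0// exprn_gt0.
- apply: (@squeeze_cvgr _ _ _ _ (fun=> 0) (fun n => 1 / n.+1%:R)); last 2 first.
  + exact: cvg_cst.
  + exact: cvg_inv_nat.
  near=> n; apply/andP; split.
    by have /andP[] := @threshold_poly_itv n.+1 x (introT andP (conj x0 x1)).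
  have n0 : (0 : R) < n.+1%:R by rewrite ltr0n.
  have p1 : x ^+ n.+1 <= 1 by rewrite exprn_ile1.
  apply: (@le_trans _ _ (expR (- x ^+ n.+1) ^+ (n.+1 * 2 ^ n.+1))).
    by rewrite /threshold_poly lerXn2r ?nnegrE ?subr_ge0 ?expR_ge0// expR_ge1Dx.
  rewrite -expRM_natl mulrN expRN div1r lef_pV2 ?posrE ?expR_gt0//.
  apply: (@le_trans _ _ (expR n.+1%:R)).
    by apply: le_trans (expR_ge1Dx _); rewrite lerDr.
  rewrite ler_expR natrM natrX -mulrA -exprMn -[leLHS]mulr1 ler_wpM2l//.
  by rewrite exprn_ege1// -ler_pdivrMl// mulr1.
Unshelve. all: by end_near. Qed.

End ThresholdPolynomials.

Section CramerWold.
Context {d : measure_display} {T : measurableType d} {R : realType}.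
Variable Q : probability T R.
Variable L : (T -> R) -> (T -> R) -> Prop.
Hypothesis Lm : forall u v, L u v -> measurable_fun setT u /\ measurable_fun setT v.
Hypothesis L_lin : forall a u v u' v', L u v -> L u' v' ->
  L (fun x => a * u x + u' x) (fun x => a * v x + v' x).
Hypothesis L0 : L (fun=> 0) (fun=> 0).
Hypothesis Lcos : forall u v th, L u v ->
  \int[Q]_x cos (u x + th) = \int[Q]_x cos (v x + th).
Implicit Types (f g u v m : T -> R).

Definition bounded_measurable f := measurable_fun setT f /\ exists M, forall x, `|f x| <= M.

Lemma bounded_measurable_integrable f : bounded_measurable f ->
  Q.-integrable setT (EFin \o f).
Proof.
move=> [mf [M HM]]; apply: measurable_bounded_integrable => //.
  by apply: (le_lt_trans (probability_le1 Q measurableT)); rewrite ltry.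
exists M; split; first exact: num_real.
by move=> y My x _; apply: le_trans (HM x) (ltW My).
Qed.

Lemma bounded_measurableM f g : bounded_measurable f -> bounded_measurable g ->
  bounded_measurable (fun x => f x * g x).
Proof.
move=> [mf [M HM]] [mg [N HN]]; split; first exact: measurable_funM.
by exists (M * N) => x; rewrite normrM ler_pM.
Qed.

Lemma bounded_measurable_lin a f g : bounded_measurable f -> bounded_measurable g ->
  bounded_measurable (fun x => a * f x + g x).
Proof.
move=> [mf [M HM]] [mg [N HN]]; split.
  by apply: measurable_funD => //; exact: measurable_funM.
exists (`|a| * M + N) => x; apply: (le_trans (ler_normD _ _)).
by rewrite normrM lerD// ler_wpM2l.
Qed.

Lemma bounded_measurable_cos u th : measurable_fun setT u ->
  bounded_measurable (fun x => cos (u x + th)).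
Proof.
move=> mu; split; last first.
  by exists 1 => x; rewrite ler_norml cos_geN1 cos_le1.
apply: measurableT_comp; last exact: measurable_funD.
by apply: continuous_measurable_fun; exact: continuous_cos.
Qed.

(** The signed measures with densities [f] and [g] have the same Fourier transform along paired
    functionals; the phase [th] carries cosine and sine together. *)
Definition same_transform f g := [/\ bounded_measurable f, bounded_measurable g &
  forall u v th, L u v ->
    \int[Q]_x (f x * cos (u x + th)) = \int[Q]_x (g x * cos (v x + th))].

(** Such pairs form an algebra, stable under bounded pointwise limits; this leads from cosines to
    indicators. *)
Definition multiplier m m' := [/\ bounded_measurable m, bounded_measurable m' &
  forall f g, same_transform f g ->
    same_transform (fun x => f x * m x) (fun x => g x * m' x)].

Lemma same_transform_lin a f g f' g' : same_transform f g -> same_transform f' g' ->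
  same_transform (fun x => a * f x + f' x) (fun x => a * g x + g' x).
Proof.
move=> [bf bg fg] [bf' bg' fg']; split; try exact: bounded_measurable_lin.
move=> u v th uv.
have [mu mv] := Lm uv.
have key (h h' w : T -> R) : bounded_measurable h -> bounded_measurable h' -> measurable_fun setT w ->
    \int[Q]_x ((a * h x + h' x) * cos (w x + th)) =
    a * \int[Q]_x (h x * cos (w x + th)) + \int[Q]_x (h' x * cos (w x + th)).
  move=> bh bh' mw; have bc := bounded_measurable_cos th mw.
  rewrite -RintegralZl//; last exact: bounded_measurable_integrable (bounded_measurableM _ _).
  rewrite -RintegralD//; last 2 first.
  - have := bounded_measurable_integrable (bounded_measurableM bh bc).
    by move=> /(integrableZl measurableT a); exact: eq_integrable.
  - exact: bounded_measurable_integrable (bounded_measurableM _ _).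
  by apply: eq_Rintegral => x _; ring.
by rewrite !key// (fg _ _ _ uv) (fg' _ _ _ uv).
Qed.

Lemma multiplier1 : multiplier (fun=> 1) (fun=> 1).
Proof.
have b1 : bounded_measurable (fun=> 1).
  by split => //; exists 1 => x; rewrite normr1.
split => // f g; congr same_transform; apply/funext => x; rewrite mulr1//.
Qed.

Lemma multiplier_lin a m m' n n' : multiplier m m' -> multiplier n n' ->
  multiplier (fun x => a * m x + n x) (fun x => a * m' x + n' x).
Proof.
move=> [bm bm' H] [bn bn' H']; split; try exact: bounded_measurable_lin.
move=> f g fg.
have := same_transform_lin a (H _ _ fg) (H' _ _ fg).
by congr same_transform; apply/funext => x; ring.
Qed.

Lemma multiplierM m m' n n' : multiplier m m' -> multiplier n n' ->
  multiplier (fun x => m x * n x) (fun x => m' x * n' x).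
Proof.
move=> [bm bm' H] [bn bn' H']; split; try exact: bounded_measurableM.
move=> f g fg.
have := H' _ _ (H _ _ fg).
by congr same_transform; apply/funext => x; ring.
Qed.

Lemma multiplierX m m' k : multiplier m m' ->
  multiplier (fun x => m x ^+ k) (fun x => m' x ^+ k).
Proof.
move=> H; elim: k => [|k IH]; first exact: multiplier1.
by have := multiplierM H IH; congr multiplier; apply/funext => x; rewrite exprS.
Qed.

(** The product-to-sum formula produces cosines at [u' + u] and [u' - u], whose frequencies are
    again paired because [L] is linear. *)
Lemma multiplier_cos u v th : L u v ->
  multiplier (fun x => cos (u x + th)) (fun x => cos (v x + th)).
Proof.
move=> uv; have [mu mv] := Lm uv.
split; try exact: bounded_measurable_cos.
move=> f g [bf bg fg]; split; try by apply: bounded_measurableM => //; exact: bounded_measurable_cos.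
move=> u' v' th' uv'.
have uvD := L_lin 1 uv uv'; have uvB := L_lin (-1) uv uv'.
have key (h w w' : T -> R) : bounded_measurable h -> measurable_fun setT w -> measurable_fun setT w' ->
    \int[Q]_x (h x * cos (w x + th) * cos (w' x + th')) =
    2^-1 * (\int[Q]_x (h x * cos ((1 * w x + w' x) + (th + th'))) +
            \int[Q]_x (h x * cos ((-1 * w x + w' x) + (th' - th)))).
  move=> bh mw mw'.
  have bi (s : T -> R) a : measurable_fun setT s -> Q.-integrable setT (EFin \o (fun x => h x * cos (s x + a))).
    move=> ms; apply: bounded_measurable_integrable; apply: bounded_measurableM => //.
    exact: bounded_measurable_cos.
  have m1 a : measurable_fun setT (fun x => a * w x + w' x).
    by apply: measurable_funD => //; exact: measurable_funM.
  rewrite -RintegralD//; try exact: bi.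
  rewrite -RintegralZl//; last first.
    by have := integrableD measurableT (bi _ (th + th') (m1 1)) (bi _ (th' - th) (m1 (-1))); exact: eq_integrable.
  apply: eq_Rintegral => x _.
  rewrite (_ : 1 * w x + w' x + (th + th') = (w' x + th') + (w x + th)); last by ring.
  rewrite (_ : -1 * w x + w' x + (th' - th) = (w' x + th') - (w x + th)); last by ring.
  by rewrite (cosD (w' x + th')) (cosB (w' x + th')); field.
have [mu' mv'] := Lm uv'.
by rewrite !key// (fg _ _ _ uvD) (fg _ _ _ uvB).
Qed.

Lemma multiplier_cvg (m m' : nat -> T -> R) (m0 m0' : T -> R) :
  (forall n, multiplier (m n) (m' n)) ->
  (forall n x, `|m n x| <= 1) -> (forall n x, `|m' n x| <= 1) ->
  (forall x, m n x @[n --> \oo] --> m0 x) -> (forall x, m' n x @[n --> \oo] --> m0' x) ->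
  multiplier m0 m0'.
Proof.
move=> mm m1 m1' cm cm'.
have bmlim (k : nat -> T -> R) (k0 : T -> R) : (forall n, bounded_measurable (k n)) ->
   (forall n x, `|k n x| <= 1) -> (forall x, k n x @[n --> \oo] --> k0 x) ->
   bounded_measurable k0.
  move=> bk k1 ck; split.
    apply: (@measurable_fun_cvg _ _ _ _ k) => [n|x _]; first exact: (bk n).1.
    exact: ck.
  exists 1 => x.
  have ck' : `|k n x| @[n --> \oo] --> `|k0 x| by apply: cvg_norm; exact: ck.
  rewrite -(cvg_lim (@Rhausdorff R) ck'); apply: limr_le; first exact: cvgP ck'.
  by near=> n; exact: k1.
have b0 : bounded_measurable m0 by apply: (bmlim m) => // n; have [] := mm n.
have b0' : bounded_measurable m0' by apply: (bmlim m') => // n; have [] := mm n.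
split => // f g fg; have [bf bg _] := fg.
split; try exact: bounded_measurableM.
move=> u v th uv; have [mu mv] := Lm uv.
have key (k : nat -> T -> R) (k0 h w : T -> R) : (forall n, bounded_measurable (k n)) ->
   (forall n x, `|k n x| <= 1) -> (forall x, k n x @[n --> \oo] --> k0 x) ->
   bounded_measurable h -> measurable_fun setT w -> bounded_measurable k0 ->
   \int[Q]_x (h x * k n x * cos (w x + th)) @[n --> \oo] --> \int[Q]_x (h x * k0 x * cos (w x + th)).
  move=> bk k1 ck bh mw bk0.
  have bc := bounded_measurable_cos th mw.
  apply: fine_cvg; rewrite fineK; last first.
    apply: integrable_fin_num => //; apply: bounded_measurable_integrable.
    by do 2 apply: bounded_measurableM => //.
  apply: (@dominated_cvg _ _ _ _ _ measurableT (fun n x => (h x * k n x * cos (w x + th))%:E) _ (fun x => `|h x|%:E)).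
  - move=> n; apply/measurable_EFinP.
    by have [] := bounded_measurableM (bounded_measurableM bh (bk n)) bc.
  - move=> x _; apply: cvg_EFin; first by near=> n.
    by apply: cvgMl; apply: cvgMr; exact: ck.
  - by [].
  - by have := bounded_measurable_integrable bh; exact: integrable_norm.
  - move=> n x _; rewrite /= lee_fin !normrM -mulrA ler_piMr//.
    by rewrite mulr_ile1// ler_norml cos_geN1 cos_le1.
have c1 := key _ _ f u (fun n => let: And3 b _ _ := mm n in b) m1 cm bf mu b0.
have c2 := key _ _ g v (fun n => let: And3 _ b _ := mm n in b) m1' cm' bg mv b0'.
have e : (fun n => \int[Q]_x (f x * m n x * cos (u x + th))) =
         (fun n => \int[Q]_x (g x * m' n x * cos (v x + th))).
  apply/funext => n; have [_ _ H] := mm n; have [_ _ Hn] := H _ _ fg; exact: Hn uv.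
rewrite e in c1.
by apply: cvg_unique c1 c2.
Unshelve. all: by end_near. Qed.

(** (1 + sin)/2 takes values in [0, 1] and is below 1/2 exactly where the sine is negative, so the
    threshold polynomials in it converge to the indicator. *)
Lemma multiplier_sin_lt0 u v th : L u v ->
  multiplier (fun x => (sin (u x + th) < 0)%R%:R) (fun x => (sin (v x + th) < 0)%R%:R).
Proof.
move=> uv.
pose p (w : T -> R) x := 2^-1 * cos (w x + (th - pi / 2)) + 2^-1.
have pE w x : p w x = (1 + sin (w x + th)) / 2.
  by rewrite /p addrA cosBpihalf; field.
have p01 w x : 0 <= p w x <= 1.
  rewrite pE; have := sin_geN1 (w x + th); have := sin_le1 (w x + th) => *.
  by apply/andP; split; lra.
have mp : multiplier (p u) (p v).
  have := multiplier_lin 2^-1 (multiplier_cos (th - pi / 2) uv)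
   (multiplier_lin 2^-1 multiplier1 (multiplier_lin (-1) multiplier1 multiplier1)).
  by congr multiplier; apply/funext => x; rewrite /p; field.
have half w x : (p w x < 2^-1) = (sin (w x + th) < 0).
  by rewrite pE; apply/idP/idP => *; lra.
have n1 w n x : `|threshold_poly n.+1 (p w x)| <= 1.
  by have /andP[a b] := threshold_poly_itv n.+1 (p01 w x); rewrite ger0_norm.
apply: (@multiplier_cvg (fun n x => threshold_poly n.+1 (p u x)) (fun n x => threshold_poly n.+1 (p v x))).
- move=> n; apply: multiplierX.
  have := multiplier_lin (-1) (multiplierX n.+1 mp) multiplier1.
  by congr multiplier; apply/funext => x; ring.
- by move=> n x; exact: n1.
- by move=> n x; exact: n1.
- by move=> x; rewrite -half; exact: threshold_poly_cvg.
- by move=> x; rewrite -half; exact: threshold_poly_cvg.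
Qed.

(** For n large enough, depending on the point, (u - c)/n lies within one arch of the sine, whose
    sign is then that of u - c. *)
Lemma multiplier_lt u v c : L u v ->
  multiplier (fun x => (u x < c)%R%:R) (fun x => (v x < c)%R%:R).
Proof.
move=> uv.
pose k (w : T -> R) n x : R := (sin ((n.+1%:R^-1 * w x + 0) + - (n.+1%:R^-1 * c)) < 0)%R%:R.
have kc w x : k w n x @[n --> \oo] --> ((w x < c)%R%:R : R).
  apply: cvg_near_cst; near=> n; rewrite /k; congr (nat_of_bool _)%:R.
  rewrite addr0 -mulrBr.
  set y := w x - c; have -> : (w x < c) = (y < 0) by rewrite subr_lt0.
  have n0 : (0 : R) < n.+1%:R by rewrite ltr0n.
  have ny : `|n.+1%:R^-1 * y| < 1.
    rewrite normrM gtr0_norm ?invr_gt0// ltr_pdivrMl// mulr1.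
    apply: (@lt_le_trans _ _ n%:R); last by rewrite ler_nat.
    by near: n; exact: nbhs_infty_gtr.
  have [y0|y0|->] := ltgtP y 0.
  - apply/idP; rewrite -oppr_gt0 -sinN sin2_gt0// -mulrN mulr_gt0 ?invr_gt0 ?oppr_gt0//=.
    by rewrite mulrN (le_lt_trans (ler_norm _))// normrN (lt_trans ny)// ltr1n.
  - apply/negbTE; rewrite -leNgt ltW// sin2_gt0// mulr_gt0 ?invr_gt0//=.
    by rewrite (le_lt_trans (ler_norm _))// (lt_trans ny)// ltr1n.
  - by rewrite mulr0 sin0 ltxx.
have b1 (b : bool) : `|b%:R : R| <= 1 by case: b; rewrite ?normr1 ?normr0.
apply: (@multiplier_cvg (k u) (k v)).
- by move=> n; apply: multiplier_sin_lt0; apply: L_lin.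
- by move=> n x; exact: b1.
- by move=> n x; exact: b1.
- by move=> x; exact: kc.
- by move=> x; exact: kc.
Unshelve. all: by end_near. Qed.

(* Multiplying by the indicator of a half-line, an iterated bounded limit of
   trigonometric polynomials, preserves equality of the transforms. *)
Lemma cramer_wold_orthant (I : Type) (u v : I -> T -> R) (c : I -> R) (J : seq I) :
  (forall i, L (u i) (v i)) ->
  Q [set x | all (fun i => u i x < c i) J] =
  Q [set x | all (fun i => v i x < c i) J].
Proof.
move=> Luv.
pose ind (w : I -> T -> R) x : R := (all (fun i => w i x < c i) J)%:R.
have mI : multiplier (ind u) (ind v).
  rewrite /ind; elim: J {ind} => [|i J IH]; first exact: multiplier1.
  have := multiplierM (multiplier_lt (c i) (Luv i)) IH.
  by congr multiplier; apply/funext => x /=; rewrite -natrM mulnb.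
have [[mI1 _] [mI2 _] H] := mI.
have s1 : same_transform (fun=> 1) (fun=> 1).
  have b1 : bounded_measurable (fun=> 1) by split => //; exists 1 => x; rewrite normr1.
  split => // u0 v0 th uv; under eq_Rintegral do rewrite mul1r.
  by under [in RHS]eq_Rintegral do rewrite mul1r; exact: Lcos.
have [_ _ /(_ _ _ 0 L0)] := H _ _ s1.
under eq_Rintegral do rewrite mul1r addr0 cos0 mulr1.
under [in RHS]eq_Rintegral do rewrite mul1r addr0 cos0 mulr1.
have key w : measurable_fun setT (ind w) ->
   (\int[Q]_x ind w x)%:E = Q [set x | all (fun i => w i x < c i) J].
  move=> mw; set A := [set x | _].
  have mA : measurable A.
    rewrite (_ : A = ind w @^-1` [set 1]).
      by rewrite -[X in measurable X]setTI; exact: mw.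
    apply/seteqP; split => x /=; rewrite /ind; first by move=> ->.
    by rewrite /A/=; case: all => //= /esym/eqP; rewrite oner_eq0.
  rewrite /Rintegral (_ : (\int[Q]_x (ind w x)%:E)%E = (\int[Q]_x (\1_A x)%:E)%E).
    by rewrite integral_indic// setIT fineK// fin_num_measure.
  apply: eq_integral => x _; rewrite indicE /ind; congr (nat_of_bool _)%:R%:E.
  by apply/idP/idP => [h|]; rewrite inE.
by move=> e; rewrite -(key u)// -(key v)// e.
Qed.

End CramerWold.

Lemma all_has_split (I : Type) (p q r : pred I) (J : seq I) :
  all p J -> ~~ all q J -> (forall i, p i -> ~~ q i -> ~~ r i) -> ~~ all r J.
Proof.
elim: J => //= i J IH /andP[pi pJ]; rewrite !negb_and => /orP[nq|nq] h.
  by rewrite h.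
by rewrite IH ?orbT.
Qed.

(** * Fernique's inequality *)

Section Fernique.
Context {dO : measure_display} {Omega : measurableType dO} {R : realType}.
Variable P : probability Omega R.
Variable G : set (Omega -> R).
Hypothesis HG : gaussian_space P G.
Implicit Types (Y Z : Omega -> R).

Let PP : probability (Omega * Omega)%type R := (P \x P)%E.

Lemma product_gaussian_law Y Z (g : R -> R) : G Y -> G Z ->
  continuous g -> (forall x, 0 <= g x) ->
  (\int[PP]_p (g (Y p.1 + Z p.2))%:E =
   \int[gauss (ip P Y Y + ip P Z Z)]_z (g z)%:E)%E.
Proof.
move=> GY GZ cg g0.
have mY := gspace_measurable HG GY; have mZ := gspace_measurable HG GZ.
have mg : measurable_fun [set: R] (fun x => (g x)%:E).
  by apply/measurable_EFinP; exact: continuous_measurable_fun.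
have [vY _ _ HY] := gaussian_facts (HG.1 _ GY).
have [vZ _ _ HZ] := gaussian_facts (HG.1 _ GZ).
rewrite !ip_sqr -gauss_convolution//.
rewrite /PP fubini_tonelli1/=; last 2 first.
- apply: (measurableT_comp mg); apply: measurable_funD.
    exact: (measurableT_comp mY measurable_fst).
  exact: (measurableT_comp mZ measurable_snd).
- by move=> p; rewrite lee_fin.
rewrite /fubini_F/= -HY; last 2 first.
- apply: (@measurable_fun_fubini_tonelli_F _ _ (measurableTypeR R) (measurableTypeR R) R (gauss _) (fun p => (g (p.1 + p.2))%:E)).
    by apply: (measurableT_comp mg); exact: measurable_funD.
  by move=> *; rewrite lee_fin.
- by move=> x; apply: integral_ge0 => y _; rewrite lee_fin.
apply: eq_integral => x _; rewrite -(HZ (fun z => (g (Y x + z))%:E))//.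
- apply: (measurableT_comp mg); exact: measurable_funD.
- by move=> z; rewrite lee_fin.
Qed.

Lemma product_gaussian_cos Y Z Y' Z' th : G Y -> G Z -> G Y' -> G Z' ->
  ip P Y Y + ip P Z Z = ip P Y' Y' + ip P Z' Z' ->
  \int[PP]_p cos (Y p.1 + Z p.2 + th) = \int[PP]_p cos (Y' p.1 + Z' p.2 + th).
Proof.
move=> GY GZ GY' GZ' e.
(* Adding 1 makes the integrand nonnegative, as the transfer of laws requires. *)
pose g x : R := 1 + cos (x + th).
have cg : continuous g.
  move=> x; apply: cvgD; first exact: cvg_cst.
  apply: (cvg_comp (fun x => x + th) cos); last exact: continuous_cos.
  by apply: cvgD; [exact: cvg_id|exact: cvg_cst].
have g0 x : 0 <= g x by rewrite /g -lerBlDl sub0r cos_geN1.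
have key A B : G A -> G B -> \int[PP]_p g (A p.1 + B p.2) =
   1 + \int[PP]_p cos (A p.1 + B p.2 + th).
  move=> GA GB; rewrite RintegralD//.
  - by rewrite Rintegral_cst//= probability_setT mul1r.
  - exact: finite_measure_integrable_cst.
  - apply: bounded_measurable_integrable; apply: bounded_measurable_cos.
    apply: measurable_funD.
      exact: (measurableT_comp (gspace_measurable HG GA) measurable_fst).
    exact: (measurableT_comp (gspace_measurable HG GB) measurable_snd).
apply: (@addrI _ 1); rewrite -!key//.
by rewrite /Rintegral (product_gaussian_law GY GZ cg g0) (product_gaussian_law GY' GZ' cg g0) e.
Qed.

Let c : R := (Num.sqrt 2)^-1.

Let c2 : c ^+ 2 = 2^-1.
Proof. by rewrite /c exprVn sqr_sqrtr. Qed.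

(* Pairs (u, v) where v is u after rotating (w1, w2) by 45 degrees. *)
Definition rotated (u v : Omega * Omega -> R) := exists Y Z, [/\ G Y, G Z,
  u = (fun p => Y p.1 + Z p.2) &
  v = (fun p => (c * Y p.1 + c * Z p.1) + (c * Z p.2 - c * Y p.2))].

Lemma rotated_measurable u v : rotated u v ->
  measurable_fun setT u /\ measurable_fun setT v.
Proof.
move=> [Y [Z [GY GZ -> ->]]].
have mY := gspace_measurable HG GY; have mZ := gspace_measurable HG GZ.
have m1 := measurableT_comp mY (@measurable_fst _ _ Omega Omega).
have m2 := measurableT_comp mY (@measurable_snd _ _ Omega Omega).
have m3 := measurableT_comp mZ (@measurable_fst _ _ Omega Omega).
have m4 := measurableT_comp mZ (@measurable_snd _ _ Omega Omega).
split; first exact: measurable_funD.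
apply: measurable_funD; first by apply: measurable_funD; exact: measurable_funM.
by apply: measurable_funB; exact: measurable_funM.
Qed.

Lemma rotated_lin a u v u' v' : rotated u v -> rotated u' v' ->
  rotated (fun x => a * u x + u' x) (fun x => a * v x + v' x).
Proof.
move=> [Y [Z [GY GZ -> ->]]] [Y' [Z' [GY' GZ' -> ->]]].
exists (fun w => a * Y w + Y' w), (fun w => a * Z w + Z' w); split.
- exact: HG.2.1.
- exact: HG.2.1.
- by apply/funext => p; ring.
- by apply/funext => p; ring.
Qed.

Lemma rotated_cos u v th : rotated u v ->
  \int[PP]_x cos (u x + th) = \int[PP]_x cos (v x + th).
Proof.
move=> [Y [Z [GY GZ -> ->]]].
have GcY := gspaceZ HG c GY; have GcZ := gspaceZ HG c GZ.
have Gp := gspaceD HG GcY GcZ; have Gm := gspaceB HG GcZ GcY.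
rewrite (@product_gaussian_cos Y Z (fun w => c * Y w + c * Z w) (fun w => c * Z w - c * Y w))//.
pose p w := c * Y w + c * Z w; pose m w := c * Z w - c * Y w.
have Lp A : G A -> ip P p A = c * ip P Y A + c * ip P Z A.
  by move=> GA; rewrite (ip_linear HG)// (ipZ HG).
have Lm A : G A -> ip P m A = c * ip P Z A - c * ip P Y A.
  by move=> GA; rewrite (ipB HG)// !(ipZ HG).
rewrite -/p -/m Lp// Lm// (ipC P Y p) (ipC P Z p) (ipC P Y m) (ipC P Z m) !Lp// !Lm//.
rewrite (ipC P Z Y).
suff : ip P Y Y + ip P Z Z = 2 * c ^+ 2 * (ip P Y Y + ip P Z Z) by move=> ->; ring.
by rewrite c2 divff// mul1r.
Qed.

Variables (I : Type) (f : I -> Omega -> R) (J : seq I).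
Hypothesis Gf : forall i, G (f i).

Definition norm_lt (s : R) := [set w | all (fun i => `|f i w| < s) J].

Lemma measurable_norm_lt (s : R) : measurable (norm_lt s).
Proof.
rewrite /norm_lt; elim: J => [|i J' IH].
  by rewrite (_ : [set _ | _] = setT)//; apply/seteqP; split.
rewrite (_ : [set _ | _] = (fun w => `|f i w|) @^-1` `]-oo, s[ `&`
    [set w | all (fun i => `|f i w| < s) J']).
  apply: measurableI => //; rewrite -[X in measurable X]setTI.
  apply: (measurableT_comp (@normr_measurable _ setT)) => //.
  exact: (gspace_measurable HG).
by apply/seteqP; split => w /=; rewrite in_itv/= => /andP.
Qed.

Lemma norm_lt_mono (s t : R) : s <= t -> norm_lt s `<=` norm_lt t.
Proof.
by move=> st w /=; apply: sub_all => i /lt_le_trans; apply.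
Qed.

(** The left side is the probability that the first of two independent copies has maximum below s
    and the second at least t. After the rotation this concerns (f(w1) - f(w2))/sqrt 2 and (f(w1) +
    f(w2))/sqrt 2. At an index where the sum is large the difference is small, so both f(w1) and
    f(w2) exceed (t - s)/sqrt 2 in absolute value there; independence gives the square. *)
Lemma fernique_rotation (s t : R) :
  (P (norm_lt s) * P (~` norm_lt t) <=
   P (~` norm_lt ((t - s) * c)) * P (~` norm_lt ((t - s) * c)))%E.
Proof.
have mN := measurable_norm_lt.
(* The index holds the variable, a sign and the copy; the sign splits |x| < s into two one-sided
   bounds, so that the events become orthants. *)
pose u (k : I * bool * bool) (p : Omega * Omega) : R :=
  (-1) ^+ k.1.2 * f k.1.1 (if k.2 then p.2 else p.1).
pose v (k : I * bool * bool) (p : Omega * Omega) : R :=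
  (-1) ^+ k.1.2 * c * (if k.2 then f k.1.1 p.1 + f k.1.1 p.2 else f k.1.1 p.1 - f k.1.1 p.2).
have Luv k : rotated (u k) (v k).
  case: k => -[i b] []; rewrite /u /v/=.
  - exists (fun=> 0), (fun w => (-1) ^+ b * f i w); split.
    + exact: gspace0 HG.
    + exact: (gspaceZ HG).
    + by apply/funext => p; rewrite add0r.
    + by apply/funext => p; ring.
  - exists (fun w => (-1) ^+ b * f i w), (fun=> 0); split.
    + exact: (gspaceZ HG).
    + exact: gspace0 HG.
    + by apply/funext => p; rewrite addr0.
    + by apply/funext => p; ring.
have L0 : rotated (fun=> 0) (fun=> 0).
  exists (fun=> 0), (fun=> 0); split; try exact: gspace0 HG.
    by apply/funext => p; rewrite addr0.
  by apply/funext => p; rewrite !mulr0 subrr !addr0.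
pose cc (k : I * bool * bool) := if k.2 then t else s.
pose K (b : bool) := [seq (i, false, b) | i <- J] ++ [seq (i, true, b) | i <- J].
have allK b (w : I * bool * bool -> R) (x : I -> R) : (forall i, w (i, false, b) = x i) ->
    (forall i, w (i, true, b) = - x i) ->
    all (fun k => w k < cc k) (K b) = all (fun i => `|x i| < (if b then t else s)) J.
  move=> w1 w2; rewrite all_cat !all_map -all_predI; apply: eq_all => i /=.
  by rewrite w1 w2 /cc/= ltr_norml ltrNl andbC.
have cw := cramer_wold_orthant rotated_measurable rotated_lin L0 rotated_cos cc _ Luv.
have uA p : all (fun k => u k p < cc k) (K false) = all (fun i => `|f i p.1| < s) J.
  by apply: (allK false) => i; rewrite /u/= ?expr0 ?expr1 ?mul1r ?mulN1r.
have uB p : all (fun k => u k p < cc k) (K true) = all (fun i => `|f i p.2| < t) J.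
  by apply: (allK true) => i; rewrite /u/= ?expr0 ?expr1 ?mul1r ?mulN1r.
have vA p : all (fun k => v k p < cc k) (K false) = all (fun i => `|c * (f i p.1 - f i p.2)| < s) J.
  by apply: (allK false) => i; rewrite /v/= ?expr0 ?expr1 ?mul1r ?mulN1r ?mulNr.
have vB p : all (fun k => v k p < cc k) (K true) = all (fun i => `|c * (f i p.1 + f i p.2)| < t) J.
  by apply: (allK true) => i; rewrite /v/= ?expr0 ?expr1 ?mul1r ?mulN1r ?mulNr.
pose Au := [set p | all (fun k => u k p < cc k) (K false)].
pose Bu := [set p | all (fun k => u k p < cc k) (K true)].
pose Av := [set p | all (fun k => v k p < cc k) (K false)].
pose Bv := [set p | all (fun k => v k p < cc k) (K true)].
have mall (w : I * bool * bool -> Omega * Omega -> R) (S : seq (I * bool * bool)) :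
   (forall k, measurable_fun setT (w k)) -> measurable [set p | all (fun k => w k p < cc k) S].
  move=> mw; elim: S => [|k S IH].
    by rewrite (_ : [set _ | _] = setT)//; apply/seteqP; split.
  rewrite (_ : [set _ | _] = w k @^-1` `]-oo, cc k[ `&`
      [set p | all (fun k => w k p < cc k) S]).
    by apply: measurableI => //; rewrite -[X in measurable X]setTI; exact: mw.
  by apply/seteqP; split => p /=; rewrite in_itv/= => /andP.
have mu k : measurable_fun setT (u k) by have [] := rotated_measurable (Luv k).
have mv k : measurable_fun setT (v k) by have [] := rotated_measurable (Luv k).
(* A difference is not an orthant, but its probability is P(A) - P(A and B), where both events
   are. *)
have ABu : PP (Au `\` Bu) = PP (Av `\` Bv).
  rewrite !measureD ?(le_lt_trans (probability_le1 _ _)) ?ltry//; try exact: mall.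
  congr (_ - _)%E; first exact: cw.
  have := cw (K false ++ K true).
  by congr (_ = _); congr (PP _); apply/seteqP; split => p /=; rewrite all_cat => /andP.
rewrite -!product_measure1E -/PP; try exact: measurableC; try exact: mN.
rewrite (_ : _ `*` _ = Au `\` Bu); last first.
  by apply/seteqP; split => p /=; rewrite /Au /Bu /norm_lt/= uA uB.
rewrite ABu le_measure// ?inE.
- by apply: measurableD; exact: mall.
- by apply: measurableX; apply: measurableC.
move=> p [] /=; rewrite /Av /Bv/= vA vB => hA hB.
have nr (x : I -> R) : (forall i, `|c * (f i p.1 - f i p.2)| < s ->
    ~~ (`|c * (f i p.1 + f i p.2)| < t) -> (t - s) * c <= `|x i|) ->
    ~ all (fun i => `|x i| < (t - s) * c) J.
  move=> H; apply/negP; apply: all_has_split hA (introN idP hB) _ => i p1 p2.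
  by rewrite -leNgt; exact: H.
have c0 : 0 < c by rewrite invr_gt0 sqrtr_gt0.
have half (x y : R) : `|c * (x - y)| < s -> t <= `|c * (x + y)| -> (t - s) * c <= `|x|.
  move=> xs xt.
  have e : x = c * (c * (x - y) + c * (x + y)).
    by rewrite -mulrDr mulrA -expr2 c2; field.
  rewrite e normrM (gtr0_norm c0) mulrC ler_wpM2l// ?ltW//.
  have := ler_normB (c * (x - y) + c * (x + y)) (c * (x - y)).
  by rewrite addrAC subrr add0r; lra.
split; apply: nr => i p1 p2.
- by apply: half p1 _; rewrite leNgt.
- apply: (@half _ (f i p.1)); last by rewrite addrC leNgt.
  by rewrite -opprB mulrN normrN.
Qed.

(** Along the levels t' = s + sqrt 2 t the rotation inequality squares the ratio p/q, which starts
    at most at (1 - q)/q <= 1/3. The levels grow like sqrt 2 ^ n, so 2^n is of the order of (t/s)^2,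
    which is the Gaussian decay. *)
Lemma fernique (s t : R) : 0 < s -> ((3 / 4)%:E <= P (norm_lt s))%E -> 4 * s <= t ->
  (P (~` norm_lt t) <= (expR (- (t ^+ 2 / (48 * s ^+ 2))))%:E)%E.
Proof.
move=> s0 Ps st.
pose p r := fine (P (~` norm_lt r)).
have mN r : measurable (~` norm_lt r) by apply: measurableC; exact: measurable_norm_lt.
have pE r : P (~` norm_lt r) = (p r)%:E by rewrite /p fineK// fin_num_measure.
pose q := fine (P (norm_lt s)).
have qE : P (norm_lt s) = q%:E by rewrite /q fineK// fin_num_measure//; exact: measurable_norm_lt.
have q34 : 3 / 4 <= q by rewrite -lee_fin -qE.
have q1 : q <= 1 by rewrite -lee_fin -qE probability_le1//; exact: measurable_norm_lt.
have p0 r : 0 <= p r by rewrite /p fine_ge0.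
have ps : p s = 1 - q.
  apply: EFin_inj; rewrite -pE probability_setC ?qE//; exact: measurable_norm_lt.
have rot r r' : r = (r' - s) * c -> q * p r' <= p r ^+ 2.
  by move=> ->; rewrite -lee_fin expr2 !EFinM -!pE -qE; exact: fernique_rotation.
have pmono r r' : r <= r' -> p r' <= p r.
  move=> rr; rewrite -lee_fin -!pE le_measure ?inE//.
  by apply: subsetC; exact: norm_lt_mono.
pose sq : R := Num.sqrt 2.
have sq2 : sq ^+ 2 = 2 by rewrite sqr_sqrtr.
have sq0 : 0 < sq by rewrite sqrtr_gt0.
pose tt := fix tt n := if n is k.+1 then s + sq * tt k else s.
(* The value at n = 0 is s; the constant -3 survives the recursion because 3 sqrt 2 >= 4. *)
have tt_ub n : tt n <= s * (4 * sq ^+ n - 3).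
  elim: n => [|n IH] /=; first by rewrite expr0; lra.
  have sq43 : 4 / 3 <= sq.
    by rewrite -(@ler_pXn2r _ 2) ?nnegrE ?ltW// sq2; lra.
  rewrite exprS; have := ler_wpM2l (ltW sq0) IH; move: (sq ^+ n) => x.
  by nra.
have ptt n : p (tt n) <= q * 3^-1 ^+ (2 ^ n).
  elim: n => [|n IH] /=; first by rewrite ps expr1; lra.
  have := rot (tt n) (s + sq * tt n); rewrite addrAC subrr add0r /c -/sq.
  rewrite mulrAC divff ?gt_eqF// mul1r => /(_ erefl) H.
  rewrite expnS mulnC exprM.
  have q0 : 0 < q by lra.
  rewrite -(ler_pM2l q0) (le_trans H)//.
  rewrite mulrA -expr2 -exprMn lerXn2r// nnegrE; first exact: p0.
  by rewrite mulr_ge0 ?(ltW q0)// exprn_ge0// invr_ge0.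
(* Choosing 2^n <= x < 2^(n+1) makes 4 s sqrt 2 ^ n at most t. Since 1/3 <= exp(-2/3) and 2^n > x/2,
   the exponent is at least x/3, whence 48 = 16 * 3. *)
pose x := t ^+ 2 / (16 * s ^+ 2).
have ss0 : 0 < 16 * s ^+ 2 by rewrite mulr_gt0// exprn_gt0.
have x1 : 1 <= x.
  by rewrite /x ler_pdivlMr// mul1r; nra.
pose n := trunc_log 2 (truncn x).
have tx : (0 < truncn x)%N by rewrite truncn_gt0.
have /andP[n1 n2] := trunc_log_bounds (isT : (1 < 2)%N) tx.
have nx : (2 ^ n)%:R <= x.
  by apply: le_trans (_ : (truncn x)%:R <= _); [rewrite ler_nat|rewrite truncn_le; lra].
have xn : x < (2 ^ n.+1)%:R.
  by apply: lt_le_trans (truncnS_gt x) _; rewrite ler_nat.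
have tn : tt n <= t.
  apply: le_trans (tt_ub n) _.
  have h : 4 * s * sq ^+ n <= t.
    have t0 : 0 < t by lra.
    rewrite -(@ler_pXn2r _ 2) ?nnegrE ?(ltW t0) ?mulr_ge0 ?exprn_ge0 ?(ltW sq0) ?(ltW s0)//.
    rewrite !exprMn -exprM mulnC exprM sq2.
    move: nx; rewrite natrX /x ler_pdivlMr// => H; apply: le_trans H.
    by rewrite le_eqVlt; apply/orP; left; apply/eqP; ring.
  by nra.
rewrite pE lee_fin (le_trans (pmono _ _ tn))// (le_trans (ptt n))//.
apply: (@le_trans _ _ (expR (- (2 / 3)) ^+ (2 ^ n))).
  apply: (@le_trans _ _ (3^-1 ^+ (2 ^ n))).
    by rewrite ler_piMl// exprn_ge0.
  rewrite lerXn2r ?nnegrE ?expR_ge0//.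
  by have := expR_ge1Dx (- (2 / 3) : R); lra.
rewrite -expRM_natl ler_expR.
have -> : t ^+ 2 / (48 * s ^+ 2) = x / 3.
  by rewrite /x; field; rewrite gt_eqF.
by move: xn; rewrite expnS natrM; lra.
Qed.

End Fernique.

(** * Oscillation of a Gaussian field on a compact set *)

Section CompactNets.
Context {R : realType} {d : nat}.
Implicit Types (T : set 'rV[R]_d) (s t : 'rV[R]_d).

Lemma compact_gauge_net T (r : 'rV[R]_d -> R) : compact T ->
  (forall t, T t -> 0 < r t) ->
  exists l : seq 'rV[R]_d, (forall t, t \in l -> T t) /\
    forall x, T x -> exists2 t, t \in l & `|x - t| < r t.
Proof.
rewrite compact_cover => cT r0.
have [||D DT Dc] := cT _ T (fun t => ball t (r t)).
- by move=> t Tt; apply: ball_open; exact: r0.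
- by move=> t Tt; exists t => //; apply: ballxx; exact: r0.
exists (finmap.enum_fset D); split.
  by move=> t tD; have := DT t tD; rewrite inE.
move=> x /Dc[t /= tD xt]; exists t => //.
by move: xt; rewrite -ball_normE/= distrC.
Qed.

Lemma compact_net T (e : R) : compact T -> 0 < e ->
  exists l : seq 'rV[R]_d, (forall t, t \in l -> T t) /\
    forall x, T x -> exists2 t, t \in l & `|x - t| < e.
Proof. by move=> cT e0; apply: (@compact_gauge_net T (fun=> e)). Qed.

Lemma within_continuous_dist T (f : 'rV[R]_d -> R) t (e : R) :
  {within T, continuous f} -> T t -> 0 < e ->
  exists2 r, 0 < r & forall s, T s -> `|s - t| < r -> `|f s - f t| < e.
Proof.
move=> /subspace_continuousP cf Tt e0.
have /cvgrPdist_lt/(_ _ e0) := cf _ Tt.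
rewrite near_withinE/= near_simpl => /nbhs_ballP[r /= r0 H]; exists r => //.
move=> s Ts st; rewrite distrC; apply: H => //.
by rewrite -ball_normE/= distrC.
Qed.

Lemma compact_unif_continuous T (f : 'rV[R]_d -> R) (e : R) :
  compact T -> {within T, continuous f} -> 0 < e ->
  exists2 r, 0 < r & forall s t, T s -> T t -> `|s - t| < r -> `|f s - f t| < e.
Proof.
move=> cT cf e0.
have e20 : 0 < e / 2 by rewrite divr_gt0.
have /choice[g Hg] : forall t, exists r, 0 < r /\
    (T t -> forall s, T s -> `|s - t| < r -> `|f s - f t| < e / 2).
  move=> t; have [Tt|nTt] := pselect (T t); last by exists 1.
  by have [r r0 H] := within_continuous_dist cf Tt e20; exists r.
have [|l [lT lc]] := @compact_gauge_net T (fun t => g t / 2) cT.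
  by move=> t _; rewrite divr_gt0//; case: (Hg t).
have [r r0 Hr] : exists2 r, 0 < r & forall t, t \in l -> r <= g t / 2.
  elim: {lT lc} l => [|t l [r r0 IH]]; first by exists 1.
  exists (minr r (g t / 2)).
    by rewrite lt_min r0 divr_gt0//; case: (Hg t).
  move=> x; rewrite inE ge_min => /orP[/eqP ->|/IH ->//].
  by rewrite lexx orbT.
exists r => // s t Ts Tt st.
have [x xl xs] := lc _ Ts; have [gx0 /(_ (lT _ xl)) Hx] := Hg x.
have stx : `|s - t| < g x / 2.
  by apply: lt_le_trans st _; exact: Hr.
have h1 : `|f s - f x| < e / 2 by apply: Hx => //; lra.
have h2 : `|f t - f x| < e / 2.
  apply: Hx => //; have := ler_distD s t x; rewrite (distrC t s); lra.
by have := ler_distD (f x) (f s) (f t); rewrite (distrC (f x)); lra.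
Qed.

Lemma compact_dense_sequence T : compact T -> T !=set0 ->
  exists D : nat -> 'rV[R]_d, (forall n, T (D n)) /\
    forall t (e : R), T t -> 0 < e -> exists n, `|t - D n| < e.
Proof.
move=> cT [a Ta].
have /choice[l Hl] : forall n : nat, exists l : seq 'rV[R]_d,
    (forall t, t \in l -> T t) /\
    forall x, T x -> exists2 t, t \in l & `|x - t| < n.+1%:R^-1.
  by move=> n; apply: compact_net => //; rewrite invr_gt0.
(* Nets of mesh 1/(i+1) are merged by numbering the pairs (i, j); [a] fills the numbers that code
   nothing. *)
pose D n := if @unpickle (nat * nat)%type n is Some (i, j) then nth a (l i) j else a.
exists D; split.
  move=> n; rewrite /D; case: unpickle => // -[i j].
  have [jl|jl] := ltnP j (size (l i)); last by rewrite nth_default.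
  by apply: (Hl i).1; exact: mem_nth.
move=> t e Tt e0.
have [i ie] : exists i : nat, i.+1%:R^-1 < e.
  have [i _ Hi] := near_infty_natSinv_lt (PosNum e0).
  by exists i; apply: (Hi i) => /=.
have [x xl tx] := (Hl i).2 _ Tt.
exists (pickle (i, index x (l i))); rewrite /D pickleK nth_index//.
exact: lt_trans tx ie.
Qed.

End CompactNets.

Section FieldSpace.
Context {dO : measure_display} {Omega : measurableType dO} {R : realType}.
Variable P : probability Omega R.
Context {d : nat}.
Variables (T : set 'rV[R]_d) (X : 'rV[R]_d -> Omega -> R).
Hypothesis gX : centered_gaussian_field P T X.

Definition field_space : set (Omega -> R) :=
  [set Y | exists s : seq ('rV[R]_d * R), (forall p, p \in s -> T p.1) /\ Y = lincomb X s].

Lemma field_spaceP : gaussian_space P field_space.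
Proof.
split; first by move=> Y [s [sT ->]]; exact: gX.2.
split; last first.
  by exists [::]; split => //; apply/funext => w; rewrite /lincomb big_nil.
move=> a Y Z [s [sT ->]] [r [rT ->]].
exists ([seq (p.1, a * p.2) | p <- s] ++ r); split.
  move=> p; rewrite mem_cat => /orP[/mapP[q qs ->]|]; first by apply: (sT q).
  exact: rT.
apply/funext => w; rewrite /lincomb big_cat big_map mulr_sumr/=.
by congr (_ + _); apply: eq_bigr => p _; rewrite mulrA.
Qed.

Lemma field_space_point t : T t -> field_space (X t).
Proof.
move=> Tt; exists [:: (t, 1)]; split; first by move=> p; rewrite inE => /eqP ->.
by apply/funext => w; rewrite /lincomb big_seq1 mul1r.
Qed.

Lemma field_space_incr s t : T s -> T t -> field_space (fun w => X s w - X t w).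
Proof.
by move=> Ts Tt; apply: (gspaceB field_spaceP); exact: field_space_point.
Qed.

Hypothesis cT : compact T.
Hypothesis cX : forall w, {within T, continuous (fun t => X t w)}.

Definition osc_le (eta M : R) : set Omega :=
  [set w | forall s t, T s -> T t -> `|s - t| < eta -> `|X s w - X t w| <= M].

Section DenseOscillation.
Variable D : nat -> 'rV[R]_d.
Hypothesis DT : forall n, T (D n).
Hypothesis Dd : forall t (e : R), T t -> 0 < e -> exists n, `|t - D n| < e.

(** Restricting to countably many points makes the event measurable and a countable limit of events
    to which Fernique's inequality applies. The strict bound here weakens to the non-strict one of
    [osc_le] on passing to limits of points. *)
Definition dense_osc_lt (eta M : R) : set Omega :=
  [set w | forall i j, `|D i - D j| < eta -> `|X (D i) w - X (D j) w| < M].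

Lemma measurable_incr s t : T s -> T t ->
  measurable_fun setT (fun w => `|X s w - X t w|).
Proof.
move=> Ts Tt; apply: (measurableT_comp (@normr_measurable _ setT)) => //.
exact: (gspace_measurable field_spaceP) (field_space_incr Ts Tt).
Qed.

Lemma dense_osc_ltE eta M : dense_osc_lt eta M =
  \bigcap_i \bigcap_j [set w | `|D i - D j| < eta -> `|X (D i) w - X (D j) w| < M].
Proof.
apply/seteqP; split => w /= H; first by move=> i _ j _; exact: H.
by move=> i j; exact: (H i I j I).
Qed.

Lemma measurable_dense_osc_lt eta M : measurable (dense_osc_lt eta M).
Proof.
rewrite dense_osc_ltE; apply: bigcapT_measurable => i; apply: bigcapT_measurable => j.
case: (ltP `|D i - D j| eta) => ij; last first.
  by rewrite (_ : [set _ | _] = setT)//; apply/seteqP; split.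
rewrite (_ : [set _ | _] = (fun w => `|X (D i) w - X (D j) w|) @^-1` `]-oo, M[).
  by rewrite -[X in measurable X]setTI; apply: measurable_incr.
by apply/seteqP; split => w /=; rewrite in_itv/= => // H; exact: H.
Qed.

Lemma dense_osc_osc eta M : dense_osc_lt eta M `<=` osc_le eta M.
Proof.
move=> w H s t Ts Tt st; apply/ler_addgt0Pr => e e0.
have e20 : 0 < e / 2 by rewrite divr_gt0.
have [r1 r10 H1] := within_continuous_dist (@cX w) Ts e20.
have [r2 r20 H2] := within_continuous_dist (@cX w) Tt e20.
have g0 : 0 < (eta - `|s - t|) / 2 by rewrite divr_gt0// subr_gt0.
have m1 : 0 < minr r1 ((eta - `|s - t|) / 2) by rewrite lt_min r10.
have m2 : 0 < minr r2 ((eta - `|s - t|) / 2) by rewrite lt_min r20.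
have [i] := Dd Ts m1; rewrite lt_min => /andP[i1 i2].
have [j] := Dd Tt m2; rewrite lt_min => /andP[j1 j2].
have Dij : `|D i - D j| < eta.
  have := ler_distD s (D i) (D j); have := ler_distD t s (D j).
  by rewrite (distrC (D i) s); lra.
have h1 : `|X (D i) w - X s w| < e / 2 by apply: H1; rewrite ?(distrC (D i)).
have h2 : `|X (D j) w - X t w| < e / 2 by apply: H2; rewrite ?(distrC (D j)).
have := ler_distD (X (D i) w) (X s w) (X t w).
have := ler_distD (X (D j) w) (X (D i) w) (X t w).
by have := H _ _ Dij; rewrite (distrC (X (D i) w)) in h1; lra.
Qed.

(** Each sample path is uniformly continuous on the compact set, so these events increase to the
    whole space as the mesh shrinks; 3/4 is the mass that Fernique's inequality asks for. *)
Lemma dense_osc_eventually (M : R) : 0 < M ->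
  exists2 eta, 0 < eta & ((3 / 4)%:E <= P (dense_osc_lt eta M))%E.
Proof.
move=> M0.
pose F n := dense_osc_lt n.+1%:R^-1 M.
have mF n : measurable (F n) by exact: measurable_dense_osc_lt.
have FT : \bigcup_n F n = setT.
  apply/seteqP; split => // w _.
  have [r r0 H] := compact_unif_continuous cT (@cX w) M0.
  have [i _ Hi] := near_infty_natSinv_lt (PosNum r0).
  exists i => // k l kl; apply: H => //.
  by apply: lt_trans kl _; exact: (Hi i (leqnn i)).
have ndF : {homo F : n m / (n <= m)%N >-> (n <= m)%O}.
  move=> n m nm; apply/subsetPset => w H i j ij; apply: H.
  by apply: lt_le_trans ij _; rewrite lef_pV2 ?posrE// ler_nat.
have := nondecreasing_cvg_mu (mu := P) mF (bigcupT_measurable _ mF) ndF.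
rewrite FT => cP.
have [n Hn] : exists n, ((3 / 4)%:E <= P (F n))%E.
  apply: contrapT => /forallNP H.
  have : (P setT <= (3 / 4)%:E)%E.
    apply: (cvge_le _ cP); near=> n; rewrite ltW// ltNge; apply/negP; exact: H.
  by rewrite probability_setT lee_fin; lra.
by exists n.+1%:R^-1.
Unshelve. all: by end_near. Qed.

(** Fernique's inequality is applied to the increments with indices below k; its bound does not
    depend on k, and the exceptional events increase with k. *)
Lemma dense_osc_tail eta s M : 0 < s -> 4 * s <= M ->
  ((3 / 4)%:E <= P (dense_osc_lt eta s))%E ->
  (P (~` dense_osc_lt eta M) <= (expR (- (M ^+ 2 / (48 * s ^+ 2))))%:E)%E.
Proof.
move=> s0 sM Ps.
pose f (p : nat * nat) w := X (D p.1) w - X (D p.2) w.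
pose J k : seq (nat * nat) := [seq p <- allpairs pair (iota 0 k) (iota 0 k) | `|D p.1 - D p.2| < eta].
have Gf p : field_space (f p) by exact: field_space_incr.
have sub k r : dense_osc_lt eta r `<=` norm_lt f (J k) r.
  by move=> w H; apply/allP => p; rewrite mem_filter => /andP[pe _]; exact: H.
pose F k := ~` norm_lt f (J k) M.
have mF k : measurable (F k).
  by apply: measurableC; exact: (measurable_norm_lt field_spaceP).
have FU : \bigcup_k F k = ~` dense_osc_lt eta M.
  rewrite -setC_bigcap; congr (~` _); apply/seteqP; split => w H; last by move=> k _; exact: sub H.
  move=> i j ij; have /allP/(_ (i, j)) := H (maxn i j).+1 I; apply.
  rewrite mem_filter; apply/andP; split => //; apply: allpairs_f;
    by rewrite mem_iota/= add0n ltnS ?leq_maxl ?leq_maxr.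
have ndF : {homo F : n m / (n <= m)%N >-> (n <= m)%O}.
  move=> n m nm; apply/subsetPset; apply: subsetC => w /allP H; apply/allP => p.
  rewrite mem_filter => /andP[pe /allpairsP[[i j] [/= hi hj pij]]].
  apply: H; rewrite mem_filter pe andTb pij; apply: allpairs_f.
    by move: hi; rewrite !mem_iota/= !add0n => /leq_trans; apply.
  by move: hj; rewrite !mem_iota/= !add0n => /leq_trans; apply.
have := nondecreasing_cvg_mu (mu := P) mF (bigcupT_measurable _ mF) ndF.
rewrite FU => cP; apply: (cvge_le _ cP); near=> k.
apply: (fernique field_spaceP) => //.
apply: le_trans Ps _; apply: le_measure; rewrite ?inE.
- exact: measurable_dense_osc_lt.
- exact: (measurable_norm_lt field_spaceP).
- exact: sub.
Unshelve. all: by end_near. Qed.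

End DenseOscillation.

(* Otherwise the Gaussian density of Y would be too flat to put mass 3/4 on [-M, M]. *)
Lemma variance_le Y (M : R) (A : set Omega) : field_space Y -> 0 < M ->
  measurable A -> ((3 / 4)%:E <= P A)%E -> (forall w, A w -> `|Y w| <= M) ->
  ip P Y Y <= 2 * M ^+ 2.
Proof.
move=> GY M0 mA PA AM.
have [_ _ _ HY] := gaussian_facts (field_spaceP.1 _ GY).
set v := ip P Y Y.
have v0 : 0 <= v by exact: ip_ge0.
have [->|vn] := eqVneq v 0; first by rewrite mulr_ge0// sqr_ge0.
have vp : 0 < v by rewrite lt_neqAle eq_sym vn.
pose B : set (measurableTypeR R) := `[- M, M]%classic.
have mB : measurable B by exact: measurable_itv.
have PB : (P A <= gauss v B)%E.
  rewrite -(gspace_law field_spaceP GY mB); apply: le_measure; rewrite ?inE//.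
    rewrite -[X in measurable X]setTI.
    exact: (gspace_measurable field_spaceP GY).
  by move=> w /AM; rewrite /B/= in_itv/= ler_norml.
have r0 : Num.sqrt v != 0 by rewrite gt_eqF// sqrtr_gt0.
have ub : (gauss v B <= (normal_peak (Num.sqrt v) * (2 * M))%:E)%E.
  rewrite /gauss (negbTE vn)/= /normal_prob.
  apply: (@le_trans _ _ (\int[lebesgue_measure]_(x in B) (normal_peak (Num.sqrt v))%:E)%E).
    apply: ge0_le_integral => //.
    - by move=> x _; rewrite lee_fin normal_pdf_ge0.
    - apply/measurable_EFinP; apply: measurable_funTS; exact: measurable_normal_pdf.
    - by move=> x _; rewrite lee_fin normal_pdf_ub.
  rewrite integral_cst//= lebesgue_measure_itv/= lte_fin ifT; last by lra.
  by rewrite -EFinB -EFinM lee_fin; rewrite opprK -mulr2n mulr_natl.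
have := le_trans PA (le_trans PB ub); rewrite lee_fin.
rewrite /normal_peak sqr_sqrtr// => h.
have pg := pi_ge2 R.
have q0 : 0 < Num.sqrt (v * pi *+ 2) by rewrite sqrtr_gt0 mulrn_wgt0// mulr_gt0// pi_gt0.
have qq : Num.sqrt (v * pi *+ 2) ^+ 2 = v * pi *+ 2.
  by rewrite sqr_sqrtr// mulrn_wge0// mulr_ge0// pi_ge0.
move: h; rewrite ler_pdivlMl// => h.
have : v * 4 <= (8 / 3 * M) ^+ 2.
  apply: (@le_trans _ _ (Num.sqrt (v * pi *+ 2) ^+ 2)).
    rewrite qq -mulr_natr; nra.
  rewrite lerXn2r ?nnegrE ?(ltW q0)//; last by lra.
  by rewrite mulr_ge0// ltW.
by have := sqr_ge0 M; lra.
Qed.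

(** The freedom is in the reference level s: a finer mesh brings the oscillation below any s with
    probability 3/4, and the tail at delta u then has rate delta^2 / (48 s^2), which is as large as
    desired. *)
Lemma field_oscillation (K delta theta : R) : T !=set0 -> 0 < delta -> 0 < theta ->
  exists eta, [/\ 0 < eta,
    forall s t, T s -> T t -> `|s - t| < eta ->
      ip P (fun w => X s w - X t w) (fun w => X s w - X t w) <= theta &
    forall u, 1 <= u -> exists B, [/\ measurable B,
      (P B <= (expR (- (K * u ^+ 2)))%:E)%E & ~` B `<=` osc_le eta (delta * u)]].
Proof.
move=> T0 d0 th0.
have [D [DT Dd]] := compact_dense_sequence cT T0.
(* The three bounds serve in turn the condition 4 s <= delta u, the rate K (as 49 >= 48), and the
   variance of increments, which is at most 2 s^2 <= theta. *)
pose s := minr (delta / 4) (minr (delta / (7 * (`|K| + 1))) (Num.sqrt (theta / 2))).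
have K0 : 0 < 7 * (`|K| + 1) by rewrite mulr_gt0// ltr_wpDl.
have s0 : 0 < s by rewrite !lt_min !divr_gt0//= sqrtr_gt0 divr_gt0.
have s1 : 4 * s <= delta.
  by rewrite mulrC -ler_pdivlMr// /s ge_min lexx.
have s2 : 48 * s ^+ 2 * (`|K| + 1) <= delta ^+ 2.
  have : s <= delta / (7 * (`|K| + 1)) by rewrite /s !ge_min lexx orbT.
  rewrite ler_pdivlMr// => h.
  have h2 : (s * (7 * (`|K| + 1))) ^+ 2 <= delta ^+ 2.
    by rewrite lerXn2r// nnegrE ltW// mulr_gt0.
  apply: le_trans h2; have := normr_ge0 K; have := ltW (exprn_gt0 2 s0).
  by nra.
have s3 : 2 * s ^+ 2 <= theta.
  have : s <= Num.sqrt (theta / 2) by rewrite /s !ge_min lexx !orbT.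
  move=> h; have : s ^+ 2 <= Num.sqrt (theta / 2) ^+ 2.
    by rewrite lerXn2r// nnegrE ?sqrtr_ge0// ltW.
  by rewrite sqr_sqrtr; [lra|rewrite divr_ge0// ltW].
have [eta eta0 Peta] := dense_osc_eventually DT s0.
have mS := measurable_dense_osc_lt DT.
exists eta; split => //.
- move=> x y Tx Ty xy; apply: le_trans s3.
  apply: (variance_le (field_space_incr Tx Ty) s0 (mS eta s) Peta) => w.
  by move=> /(dense_osc_osc DT Dd)/(_ _ _ Tx Ty xy).
- move=> u u1; exists (~` dense_osc_lt D eta (delta * u)); split.
  + exact: measurableC.
  + apply: le_trans (dense_osc_tail DT s0 _ Peta) _; first by nra.
    rewrite lee_fin ler_expR lerN2 ler_pdivlMr ?mulr_gt0 ?exprn_gt0//.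
    rewrite exprMn; have := ler_norm K.
    have U0 : 0 <= u ^+ 2 by rewrite sqr_ge0.
    have S0 := sqr_ge0 s => Kn.
    have h : K * (48 * s ^+ 2) <= delta ^+ 2.
      apply: le_trans s2; rewrite mulrC ler_wpM2l ?mulr_ge0//; lra.
    by have := ler_wpM2r U0 h; congr (_ <= _); ring.
  + by rewrite setCK; exact: dense_osc_osc.
Qed.

End FieldSpace.

(** * Large deviations of Gaussian vectors *)

Lemma continuous_sum (T : topologicalType) (R : realType) (I : Type) (r : seq I)
    (F : I -> T -> R) :
  (forall i, continuous (F i)) -> continuous (fun x => \sum_(i <- r) F i x).
Proof.
move=> cF x; elim: r => [|i r IH].
  rewrite (_ : (fun y => _) = (fun=> 0)); first exact: cvg_cst.
  by apply/funext => y; rewrite big_nil.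
rewrite (_ : (fun y => _) = (fun y => F i y + \sum_(j <- r) F j y)).
  by apply: cvgD; [exact: cF|exact: IH].
by apply/funext => y; rewrite big_cons.
Qed.

Section GaussianTilting.
Context {dO : measure_display} {Omega : measurableType dO} {R : realType}.
Variable P : probability Omega R.
Variable G : set (Omega -> R).
Hypothesis HG : gaussian_space P G.
Implicit Types (Y Z H : Omega -> R).

Local Notation ip := (ip P).

Lemma gspace_exp_integral Y (k : R) : G Y ->
  (\int[P]_w (expR (Y w + k))%:E = (expR (ip Y Y / 2 + k))%:E)%E.
Proof.
move=> GY; rewrite expRD EFinM -(gspace_mgf HG GY) -ge0_integralZr//=.
- by apply: eq_integral => w _; rewrite expRD EFinM.
- apply/measurable_EFinP; apply: measurableT_comp => //.
  exact: (gspace_measurable HG GY).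
Qed.

Lemma measurable_exp Y (k : R) : G Y -> measurable_fun setT (fun w => (expR (Y w + k))%:E).
Proof.
move=> GY; apply/measurable_EFinP; apply: measurableT_comp => //.
by apply: measurable_funD => //; exact: (gspace_measurable HG GY).
Qed.

Lemma ip_lin2 (a : R) Y Z : G Y -> G Z ->
  ip (fun w => a * Y w + Z w) (fun w => a * Y w + Z w) =
  a ^+ 2 * ip Y Y + 2 * a * ip Y Z + ip Z Z.
Proof.
move=> GY GZ; have GW := HG.2.1 a _ _ GY GZ.
rewrite (ip_linear HG)// (ipC P Y) (ipC P Z) !(ip_linear HG)// (ipC P Z Y).
by ring.
Qed.

Lemma ip_scale2 (a : R) Y : G Y ->
  ip (fun w => a * Y w) (fun w => a * Y w) = a ^+ 2 * ip Y Y.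
Proof.
move=> GY; have GW := gspaceZ HG a GY.
by rewrite (ipZ HG)// ipC (ipZ HG)// mulrA -expr2.
Qed.

Lemma measurable_ge Y (x : R) : G Y -> measurable [set w | x <= Y w].
Proof.
move=> GY; rewrite (_ : [set _ | _] = Y @^-1` `[x, +oo[).
  rewrite -[X in measurable X]setTI; exact: (gspace_measurable HG GY).
by apply/seteqP; split => w /=; rewrite in_itv/= andbT.
Qed.

Lemma chernoff Y (x th : R) : G Y -> 0 <= th ->
  (P [set w | (x <= Y w)%R] <= (expR (th ^+ 2 * ip Y Y / 2 - th * x))%:E)%E.
Proof.
move=> GY th0; have GZ := gspaceZ HG th GY.
rewrite -ip_scale2// -gspace_exp_integral//.
have mA := measurable_ge x GY.
rewrite -(setIT [set _ | _]) -integral_indic//.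
apply: ge0_le_integral => //.
- by apply/measurable_EFinP; exact: measurable_indic.
- exact: measurable_exp.
- move=> w _; rewrite lee_fin indicE.
  case: (boolP (w \in _)) => [|_]; last exact: expR_ge0.
  rewrite inE/= => xY; rewrite -[leLHS]expR0 ler_expR -mulrBr mulr_ge0//.
  by rewrite subr_ge0.
Qed.

Section Minimax.
Variables (n : nat) (f : 'I_n -> Omega -> R) (S : {set 'I_n}).
Hypothesis Gf : forall i, G (f i).

Definition face_weights (la : 'I_n -> R) :=
  [/\ forall i, 0 <= la i, \sum_i la i = 1 & forall i, i \notin S -> la i = 0].

(** This is the first-order condition at a minimum of the variance on the face of the simplex
    spanned by [S]: moving the weights towards a vertex i of that face cannot decrease it. *)
Lemma convex_equalizer i0 : i0 \in S -> exists la, face_weights la /\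
  let Y := fun w => \sum_i la i * f i w in
  forall i, i \in S -> ip Y Y <= ip (f i) Y.
Proof.
move=> i0S.
pose comb (la : 'I_n -> R) w := \sum_i la i * f i w.
have Gc la : G (comb la) by exact: (gspace_sum HG).
pose q (la : 'rV[R]_n) : R := \sum_i \sum_j (la ord0 i * la ord0 j) * ip (f i) (f j).
have qE la : q la = ip (comb (la ord0)) (comb (la ord0)).
  rewrite (ip_sum HG)//; apply: eq_bigr => i _; rewrite ipC (ip_sum HG)// mulr_sumr.
  by apply: eq_bigr => j _; rewrite mulrA ipC.
pose A : set 'rV[R]_n := [set la | face_weights (la ord0)].
have A0 : A !=set0.
  exists (delta_mx ord0 i0); split.
  - by move=> i; rewrite mxE; case: (_ && _).
  - rewrite (bigD1 i0)//= mxE !eqxx/= big1 ?addr0// => i ii0.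
    by rewrite mxE eqxx (negbTE ii0).
  - by move=> i iS; rewrite mxE eqxx/=; case: eqP => // ii0; rewrite ii0 i0S in iS.
have cA : compact A.
  have cc i := @coord_continuous R 1 n ord0 i.
  have cK : compact [set v : 'rV[R]_n | forall i, `[0, 1]%classic (v ord0 i)].
    by apply: (@rV_compact _ _ (fun _ : 'I_n => (`[0, 1]%classic : set R))) => i; exact: segment_compact.
  apply: (subclosed_compact _ cK).
    rewrite (_ : A = (\bigcap_i [set v : 'rV[R]_n | 0 <= v ord0 i]) `&`
      ([set v : 'rV[R]_n | \sum_i v ord0 i = 1] `&`
       \bigcap_(i in [set i | i \notin S]) [set v : 'rV[R]_n | v ord0 i = 0])).
      apply: closedI; last apply: closedI.
      - apply: closed_bigI => i _.
        by apply: (preimage_closed (D := [set x : R | 0 <= x])) => [x _|]; [exact: cc|exact: closed_ge].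
      - apply: (preimage_closed (D := [set x : R | x = 1])) => [x _|]; last exact: closed_eq.
        by apply: continuous_sum => i; exact: cc.
      - apply: closed_bigI => i _.
        by apply: (preimage_closed (D := [set x : R | x = 0])) => [x _|]; [exact: cc|exact: closed_eq].
    apply/seteqP; split => v.
      by move=> [v0 v1 vS]; split; [move=> i _; exact: v0|split => // i /= iS; exact: vS].
    by move=> [v0 [v1 vS]]; split => [i||i iS]; [exact: v0|exact: v1|exact: vS].
  move=> v [v0 v1 _] i; rewrite /= in_itv/= v0/= -v1 (bigD1 i)//= lerDl.
  by apply: sumr_ge0 => j _; exact: v0.
have cq : {within A, continuous q}.
  apply: continuous_subspaceT.
  apply: continuous_sum => i; apply: continuous_sum => j la.
  exact: (cvgM (cvgM (@coord_continuous _ _ _ ord0 i la) (@coord_continuous _ _ _ ord0 j la)) (cvg_cst _)).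
have [la lA Hmin] := EVT_min_rV A0 cA cq.
exists (la ord0); split; first exact/set_mem.
move=> Y i iS; rewrite leNgt; apply/negP => lt.
have [la0 la1 laS] : face_weights (la ord0) by exact/set_mem.
set V := ip Y Y in lt *; set b := ip (f i) Y in lt *.
pose D := V - 2 * b + ip (f i) (f i).
have D0 : 0 <= D.
  have GY : G Y := Gc (la ord0).
  rewrite (_ : D = ip (fun w => -1 * Y w + f i w) (fun w => -1 * Y w + f i w)); first exact: ip_ge0.
  by rewrite ip_lin2// (ipC P Y) -/b -/V /D; ring.
(* Moving by e towards vertex i changes the variance to V - 2 e (V - b) + e^2 D, where D is the
   squared distance from Y to f i. This e lies in (0, 1] and satisfies e D < V - b, also when D =
   0. *)
pose e := (V - b) / (D + (V - b)).
have g0 : 0 < V - b by rewrite subr_gt0.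
have De : 0 < D + (V - b) by rewrite ltr_wpDl.
have e0 : 0 < e by rewrite divr_gt0.
have e1 : e <= 1 by rewrite ler_pdivrMr// mul1r lerDr.
pose la' : 'rV[R]_n := \row_j ((1 - e) * la ord0 j + e * (j == i)%:R).
have A' : A la'.
  split.
  - by move=> j; rewrite mxE addr_ge0// mulr_ge0// ?subr_ge0// ltW.
  - under eq_bigr do rewrite mxE.
    rewrite big_split/= -!mulr_sumr la1 mulr1.
    by rewrite (bigD1 i)//= eqxx big1 ?addr0 ?mulr1 ?subrK// => j /negbTE ->.
  - move=> j jS; rewrite mxE laS// mulr0 add0r; case: eqP => [ji|]; last by rewrite mulr0.
    by rewrite ji iS in jS.
have := Hmin la' (mem_set A').
rewrite !qE -/Y -/V.
have -> : comb (la' ord0) = (fun w => (1 - e) * Y w + (e * f i w)).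
  apply/funext => w; rewrite /comb /Y mulr_sumr.
  under eq_bigr do rewrite mxE mulrDl.
  rewrite big_split/=; congr (_ + _); first by apply: eq_bigr => j _; rewrite mulrA.
  by rewrite (bigD1 i)//= eqxx mulr1 big1 ?addr0// => j /negbTE ->; rewrite mulr0 mul0r.
have GY : G Y := Gc (la ord0).
have GZ : G (fun w => e * f i w) by exact: (gspaceZ HG).
rewrite ip_lin2// ip_scale2// -/V (ipC P Y) (ipZ HG)// -/b.
have eD : e * D < V - b.
  by rewrite /e mulrAC ltr_pdivrMr// ltr_pM2l// ltrDl.
have := ltr_pM2l e0 (e * D) (V - b); rewrite eD => /idP h1.
have h2 := mulr_gt0 e0 g0.
rewrite /D in h1.
by nra.
Qed.

End Minimax.

(** A union bound over all subsets S, then Chernoff for the combination attached to S. The parameter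
    c x is used instead of the optimal x / E Y^2, so that a null variance needs no separate
    treatment; c E Y^2 <= 1 then gives the exponent - c x^2 / 2. *)
Lemma gaussian_orthants_upper (n : nat) (f : 'I_n -> Omega -> R)
    (good : pred {set 'I_n}) (c x : R) (A : set Omega) :
  (forall i, G (f i)) -> 0 <= c -> 0 <= x -> measurable A ->
  (forall S, good S -> exists2 la, face_weights S la &
    let Y := fun w => \sum_i la i * f i w in c * ip Y Y <= 1) ->
  (forall w, A w -> exists2 S, good S & forall i, i \in S -> x <= f i w) ->
  (P A <= ((2 ^ n)%:R * expR (- (c * x ^+ 2 / 2)))%:E)%E.
Proof.
move=> Gf c0 x0 mA Hg HA.
have /choice[la Hla] : forall S, exists la, good S -> face_weights S la /\
    c * ip (fun w => \sum_i la i * f i w) (fun w => \sum_i la i * f i w) <= 1.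
  move=> S; have [gS|] := boolP (good S); last by exists (fun=> 0).
  by have [la h1 h2] := Hg _ gS; exists la.
pose Y S w := \sum_i la S i * f i w.
have GY S : G (Y S) by exact: (gspace_sum HG).
pose E S := if good S then [set w | x <= Y S w] else set0.
have mE S : measurable (E S) by rewrite /E; case: ifP => // _; exact: measurable_ge.
have sub : A `<=` \big[setU/set0]_(S : {set 'I_n}) E S.
  move=> w /HA[S gS HS]; rewrite -bigcup_seq; exists S => /=; first by rewrite mem_index_enum.
  rewrite /E gS/=; have [[la0 la1 laS] _] := Hla _ gS.
  rewrite -[leLHS]mul1r -la1 mulr_suml; apply: ler_sum => i _.
  have [iS|iS] := boolP (i \in S); first by rewrite ler_wpM2l// HS.
  by rewrite laS// !mul0r.
apply: (@le_trans _ _ (P (\big[setU/set0]_(S : {set 'I_n}) E S))).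
  by apply: le_measure; rewrite ?inE//; exact: bigsetU_measurable.
apply: (@le_trans _ _ (\sum_(S : {set 'I_n}) P (E S))%E).
  elim: (index_enum _) => [|S r IH]; first by rewrite !big_nil measure0.
  rewrite !big_cons; apply: le_trans (measureU2 _ _ _) _ => //.
    exact: bigsetU_measurable.
  by rewrite leeD2l.
apply: (@le_trans _ _ (\sum_(S : {set 'I_n}) (expR (- (c * x ^+ 2 / 2)))%:E)%E).
  apply: lee_sum => S _; rewrite /E; case: ifPn => [gS|_]; last first.
    by rewrite measure0 lee_fin expR_ge0.
  have cx0 : 0 <= c * x by rewrite mulr_ge0.
  apply: le_trans (chernoff x (GY S) cx0) _.
  rewrite lee_fin ler_expR; have [_ h] := Hla _ gS.
  have := ler_wpM2l (mulr_ge0 c0 (sqr_ge0 x)) h.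
  by rewrite -/(Y S); nra.
have cS : #|{: {set 'I_n}}| = (2 ^ n)%N.
  by rewrite -cardsT -powersetT card_powerset cardsT card_ord.
by rewrite sumEFin lee_fin sumr_const cS mulr_natl.
Qed.

(** The tilted measure is never formed. E exp(u H) = exp(u^2 s2 / 2) is split instead: on A with H
    not too large the integrand is at most exp(u^2 (s2 + eps)), and every other region contributes
    less than the total by a factor exp(- k u^2). What remains bounds P(A) from below. *)
Lemma gaussian_tilting_lower (n : nat) (f : 'I_n -> Omega -> R) H (delta eps : R) :
  (forall i, G (f i)) -> G H -> 0 < delta -> 0 < eps ->
  (forall i, 1 + 2 * delta <= ip (f i) H) ->
  exists2 u0, 1 <= u0 & forall (u : R) (A B : set Omega), u0 <= u -> measurable A -> measurable B ->
    (P B <= (expR (- ((2 * ip H H + 2) * u ^+ 2)))%:E)%E ->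
    (forall w, ~ B w -> (forall i, (1 + delta) * u < f i w) -> A w) ->
    ((2^-1 * expR (- ((ip H H / 2 + eps) * u ^+ 2)))%:E <= P A)%E.
Proof.
move=> Gf GH d0 e0 Hf; set s2 := ip H H.
have s20 : 0 <= s2 by exact: ip_ge0.
(* Chernoff slope for f i. Under the tilt its mean is at least (1 + 2 delta) u, so lying below (1 +
   delta) u is a deviation of delta u, with gain [ki]; the + 1 guards against a null variance. [be]
   and [k1] do the same for H. *)
pose b i := delta / (ip (f i) (f i) + 1).
have r0 i : 0 < ip (f i) (f i) + 1 by rewrite ltr_wpDl// ip_ge0.
pose ki i := delta ^+ 2 / (2 * (ip (f i) (f i) + 1)).
pose k1 := eps ^+ 2 / (2 * (s2 + 1)).
have s21 : 0 < s2 + 1 by rewrite ltr_wpDl.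
have [k [k0 kle1 kk1 kki]] : exists k, [/\ 0 < k, k <= 1, k <= k1 & forall i, k <= ki i].
  pose k := minr (minr 1 k1) (\big[minr/1]_i ki i).
  exists k; split.
  - rewrite !lt_min ltr01/= /k1 divr_gt0 ?exprn_gt0 ?mulr_gt0//=.
    elim/big_ind : _ => // [x y x0 y0|i _]; first by rewrite lt_min x0.
    by rewrite divr_gt0 ?exprn_gt0 ?mulr_gt0.
  - by rewrite !ge_min lexx.
  - by rewrite !ge_min lexx orbT.
  - by move=> i; rewrite !ge_min (bigD1 i)//= ge_min lexx !orbT.
(* Number of error terms: the n variables f i, the excess of H, and two for B. The threshold makes k
   u^2 >= 2 N, hence N exp(- k u^2) <= 1/2. *)
pose N : R := (n + 3)%:R.
have N0 : 0 < N by rewrite ltr0n addn3.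
exists (1 + 2 * N / k); first by rewrite lerDl divr_ge0 ?mulr_ge0 ?ltW.
move=> u A B uu0 mA mB PB HAB.
have u1 : 1 <= u by apply: le_trans uu0; rewrite lerDl divr_ge0 ?mulr_ge0 ?ltW.
have u0 : 0 < u by lra.
pose be := eps / (s2 + 1).
have be0 : 0 < be by rewrite divr_gt0.
have b0 i : 0 < b i by rewrite divr_gt0.
(* On B the integrand is cut at exp(u^2 M). Against the assumed bound on P(B) the lower part
   contributes exp(- u^2), and so does the upper part, through exp(2 u H - u^2 M). *)
pose M := 2 * s2 + 1.
pose U := u ^+ 2.
have U0 : 0 < U by rewrite exprn_gt0.
pose T0 w := expR (U * (s2 + eps)) * \1_A w.
pose T1 w := expR ((u * (1 + be)) * H w + - (be * U * (s2 + eps))).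
pose T2 i w := expR ((u * H w + - (b i * u) * f i w) + b i * U * (1 + delta)).
pose T3 w := expR ((2 * u) * H w + - (U * M)).
pose T4 w := expR (U * M) * \1_B w.
(* Pointwise, one term suffices in each region: [T1] for H large, [T0] on A, [T3] and [T4] on B, and
   some [T2 i] elsewhere, since outside A and B some f i is too small. *)
have pw w : expR (u * H w) <= T0 w + (T1 w + (\sum_i T2 i w + (T3 w + T4 w))).
  have t0 : 0 <= T0 w by rewrite mulr_ge0// expR_ge0.
  have t1 : 0 <= T1 w by exact: expR_ge0.
  have t2 : 0 <= \sum_i T2 i w by apply: sumr_ge0 => i _; exact: expR_ge0.
  have t3 : 0 <= T3 w by exact: expR_ge0.
  have t4 : 0 <= T4 w by rewrite mulr_ge0// expR_ge0.
  have [Hbig|Hsmall] := ltP (u * (s2 + eps)) (H w).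
    suff : expR (u * H w) <= T1 w by lra.
    rewrite ler_expR; rewrite -subr_gt0 in Hbig.
    by have := mulr_gt0 (mulr_gt0 u0 be0) Hbig; rewrite /U; nra.
  have [Aw|nAw] := pselect (A w).
    suff : expR (u * H w) <= T0 w by lra.
    rewrite /T0 indicE mem_set// mulr1 ler_expR /U.
    by have := ler_wpM2l (ltW u0) Hsmall; nra.
  have [Bw|nBw] := pselect (B w).
    suff : expR (u * H w) <= T3 w + T4 w by lra.
    rewrite /T4 indicE mem_set// mulr1.
    have [h|h] := leP (u * H w) (U * M).
      by apply: (@le_trans _ _ (expR (U * M))); [rewrite ler_expR|rewrite lerDr].
    apply: (@le_trans _ _ (T3 w)); last by rewrite lerDl expR_ge0.
    by rewrite ler_expR; lra.
  have [i fi] : exists i, f i w <= (1 + delta) * u.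
    apply: contrapT => /forallNP h; apply: nAw; apply: HAB => // i.
    by rewrite ltNge; apply/negP; exact: h.
  suff : expR (u * H w) <= \sum_i T2 i w by lra.
  rewrite (bigD1 i)//=; apply: (@le_trans _ _ (T2 i w)); last first.
    by rewrite lerDl; apply: sumr_ge0 => j _; exact: expR_ge0.
  rewrite ler_expR /U; rewrite -subr_ge0 in fi.
  by have := mulr_ge0 (ltW (mulr_gt0 (b0 i) u0)) fi; nra.
have GuH a : G (fun w => a * H w) by exact: (gspaceZ HG).
have G2 i : G (fun w => u * H w + - (b i * u) * f i w).
  exact: (gspaceD HG (GuH u) (gspaceZ HG _ (Gf i))).
have mEx Y kk : G Y -> measurable_fun setT (fun w => (expR (Y w + kk))%:E) by exact: measurable_exp.
have mT0 : measurable_fun setT (fun w => (T0 w)%:E).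
  by apply/measurable_EFinP; apply: measurable_funM => //; exact: measurable_indic.
have mT4 : measurable_fun setT (fun w => (T4 w)%:E).
  by apply/measurable_EFinP; apply: measurable_funM => //; exact: measurable_indic.
have mT1 : measurable_fun setT (fun w => (T1 w)%:E) by exact: mEx.
have mT3 : measurable_fun setT (fun w => (T3 w)%:E) by exact: mEx.
have mT2 i : measurable_fun setT (fun w => (T2 i w)%:E) by exact: mEx.
have iI (C : set Omega) (a : R) : measurable C -> 0 <= a ->
    (\int[P]_w (a * \1_C w)%:E = a%:E * P C)%E.
  move=> mC a0; under eq_integral do rewrite EFinM.
  rewrite ge0_integralZl//= ?integral_indic ?setIT//.
  by apply/measurable_EFinP; exact: measurable_indic.
have I2 i : (\int[P]_w (T2 i w)%:E <= (expR (U * (s2 / 2) - k * U))%:E)%E.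
  rewrite gspace_exp_integral// lee_fin ler_expR ip_lin2//; last exact: (gspaceZ HG).
  rewrite ip_scale2// (ipC P H) (ipZ HG)// -/s2.
  set w := ip (f i) H; set r := ip (f i) (f i).
  have hw : 1 + 2 * delta <= w by exact: Hf.
  have hr : 0 < r + 1 by exact: r0.
  have hb : b i * (r + 1) = delta by rewrite /b divfK// gt_eqF.
  have hk : k <= b i * delta / 2.
    by apply: le_trans (kki i) _; rewrite le_eqVlt; apply/orP; left; apply/eqP; rewrite /ki /b; field; rewrite -/r gt_eqF.
  have h1 : 0 <= b i * (w - 1 - 2 * delta) by rewrite mulr_ge0 ?(ltW (b0 i))//; lra.
  have h2 : b i * (b i * r) <= b i * delta.
    by rewrite ler_wpM2l ?(ltW (b0 i))// -hb ler_wpM2l ?(ltW (b0 i))// lerDl.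
  have h3 : 0 <= U * (- (- b i * w + b i * (b i * r) / 2 + b i * (1 + delta) + k)).
    by rewrite mulr_ge0 ?(ltW U0)//; lra.
  by rewrite -subr_ge0; apply: le_trans h3 _; rewrite le_eqVlt /U; apply/orP; left; apply/eqP; field.
have I1 : (\int[P]_w (T1 w)%:E <= (expR (U * (s2 / 2) - k * U))%:E)%E.
  rewrite gspace_exp_integral// lee_fin ler_expR ip_scale2// -/s2.
  have hb : be * (s2 + 1) = eps by rewrite /be divfK// gt_eqF.
  have hk : k <= be * eps / 2.
    by apply: le_trans kk1 _; rewrite le_eqVlt; apply/orP; left; apply/eqP; rewrite /k1 /be; field; rewrite gt_eqF.
  have h2 : be * (be * s2) <= be * eps.
    by rewrite ler_wpM2l ?(ltW be0)// -hb ler_wpM2l ?(ltW be0)// lerDl.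
  have h3 : 0 <= U * (be * eps - be * (be * s2) / 2 - k) by rewrite mulr_ge0 ?(ltW U0)//; lra.
  by rewrite -subr_ge0; apply: le_trans h3 _; rewrite le_eqVlt /U; apply/orP; left; apply/eqP; field.
have I3 : (\int[P]_w (T3 w)%:E <= (expR (U * (s2 / 2) - k * U))%:E)%E.
  rewrite gspace_exp_integral// lee_fin ler_expR ip_scale2// -/s2 /M.
  have h3 : 0 <= U * (s2 / 2 + (1 - k)) by rewrite mulr_ge0 ?(ltW U0)//; lra.
  by rewrite -subr_ge0; apply: le_trans h3 _; rewrite le_eqVlt /U; apply/orP; left; apply/eqP; field.
have I4 : (\int[P]_w (T4 w)%:E <= (expR (U * (s2 / 2) - k * U))%:E)%E.
  rewrite iI ?expR_ge0//; apply: (@le_trans _ _ ((expR (U * M))%:E * (expR (- ((2 * s2 + 2) * u ^+ 2)))%:E)%E).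
    by rewrite lee_pmul2l// lte_fin expR_gt0.
  rewrite -EFinM -expRD lee_fin ler_expR -/U /M.
  have h3 : 0 <= U * (s2 / 2 + (1 - k)) by rewrite mulr_ge0 ?(ltW U0)//; lra.
  by rewrite -subr_ge0; apply: le_trans h3 _; rewrite le_eqVlt; apply/orP; left; apply/eqP; field.
have main : ((expR (s2 * U / 2))%:E <= (expR (U * (s2 + eps)))%:E * P A +
     (N * expR (U * (s2 / 2) - k * U))%:E)%E.
  have := gspace_mgf HG (GuH u); rewrite ip_scale2// -/s2 -/U (mulrC U) => <-.
  apply: (@le_trans _ _ (\int[P]_w ((T0 w)%:E + ((T1 w)%:E + ((\sum_i (T2 i w)%:E) + ((T3 w)%:E + (T4 w)%:E)))))%E).
    apply: ge0_le_integral => //.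
    - by apply/measurable_EFinP; apply: measurableT_comp => //; exact: (gspace_measurable HG).
    - do 2 (apply: emeasurable_funD => //); apply: emeasurable_funD; last exact: emeasurable_funD.
      exact: emeasurable_sum.
    - by move=> w _; rewrite sumEFin -!EFinD lee_fin.
  have p0 w : (0 <= (T0 w)%:E)%E by rewrite lee_fin mulr_ge0// expR_ge0.
  have p1 w : (0 <= (T1 w)%:E)%E by rewrite lee_fin expR_ge0.
  have p2 i w : (0 <= (T2 i w)%:E)%E by rewrite lee_fin expR_ge0.
  have p3 w : (0 <= (T3 w)%:E)%E by rewrite lee_fin expR_ge0.
  have p4 w : (0 <= (T4 w)%:E)%E by rewrite lee_fin mulr_ge0// expR_ge0.
  have mS : measurable_fun setT (fun w => \sum_i (T2 i w)%:E)%E by exact: emeasurable_sum.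
  have pS w : (0 <= \sum_i (T2 i w)%:E)%E by apply: sume_ge0.
  rewrite ge0_integralD//; last 2 first.
    by move=> w _; rewrite !adde_ge0.
    by do 2 (apply: emeasurable_funD => //); exact: emeasurable_funD.
  rewrite ge0_integralD//; last 2 first.
    by move=> w _; rewrite !adde_ge0.
    by apply: emeasurable_funD => //; exact: emeasurable_funD.
  rewrite ge0_integralD//; last 2 first.
    by move=> w _; rewrite !adde_ge0.
    exact: emeasurable_funD.
  rewrite ge0_integralD// ge0_integral_sum// iI ?expR_ge0//.
  apply: leeD2l; set q := expR (U * (s2 / 2) - k * U).
  apply: (@le_trans _ _ (q%:E + (\sum_(i < n) q%:E + (q%:E + q%:E)))%E).
    by apply: leeD I1 (leeD _ (leeD I3 I4)); apply: lee_sum => i _; exact: I2.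
  rewrite sumEFin sumr_const card_ord -!EFinD lee_fin /N natrD -mulr_natl.
  by rewrite le_eqVlt; apply/orP; left; apply/eqP; ring.
have fP : P A \is a fin_num by rewrite fin_num_measure.
rewrite -(fineK fP) lee_fin; move: main; rewrite -(fineK fP) -EFinM -EFinD lee_fin.
set a := fine (P A) => main.
have half : N * expR (U * (s2 / 2) - k * U) <= 2^-1 * expR (s2 * U / 2).
  rewrite expRD expRN mulrCA (_ : U * (s2 / 2) = s2 * U / 2); last by field.
  rewrite mulrC ler_wpM2r ?expR_ge0// ler_pdivrMr ?expR_gt0//.
  rewrite ler_pdivlMl//; apply: le_trans (expR_ge1Dx _).
  have : 2 * N <= k * U.
    apply: (@le_trans _ _ (k * u)); last by rewrite ler_wpM2l ?(ltW k0)// /U; nra.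
    rewrite -ler_pdivrMl//; apply: le_trans uu0.
    by rewrite mulrC lerDr.
  by lra.
have E1 : expR (- ((s2 / 2 + eps) * U)) * expR (U * (s2 + eps)) = expR (s2 * U / 2).
  by rewrite -expRD; congr expR; field.
rewrite -(ler_pM2l (expR_gt0 (U * (s2 + eps)))) mulrCA [X in 2^-1 * X]mulrC -/U E1/=.
by lra.
Qed.

End GaussianTilting.

(** * Path events on a compact set *)

Section FieldBounds.
Context {dO : measure_display} {Omega : measurableType dO} {R : realType}.
Variable P : probability Omega R.
Context {d : nat}.
Variables (T : set 'rV[R]_d) (X : 'rV[R]_d -> Omega -> R).
Hypothesis gX : centered_gaussian_field P T X.
Hypothesis cT : compact T.
Hypothesis cX : forall w, {within T, continuous (fun t => X t w)}.
Implicit Types (xi : R -> 'rV[R]_d) (a b : 'rV[R]_d).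

Local Notation ip := (ip P).
Local Notation combX l la := (fun w => \sum_i la i * X (l i) w).

Lemma path_image_compact a b xi : is_path a b xi -> compact (xi @` `[0, 1]).
Proof. by move=> [cxi _]; apply: continuous_compact => //; exact: segment_compact. Qed.

(** The minimum over the compact image of the path is attained, so a strict inequality leaves
    room. *)
Lemma path_lower_gap (f : 'rV[R]_d -> R) a b xi (u : R) : {within T, continuous f} ->
  is_path a b xi -> (forall v, v \in `[0, 1] -> T (xi v) /\ u < f (xi v)) ->
  exists2 e, 0 < e & forall v, v \in `[0, 1] -> u + e <= f (xi v).
Proof.
move=> cf pxi H.
have K0 : xi @` `[0, 1] !=set0 by exists (xi 0); exists 0 => //=; rewrite in_itv/= lexx ler01.
have KT : xi @` `[0, 1] `<=` T by move=> _ [v vI <-]; have [] := H v vI.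
have [c cK Hc] := compact_EVT_min K0 (path_image_compact pxi) (continuous_subspaceW KT cf).
have [v0 v0I cE] := set_mem cK.
exists (f c - u); first by rewrite subr_gt0 -cE; have [] := H _ v0I.
move=> v vI; rewrite addrC subrK; apply: Hc; apply: mem_set; by exists v.
Qed.

Definition path_event a b (u : R) : set Omega :=
  [set w | exists xi, is_path a b xi /\
        forall v, v \in `[0%R, 1%R] -> T (xi v) /\ u < X (xi v) w].

(** The union over uncountably many paths becomes countable because a sample path enters only
    through its oscillation at some mesh and the set S of net points where it is high; that S
    shadows an admissible path does not depend on the sample. *)
Lemma measurable_path_event a b u : measurable (path_event a b u).
Proof.
have [T0|T0] := pselect (T !=set0); last first.
  rewrite (_ : path_event a b u = set0)//; apply/seteqP; split => // w [xi [_ H]].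
  by case: T0; exists (xi 0); have [] := H 0 _; rewrite ?in_itv/= ?lexx ?ler01.
have [D [DT Dd]] := compact_dense_sequence cT T0.
have /choice[l Hl] : forall m : nat, exists l : seq 'rV[R]_d,
    (forall t, t \in l -> T t) /\
    forall x, T x -> exists2 t, t \in l & `|x - t| < m.+1%:R^-1.
  by move=> m; apply: compact_net => //; rewrite invr_gt0.
pose L m (i : 'I_(size (l m))) := nth 0 (l m) i.
have LT m i : T (L m i) by apply: (Hl m).1; exact: mem_nth.
pose good m (S : {set 'I_(size (l m))}) := exists xi, is_path a b xi /\
  forall v, v \in `[0, 1] -> T (xi v) /\ exists2 i, i \in S & `|xi v - L m i| < m.+1%:R^-1.
pose E n m (S : {set 'I_(size (l m))}) : set Omega :=
  if `[< good m S >] then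
    dense_osc_lt X D m.+1%:R^-1 n.+1%:R^-1 `&`
    [set w | forall i, i \in S -> u + n.+1%:R^-1 < X (L m i) w]
  else set0.
have mX t (x : R) : T t -> measurable [set w | x < X t w].
  move=> Tt; rewrite (_ : [set _ | _] = X t @^-1` `]x, +oo[).
    by rewrite -[X in measurable X]setTI; exact: gX.1.
  by apply/seteqP; split => w /=; rewrite in_itv/= andbT.
have mE n m S : measurable (E n m S).
  rewrite /E; case: asboolP => // _; apply: measurableI.
    exact: (measurable_dense_osc_lt gX).
  rewrite (_ : [set w | _] = \bigcap_(i in [set i | i \in S]) [set w | u + n.+1%:R^-1 < X (L m i) w]).
    by apply: fin_bigcap_measurable => // i _; exact: mX.
  by apply/seteqP; split => w H i iS; exact: H.
rewrite (_ : path_event a b u = \bigcup_n \bigcup_m \bigcup_(S in [set: {set 'I_(size (l m))}]) E n m S).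
  apply: bigcupT_measurable => n; apply: bigcupT_measurable => m.
  by apply: fin_bigcup_measurable => // S _; exact: mE.
apply/seteqP; split => w.
- move=> [xi [pxi Hxi]].
  have [e e0 He] := path_lower_gap (@cX w) pxi Hxi.
  have [n ne] : exists n : nat, n.+1%:R^-1 < e / 2.
    have e20 : 0 < e / 2 by rewrite divr_gt0.
    have [n _ Hn] := near_infty_natSinv_lt (PosNum e20).
    by exists n; apply: (Hn n) => /=.
  have n0 : (0 : R) < n.+1%:R^-1 by rewrite invr_gt0.
  have [r r0 Hr] := compact_unif_continuous cT (@cX w) n0.
  have [m mr] : exists m : nat, m.+1%:R^-1 < r.
    have [m _ Hm] := near_infty_natSinv_lt (PosNum r0).
    by exists m; apply: (Hm m) => /=.
  pose S := [set i : 'I_(size (l m)) | u + n.+1%:R^-1 < X (L m i) w]%SET.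
  have gS : good m S.
    exists xi; split => // v vI; split; first by have [] := Hxi v vI.
    have [Txi _] := Hxi v vI.
    have [t tl tv] := (Hl m).2 _ Txi.
    have il : (index t (l m) < size (l m))%N by rewrite index_mem.
    exists (Ordinal il); last by rewrite /L/= nth_index.
    rewrite inE /L/= nth_index//.
    have := Hr _ _ Txi ((Hl m).1 _ tl) (lt_trans tv mr).
    have arith (q x y : R) : q < e / 2 -> u + e <= x -> x - y < q -> u + q < y by lra.
    by rewrite ltr_norml => /andP[_]; apply: arith => //; exact: He.
  exists n => //; exists m => //; exists S => //; rewrite /E; case: asboolP => // _.
  split; last by move=> i; rewrite inE.
  by move=> i j ij; apply: Hr => //; exact: lt_trans ij mr.
- move=> [n _ [m _ [S _]]]; rewrite /E; case: asboolP => // -[xi [pxi Hxi]] [Ho HS].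
  exists xi; split => // v vI; have [Tv [i iS vi]] := Hxi v vI; split => //.
  have := dense_osc_osc (@cX) DT Dd Ho Tv (LT m i) vi.
  have arith (q x y : R) : u + q < y -> - q <= x - y -> u < x by lra.
  by rewrite ler_norml => /andP[h _]; exact: arith (HS i iS) h.
Qed.

(** The sets [good] are kept general: they are path images in the compact case, and in the
    stationary case traces of paths on a ball, which need not be connected. The variance hypothesis
    covers every finite family finer than [eta], so the net can be refined further to control the
    oscillation. *)
Lemma field_upper (c eta : R) (good : set (set 'rV[R]_d)) : T !=set0 -> 0 <= c -> 0 < eta ->
  (forall g, good g -> g `<=` T) ->
  (forall g n (l : 'I_n -> 'rV[R]_d) (S : {set 'I_n}), good g ->
    (forall i, T (l i)) ->
    (forall x, g x -> exists2 i, i \in S & `|x - l i| < eta) ->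
    exists2 la, face_weights S la & c * ip (combX l la) (combX l la) <= 1) ->
  forall eps, 0 < eps -> exists2 u0, 1 <= u0 & forall (u : R) (A : set Omega),
    u0 <= u -> measurable A ->
    (forall w, A w -> exists2 g, good g & forall x, g x -> u < X x w) ->
    (P A <= (expR (- ((c - eps) / 2 * u ^+ 2)))%:E)%E.
Proof.
move=> T0 c0 eta0 gT Hg eps e0.
(* Ensures delta < 1 and 4 c delta <= eps, so that lowering the level to (1 - delta) u costs at most
   eps / 2 in c. *)
pose delta := eps / (4 * (c + 1) + eps).
have den0 : 0 < 4 * (c + 1) + eps by lra.
have d0 : 0 < delta by rewrite divr_gt0.
have d1 : delta < 1 by rewrite ltr_pdivrMr// mul1r; lra.
have dE : delta * (4 * (c + 1) + eps) = eps by rewrite divfK// gt_eqF.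
have dc : 4 * (c * delta) <= eps by nra.
have [eta1 [eta10 _ Hosc]] := field_oscillation gX cT (@cX) c T0 d0 ltr01.
pose mesh := minr eta eta1.
have mesh0 : 0 < mesh by rewrite lt_min eta0.
have [l [lT lc]] := compact_net cT mesh0.
pose n := size l.
pose L (i : 'I_n) := nth 0 l i.
have LT i : T (L i) by apply: lT; exact: mem_nth.
pose goodS (S : {set 'I_n}) := `[< exists2 g, good g &
  forall x, g x -> exists2 i, i \in S & `|x - L i| < mesh >].
(* One term for the oscillation event and one for each subset of the net; all are absorbed by
   exp(eps u^2 / 4). *)
pose N : R := 1 + (2 ^ n)%:R.
have N1 : 1 <= N by rewrite lerDl.
exists (1 + 4 * N / eps); first by rewrite lerDl divr_ge0 ?mulr_ge0 ?ltW//; lra.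
move=> u A uu0 mA HA.
have u1 : 1 <= u by apply: le_trans uu0; rewrite lerDl divr_ge0 ?mulr_ge0 ?ltW//; lra.
have [B [mB PB HB]] := Hosc u u1.
have AB : (P (A `\` B) <= ((2 ^ n)%:R * expR (- (c * ((1 - delta) * u) ^+ 2 / 2)))%:E)%E.
  apply: (gaussian_orthants_upper (field_spaceP gX) (f := fun i => X (L i)) (good := goodS)) => //.
  - by move=> i; exact: field_space_point.
  - by rewrite mulr_ge0//; lra.
  - exact: measurableD.
  - move=> S /asboolP[g gg HS]; apply: (Hg g n L S) => // x gx.
    by have [i iS xi] := HS x gx; exists i => //; apply: lt_le_trans xi _; rewrite ge_min lexx.
  - move=> w [Aw nBw]; have [g gg Hgw] := HA w Aw.
    exists [set i : 'I_n | (1 - delta) * u <= X (L i) w]%SET; last by move=> i; rewrite inE.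
    apply/asboolP; exists g => // x gx.
    have Tx := gT _ gg _ gx.
    have [t tl xt] := lc _ Tx.
    have il : (index t l < size l)%N by rewrite index_mem.
    exists (Ordinal il); last by rewrite /L/= nth_index.
    rewrite inE /L/= nth_index//.
    have xt1 : `|x - t| < eta1 by apply: lt_le_trans xt _; rewrite ge_min lexx orbT.
    have := HB w nBw _ _ Tx (lT _ tl) xt1; rewrite ler_norml => /andP[_].
    by have := Hgw x gx; lra.
have PA : (P A <= P B + P (A `\` B))%E.
  apply: le_trans (measureU2 _ mB (measurableD mA mB)).
  apply: le_measure; rewrite ?inE//; first by apply: measurableU => //; exact: measurableD.
  by move=> w Aw; have [Bw|nBw] := pselect (B w); [left|right].
apply: le_trans PA _; apply: le_trans (leeD PB AB) _; rewrite -EFinD lee_fin.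
have U1 : u <= u ^+ 2 by nra.
set U := u ^+ 2 in U1 *.
have U0 : 0 < U by lra.
have h1 : expR (- (c * U)) <= expR (- ((c - eps / 2) / 2 * U)).
  by rewrite ler_expR lerN2 ler_wpM2r ?(ltW U0)//; lra.
have h2 : expR (- (c * ((1 - delta) * u) ^+ 2 / 2)) <= expR (- ((c - eps / 2) / 2 * U)).
  rewrite ler_expR lerN2 exprMn -/U.
  have -> : c * ((1 - delta) ^+ 2 * U) / 2 = (c * (1 - delta) ^+ 2) / 2 * U by ring.
  rewrite ler_wpM2r ?(ltW U0)// ler_wpM2r//.
  by have := mulr_ge0 c0 (sqr_ge0 delta); nra.
apply: (@le_trans _ _ (N * expR (- ((c - eps / 2) / 2 * U)))).
  by rewrite /N [leRHS]mulrDl [X in _ <= X + _]mul1r lerD// ler_wpM2l.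
have -> : - ((c - eps) / 2 * U) = eps / 4 * U + - ((c - eps / 2) / 2 * U) by field.
rewrite [leRHS]expRD ler_wpM2r ?expR_ge0//.
apply: le_trans (expR_ge1Dx _).
suff : N <= eps / 4 * U by lra.
apply: (@le_trans _ _ (eps / 4 * u)); last by rewrite ler_wpM2l// divr_ge0// ltW.
rewrite -ler_pdivrMl ?divr_gt0//; apply: le_trans uu0.
have -> : (eps / 4)^-1 * N = 4 * N / eps by field; rewrite gt_eqF.
by rewrite lerDr.
Qed.

Lemma half_expR_ge (c h eps u : R) : 0 < eps -> 12 / eps <= u -> 1 <= u ->
  h <= c + 2 / 3 * eps ->
  expR (- ((c + eps) / 2 * u ^+ 2)) <= 2^-1 * expR (- ((h / 2 + eps / 6 / 2) * u ^+ 2)).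
Proof.
move=> e0 eu u1 hc.
have -> y : 2^-1 * expR y = expR (- ln 2 + y) :> R by rewrite expRD expRN lnK// posrE.
rewrite ler_expR.
have ln2 : ln 2 <= (1 : R) by have := @le_ln1Dx R 1; rewrite -natr1; lra.
have U1 : u <= u ^+ 2 by nra.
set U := u ^+ 2 in U1 *.
have h1 : (h / 2 + eps / 6 / 2) * U <= (c / 2 + eps / 3 + eps / 12) * U.
  by rewrite ler_wpM2r//; lra.
have h2 : 12 <= eps * U.
  apply: (@le_trans _ _ (eps * u)); last by rewrite ler_wpM2l// ltW.
  by rewrite -ler_pdivrMl// mulrC.
by lra.
Qed.

Lemma field_lower (c : R) a b xi : is_path a b xi -> (forall v, v \in `[0, 1] -> T (xi v)) ->
  (forall n (l : 'I_n -> 'rV[R]_d) la, (forall i, (xi @` `[0, 1]) (l i)) ->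
     (forall i, 0 <= la i) -> \sum_i la i = 1 -> 1 <= c * ip (combX l la) (combX l la)) ->
  forall eps, 0 < eps -> exists2 u0, 1 <= u0 & forall (u : R) (A : set Omega),
    u0 <= u -> measurable A ->
    (forall w, (forall v, v \in `[0, 1] -> u < X (xi v) w) -> A w) ->
    ((expR (- ((c + eps) / 2 * u ^+ 2)))%:E <= P A)%E.
Proof.
move=> pxi Txi Hc eps e0.
pose K := xi @` `[0, 1].
have KT : K `<=` T by move=> _ [v vI <-]; exact: Txi.
have cK : compact K by exact: path_image_compact pxi.
have zI : (0 : R) \in `[0, 1] by rewrite in_itv/= lexx ler01.
have T0 : T !=set0 by exists (xi 0); exact: Txi.
have c0 : 0 < c.
  have := Hc 1%N (fun=> xi 0) (fun=> 1) (fun=> (ex_intro2 _ _ 0 zI erefl)) (fun=> ler01).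
  rewrite big_ord1 => /(_ erefl) h; rewrite ltNge; apply/negP => cle.
  have := mulr_le0_ge0 cle (ip_ge0 P (fun w => \sum_(i < 1) 1 * X (xi 0) w)); lra.
(* Ensures 12 c delta <= eps, so that the energy (1 + 2 delta)^2 c is at most c + 2 eps / 3. *)
pose delta := eps / (12 * (c + 1) + eps).
have den0 : 0 < 12 * (c + 1) + eps by lra.
have d0 : 0 < delta by rewrite divr_gt0.
have d1 : delta < 1 by rewrite ltr_pdivrMr// mul1r; lra.
have dE : delta * (12 * (c + 1) + eps) = eps by rewrite divfK// gt_eqF.
have dc : 12 * (c * delta) <= eps by nra.
pose c' := (1 + 2 * delta) ^+ 2 * c.
have c'E : c' <= c + 2 / 3 * eps by rewrite /c'; nra.
(* The rate 2 c' + 2 is what the tilting estimate demands of its exceptional event, once the energy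
   of H is at most c'. *)
have [eta [eta0 _ Hosc]] := field_oscillation gX cT (@cX) (2 * c' + 2) T0 d0 ltr01.
have [l [lK lc]] := compact_net cK eta0.
pose n := size l.
pose L (i : 'I_n) := nth 0 l i.
have LK i : K (L i) by apply: lK; exact: mem_nth.
have LT i : T (L i) by exact: KT.
have [t0 t0l _] := lc (xi 0) (ex_intro2 _ _ 0 zI erefl).
have il0 : (index t0 l < size l)%N by rewrite index_mem.
have Gf i : field_space T X (X (L i)) by exact: field_space_point.
have [la [[la0 la1 _] Hla]] := convex_equalizer (field_spaceP gX) Gf (finset.in_setT (Ordinal il0)).
pose Y w := \sum_i la i * X (L i) w.
have GY : field_space T X Y by exact: (gspace_sum (field_spaceP gX)).
have cV := Hc n L la LK la0 la1; rewrite -/Y in cV.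
set V := ip Y Y in cV.
have V0 : 0 < V.
  rewrite ltNge; apply/negP => Vle; have := mulr_ge0_le0 (ltW c0) Vle; lra.
(* Scales Y to covariances at least 1 + 2 delta on the net: one delta is spent by the tilting
   estimate, the other by the oscillation between net and path. *)
pose r := (1 + 2 * delta) / V.
pose H w := r * Y w.
have GH : field_space T X H by exact: (gspaceZ (field_spaceP gX)).
have HH : ip H H <= c'.
  rewrite /H (ip_scale2 (field_spaceP gX))// -/V /r /c'.
  have -> : ((1 + 2 * delta) / V) ^+ 2 * V = (1 + 2 * delta) ^+ 2 / V by field; rewrite gt_eqF.
  by rewrite ler_wpM2l ?sqr_ge0// -[leLHS]mul1r ler_pdivrMr.
have fH i : 1 + 2 * delta <= ip (X (L i)) H.
  rewrite ipC /H (ipZ (field_spaceP gX))// ipC /r -mulrA ler_peMr//; first by lra.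
  by rewrite ler_pdivlMl// mulr1; exact: Hla.
have e60 : 0 < eps / 6 / 2 by rewrite !divr_gt0.
have [u1 u11 Hu1] := gaussian_tilting_lower (field_spaceP gX) Gf GH d0 e60 fH.
exists (u1 + 12 / eps); first by apply: (le_trans u11); rewrite lerDl divr_ge0// ltW.
move=> u A uu0 mA HA.
have ep0 : 0 <= 12 / eps by rewrite divr_ge0// ltW.
have uu1 : u1 <= u by apply: le_trans uu0; rewrite lerDl.
have u1' : 1 <= u by exact: le_trans u11 uu1.
have eu : 12 / eps <= u by apply: le_trans uu0; rewrite lerDr (le_trans ler01).
have [B [mB PB HB]] := Hosc u u1'.
apply: le_trans (Hu1 u A B uu1 mA mB _ _).
- by rewrite lee_fin; apply: half_expR_ge => //; exact: le_trans HH c'E.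
- apply: le_trans PB _; rewrite lee_fin ler_expR lerN2 ler_wpM2r ?sqr_ge0// lerD2r.
  by rewrite ler_wpM2l.
- move=> w nBw Hw; apply: HA => v vI.
  have Kv : K (xi v) by exists v.
  have [t tl vt] := lc _ Kv.
  have il : (index t l < size l)%N by rewrite index_mem.
  have := Hw (Ordinal il); rewrite /L/= nth_index// => Xt.
  have := HB w nBw _ _ (Txi v vI) (KT _ (lK _ tl)) vt.
  rewrite ler_norml lerBrDr => /andP[hh _]; apply: lt_le_trans hh.
  by rewrite -(ltrD2l (delta * u)) addrA subrr add0r addrC -[X in X + _]mul1r -mulrDl.
Qed.

End FieldBounds.

(** * Passage to the logarithmic limit *)

Section LogRatioLimit.
Context {R : realType}.
Implicit Types (c u y : R) (p C : \bar R).

Lemma logratio_le p u y : 0 < u -> (0 <= p <= 1)%E ->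
  (p <= (expR (- (y * u ^+ 2)))%:E)%E -> (logratio p u <= (- y)%:E)%E.
Proof.
move=> u0 /andP[p0 p1] py.
have U0 : 0 < u ^+ 2 by rewrite exprn_gt0.
have V0 : 0 < u ^- 2 by rewrite invr_gt0.
rewrite /logratio /elog; case: eqP => [_|/eqP pn0].
  by rewrite gt0_mulNye ?lte_fin// leNye.
have pf : p \is a fin_num by rewrite ge0_fin_numE// (le_lt_trans p1)// ltry.
move: p0 py pn0; rewrite -(fineK pf) !lee_fin eqe => p0 py pn0.
have pp : 0 < fine p by rewrite lt_neqAle eq_sym pn0.
rewrite /= ler_pdivrMr// -[leRHS]expRK mulNr ler_ln// posrE//.
exact: expR_gt0.
Qed.

Lemma logratio_ge p u y : 0 < u -> (p <= 1)%E ->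
  ((expR (- (y * u ^+ 2)))%:E <= p)%E -> (((- y)%:E <= logratio p u)%E /\ logratio p u \is a fin_num).
Proof.
move=> u0 p1 py.
have U0 : 0 < u ^+ 2 by rewrite exprn_gt0.
have pp : (0 < p)%E by apply: lt_le_trans py; rewrite lte_fin expR_gt0.
rewrite /logratio /elog gt_eqF//.
have pf : p \is a fin_num by rewrite ge0_fin_numE ?ltW// (le_lt_trans p1)// ltry.
move: pp py; rewrite -(fineK pf) lte_fin lee_fin => pp py.
rewrite -EFinM; split => //.
rewrite lee_fin ler_pdivlMr// -[leLHS]expRK mulNr ler_ln// posrE//.
exact: expR_gt0.
Qed.

(** Finite and infinite C are treated together by comparing with real levels c on either side; for
    infinite C only the upper bound has content and forces the limit to be -oo. *)
Lemma logratio_cvg (Psi : R -> \bar R) C : (0 <= C)%E ->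
  (forall u, (0 <= Psi u <= 1)%E) ->
  (forall c, 0 <= c -> (c%:E < C)%E -> forall e, 0 < e -> exists2 u0, 1 <= u0 &
     forall u, u0 <= u -> (Psi u <= (expR (- ((c - e) / 2 * u ^+ 2)))%:E)%E) ->
  (forall c, (C < c%:E)%E -> forall e, 0 < e -> exists2 u0, 1 <= u0 &
     forall u, u0 <= u -> ((expR (- ((c + e) / 2 * u ^+ 2)))%:E <= Psi u)%E) ->
  logratio (Psi u) u @[u --> +oo] --> (- ((2^-1)%:E * C))%E.
Proof.
move=> C0 P01 UB0 LB.
have UB c : (c%:E < C)%E -> forall e, 0 < e -> \forall u \near +oo,
     (logratio (Psi u) u <= (- ((c - e) / 2))%:E)%E.
  move=> cC e e0.
  have [u0 u01 Hu0] : exists2 u0, 1 <= u0 &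
     forall u, u0 <= u -> (Psi u <= (expR (- ((c - e) / 2 * u ^+ 2)))%:E)%E.
    (* When C = 0 all levels below it are negative, and the bound is then at least 1. *)
    have [c0|c0] := leP 0 c; first exact: UB0.
    exists 1 => // u u1; apply: (@le_trans _ _ 1%E); first by have /andP[] := P01 u.
    rewrite lee_fin -[leLHS]expR0 ler_expR -mulNr mulr_ge0 ?sqr_ge0//.
    by rewrite oppr_ge0; lra.
  near=> u; have uu : u0 <= u by near: u; exact: nbhs_pinfty_ge (num_real _).
  have up : 0 < u := lt_le_trans (lt_le_trans ltr01 u01) uu.
  exact: logratio_le up (P01 u) (Hu0 u uu).
have {}LB c : (C < c%:E)%E -> forall e, 0 < e -> \forall u \near +oo,
     ((- ((c + e) / 2))%:E <= logratio (Psi u) u)%E /\ logratio (Psi u) u \is a fin_num.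
  move=> cC e e0; have [u0 u01 Hu0] := LB c cC e e0.
  near=> u; have uu : u0 <= u by near: u; exact: nbhs_pinfty_ge (num_real _).
  have up : 0 < u := lt_le_trans (lt_le_trans ltr01 u01) uu.
  by apply: (logratio_ge up _ (Hu0 u uu)); have /andP[] := P01 u.
case: C C0 UB LB {UB0} => [c0| |]//.
- move=> _ UB LB.
  rewrite -EFinM -EFinN; apply/fine_cvgP; split.
    have := LB (c0 + 1) _ 1 ltr01; rewrite lte_fin ltrDl ltr01 => /(_ isT).
    by apply: filterS => u [].
  apply/cvgrPdist_le => e e0.
  have e20 : 0 < e / 2 by rewrite divr_gt0.
  have h1 : ((c0 - e / 2)%:E < c0%:E)%E by rewrite lte_fin; lra.
  have h2 : (c0%:E < (c0 + e / 2)%:E)%E by rewrite lte_fin; lra.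
  near=> u.
  have [lb fn] : ((- ((c0 + e / 2 + e / 2) / 2))%:E <= logratio (Psi u) u)%E /\ logratio (Psi u) u \is a fin_num.
    by near: u; exact: LB.
  have ub : (logratio (Psi u) u <= (- ((c0 - e / 2 - e / 2) / 2))%:E)%E.
    by near: u; exact: UB.
  move: lb ub; rewrite -(fineK fn) !lee_fin /=; move: (fine _) => x lb ub.
  by rewrite ler_norml; apply/andP; split; lra.
- move=> _ UB _; rewrite gt0_muley ?lte_fin//=.
  apply/cvgeNyPle => A.
  have := UB (2 * `|A| + 1) (ltry _) 1 ltr01.
  apply: filterS => u /le_trans; apply; rewrite lee_fin.
  by have := ler_norm (- A); rewrite normrN; lra.
Unshelve. all: by end_near. Qed.

(** Cauchy-Schwarz in polynomial form, shared by the integrals over the probability space and over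
    the spectral measure. A null v is excluded by evaluating at t = h + 1. *)
Lemma quadratic_discriminant (h p v : R) : 1 <= p ->
  (forall t : R, 0 <= h - 2 * t * p + t ^+ 2 * v) -> 1 <= h * v.
Proof.
move=> p1 H.
have h0 : 0 <= h by have := H 0; rewrite expr0n/=; lra.
have [v0|v0] := ltP 0 v.
  have := H (p / v).
  have -> : h - 2 * (p / v) * p + (p / v) ^+ 2 * v = h - p ^+ 2 / v.
    by field; rewrite gt_eqF.
  by rewrite subr_ge0 ler_pdivrMr// => hp; nra.
have := H (h + 1); have := mulr_ge0_le0 (sqr_ge0 (h + 1)) v0; nra.
Qed.

End LogRatioLimit.

(** * Upper bound through the variational constant *)

Section PathCondition.
Context {dO : measure_display} {Omega : measurableType dO} {R : realType}.
Variable P : probability Omega R.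
Context {d : nat}.
Variables (T : set 'rV[R]_d) (X : 'rV[R]_d -> Omega -> R).
Hypothesis gX : centered_gaussian_field P T X.
Hypothesis cT : compact T.
Hypothesis cX : forall w, {within T, continuous (fun t => X t w)}.

Local Notation ip := (ip P).
Local Notation combX l la := (fun w => \sum_i la i * X (l i) w).

Lemma sqr_ratio_le (k : R) : 0 < k -> k <= 2^-1 -> ((1 + k) / (1 - k)) ^+ 2 <= 1 + 16 * k.
Proof.
move=> k0 k12; have k1 : 0 < 1 - k by lra.
have r4 : (1 + k) / (1 - k) <= 1 + 4 * k by rewrite ler_pdivrMr//; nra.
have r40 : 0 <= (1 + k) / (1 - k) by rewrite divr_ge0//; lra.
by apply: (@le_trans _ _ ((1 + 4 * k) ^+ 2)); [rewrite lerXn2r// nnegrE; lra|nra].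
Qed.

(* If no weights on a fine net of the path had variance at most 1/c, the equalizing
   combination, rescaled, would be an admissible element of energy below C. *)
Lemma path_variance_bound (C : \bar R) (a b : 'rV[R]_d) (c : R) : T !=set0 ->
  (forall xi n (l : 'I_n -> 'rV[R]_d) la, is_path a b xi ->
     (forall v, v \in `[0, 1] -> T (xi v)) -> (forall i, T (l i)) ->
     (forall v, v \in `[0, 1] -> 1 < ip (X (xi v)) (combX l la)) ->
     (C <= (ip (combX l la) (combX l la))%:E)%E) ->
  0 <= c -> (c%:E < C)%E ->
  exists2 eta, 0 < eta & forall xi n (l : 'I_n -> 'rV[R]_d) (S : {set 'I_n}),
    is_path a b xi -> (forall v, v \in `[0, 1] -> T (xi v)) -> (forall i, T (l i)) ->
    (forall v, v \in `[0, 1] -> exists2 i, i \in S & `|xi v - l i| < eta) ->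
    exists2 la, face_weights S la & c * ip (combX l la) (combX l la) <= 1.
Proof.
move=> T0 HC c0 cC.
have gS := field_spaceP gX.
have [c1 c1C cc1] : exists2 c1, (c1%:E < C)%E & c < c1.
  case: C cC {HC} => [r| |]//; last by move=> _; exists (c + 1); rewrite ?ltry// ltrDl.
  by rewrite lte_fin => cr; exists ((c + r) / 2); rewrite ?lte_fin; lra.
(* Makes (1 + 16 k) c <= c1 < C, so that the inflation by ((1 + k)/(1 - k))^2 stays below C. *)
pose k := minr 2^-1 ((c1 - c) / (16 * (c + 1))).
have k0 : 0 < k by rewrite lt_min invr_gt0 ltr0n/= divr_gt0; lra.
have k12 : k <= 2^-1 by rewrite /k ge_min lexx.
have kc : 16 * (c + 1) * k <= c1 - c.
  have c16 : 0 < 16 * (c + 1) by lra.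
  by rewrite mulrC -ler_pdivlMr// /k ge_min lexx orbT.
have c10 : 0 < c + 1 by lra.
(* If c V > 1, then k^2 / (c + 1) <= k^2 V: increments within [eta] are small relative to the
   unknown variance V. *)
have th0 : 0 < k ^+ 2 / (c + 1) by rewrite divr_gt0// exprn_gt0.
have [eta [eta0 Heta _]] := field_oscillation gX cT (@cX) 0 T0 ltr01 th0.
exists eta => // xi n l S pxi Txi Tl cov.
have zI : (0 : R) \in `[0, 1] by rewrite in_itv/= lexx ler01.
have [i0 i0S _] := cov 0 zI.
have Gf i : field_space T X (X (l i)) by exact: field_space_point.
have [la [fla Hla]] := convex_equalizer gS Gf i0S.
exists la => //.
set Y := combX l la in Hla *.
have GY : field_space T X Y by exact: (gspace_sum gS).
set V := ip Y Y in Hla *.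
rewrite leNgt; apply/negP => cV.
have V0 : 0 < V.
  by have := ip_ge0 P Y; rewrite -/V le_eqVlt => /orP[/eqP V0|//]; move: cV; rewrite -V0 mulr0; lra.
have k1 : 0 < 1 - k by lra.
(* The factor 1/(1 - k) repairs the loss from net points to path points, and 1 + k makes the
   covariance strictly greater than 1. *)
pose r := (1 + k) / (1 - k) / V.
have rV : r * V = (1 + k) / (1 - k) by rewrite /r divfK// gt_eqF.
have r0 : 0 < r by rewrite divr_gt0// divr_gt0//; lra.
have combE : combX l (fun i => r * la i) = (fun w => r * Y w).
  by apply/funext => w; rewrite /Y mulr_sumr; apply: eq_bigr => i _; rewrite mulrA.
have := HC xi n l (fun i => r * la i) pxi Txi Tl; rewrite combE => /(_ _)/wrap[].
  move=> v vI; have [i iS vi] := cov v vI.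
  rewrite ipC (ipZ gS)//; last exact: field_space_point (Txi v vI).
  have GX : field_space T X (X (xi v)) by exact: field_space_point (Txi v vI).
  pose Z w := X (xi v) w - X (l i) w.
  have GZ : field_space T X Z by exact: (gspaceB gS).
  have Zth : ip Z Z <= k ^+ 2 / (c + 1) by apply: Heta => //; exact: Txi.
  have ZV : ip Z Z <= k ^+ 2 * V.
    apply: (le_trans Zth); rewrite ler_wpM2l ?sqr_ge0// -[leLHS]mulr1 ler_pdivrMl//; lra.
  have ZY : ip Z Y = ip (X (xi v)) Y - ip (X (l i)) Y by exact: (ipB gS).
  (* Cauchy-Schwarz for the increment Z: the square of Z/k + Y is nonnegative, whence E (Z Y) >= - k
     V. *)
  have q : 0 <= ip (fun w => k^-1 * Z w + Y w) (fun w => k^-1 * Z w + Y w) by exact: ip_ge0.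
  rewrite (ip_lin2 gS)// -/V in q.
  have kZ : - (k * V) <= ip Z Y.
    have : 0 <= k * (k^-1 ^+ 2 * ip Z Z + 2 * k^-1 * ip Z Y + V) by rewrite mulr_ge0 // ltW.
    have -> : k * (k^-1 ^+ 2 * ip Z Z + 2 * k^-1 * ip Z Y + V) = ip Z Z / k + 2 * ip Z Y + k * V.
      by field; rewrite gt_eqF.
    have : ip Z Z / k <= k * V by rewrite ler_pdivrMr//; lra.
    by lra.
  have hi : V <= ip (X (l i)) Y := Hla i iS.
  have h : (1 - k) * V <= ip (X (xi v)) Y by rewrite ZY in kZ; lra.
  rewrite ipC; apply: (@lt_le_trans _ _ (r * ((1 - k) * V))); last by rewrite ler_wpM2l// ltW.
  have -> : r * ((1 - k) * V) = 1 + k by rewrite mulrCA rV mulrC divfK// gt_eqF.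
  by rewrite ltrDl.
apply/negP; rewrite -ltNge (le_lt_trans _ c1C)// lee_fin (ip_scale2 gS)// -/V.
have -> : r ^+ 2 * V = ((1 + k) / (1 - k)) ^+ 2 / V by rewrite -rV; field; rewrite gt_eqF.
have r16 := sqr_ratio_le k0 k12.
apply: (@le_trans _ _ ((1 + 16 * k) * c)); last by nra.
apply: ler_pM => //; [exact: sqr_ge0|by rewrite invr_ge0 ltW|].
by rewrite -[leLHS]mul1r ler_pdivrMr// ltW.
Qed.

Lemma path_event_upper (C : \bar R) (a b : 'rV[R]_d) (c : R) : T !=set0 ->
  (forall xi n (l : 'I_n -> 'rV[R]_d) la, is_path a b xi ->
     (forall v, v \in `[0, 1] -> T (xi v)) -> (forall i, T (l i)) ->
     (forall v, v \in `[0, 1] -> 1 < ip (X (xi v)) (combX l la)) ->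
     (C <= (ip (combX l la) (combX l la))%:E)%E) ->
  0 <= c -> (c%:E < C)%E -> forall eps, 0 < eps -> exists2 u0, 1 <= u0 &
    forall u, u0 <= u ->
    (P (path_event T X a b u) <= (expR (- ((c - eps) / 2 * u ^+ 2)))%:E)%E.
Proof.
move=> T0 HC c0 cC eps e0.
have [eta eta0 Heta] := path_variance_bound T0 HC c0 cC.
pose good := [set g | exists xi, [/\ is_path a b xi,
  (forall v, v \in `[0, 1] -> T (xi v)) & g = xi @` `[0, 1]]].
have [||u0 u01 Hu0] := field_upper gX cT (@cX) (good := good) T0 c0 eta0 _ _ e0.
- by move=> _ [xi [_ Txi ->]] _ [v vI <-]; exact: Txi.
- move=> _ n l S [xi [pxi Txi ->]] Tl cov; apply: (Heta xi) => // v vI.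
  by apply: cov; exists v.
exists u0 => // u uu0; apply: Hu0 => //; first exact: (measurable_path_event gX).
move=> w [xi [pxi H]]; exists (xi @` `[0, 1]).
  by exists xi; split => // v vI; have [] := H v vI.
by move=> _ [v vI <-]; have [] := H v vI.
Qed.

End PathCondition.

Section RealIntegrals.
Context {dT : measure_display} {T : measurableType dT} {R : realType}.
Variable mu : {measure set T -> \bar R}.
Implicit Types (f g h : T -> R).
Local Notation integrableR f := (mu.-integrable setT (EFin \o f)).

Lemma integrableR_lin (a : R) f g : integrableR f -> integrableR g ->
  integrableR (fun x => a * f x + g x).
Proof.
move=> fi gi; have := integrableD measurableT (integrableZl measurableT a fi) gi.
exact: eq_integrable.
Qed.

Lemma Rintegral_lin (a : R) f g : integrableR f -> integrableR g ->
  \int[mu]_x (a * f x + g x) = a * \int[mu]_x f x + \int[mu]_x g x.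
Proof.
move=> fi gi; rewrite RintegralD//; first by rewrite RintegralZl.
have := integrableZl measurableT a fi; exact: eq_integrable.
Qed.

Lemma Rintegral_sum n (a : 'I_n -> R) (f : 'I_n -> T -> R) :
  (forall i, integrableR (f i)) ->
  integrableR (fun x => \sum_i a i * f i x) /\
  \int[mu]_x (\sum_i a i * f i x) = \sum_i a i * \int[mu]_x f i x.
Proof.
elim: n a f => [a f _|n IH a f fi].
  rewrite big_ord0 (_ : (fun x => _) = (fun=> 0)); last first.
    by apply/funext => x; rewrite big_ord0.
  split; first exact: integrable0.
  by rewrite /Rintegral integral0.
have [i1 e1] := IH (fun i => a (lift ord0 i)) (fun i => f (lift ord0 i)) (fun i => fi _).
rewrite big_ord_recl -e1 -Rintegral_lin//.
rewrite (_ : (fun x => _) = (fun x => a ord0 * f ord0 x + \sum_(i < n) a (lift ord0 i) * f (lift ord0 i) x)).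
  by split => //; exact: integrableR_lin.
by apply/funext => x; rewrite big_ord_recl.
Qed.

Lemma integral_EFin f : integrableR f -> (\int[mu]_x (f x)%:E = (\int[mu]_x f x)%:E)%E.
Proof. by move=> fi; rewrite /Rintegral fineK//; exact: integrable_fin_num. Qed.

Lemma Rintegral_quadratic_ge0 f g h (t : R) : integrableR f -> integrableR g -> integrableR h ->
  (forall x, 0 <= f x - 2 * t * g x + t ^+ 2 * h x) ->
  0 <= \int[mu]_x f x - 2 * t * \int[mu]_x g x + t ^+ 2 * \int[mu]_x h x.
Proof.
move=> fi gi hi H.
have -> : \int[mu]_x f x - 2 * t * \int[mu]_x g x + t ^+ 2 * \int[mu]_x h x =
   \int[mu]_x (- (2 * t) * g x + (t ^+ 2 * h x + f x)).
  by rewrite Rintegral_lin ?Rintegral_lin//; [ring|exact: integrableR_lin].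
apply: Rintegral_ge0 => x _; have := H x; congr (_ <= _); ring.
Qed.

End RealIntegrals.

(** * The compact case *)

Section PartOne.
Context {dO : measure_display} {Omega : measurableType dO} {R : realType}.
Variable P : probability Omega R.
Context {d : nat}.
Variables (T : set 'rV[R]_d) (X : 'rV[R]_d -> Omega -> R) (a b : 'rV[R]_d).
Hypothesis gX : centered_gaussian_field P T X.
Hypothesis cT : compact T.
Hypothesis cX : forall w, {within T, continuous (fun t => X t w)}.

Local Notation ip := (ip P).
Local Notation combX l la := (fun w => \sum_i la i * X (l i) w).

Lemma expectation_EFin f : P.-integrable setT (EFin \o f) ->
  ('E_P[f] = (\int[P]_w f w)%:E)%E.
Proof. by move=> fi; rewrite unlock -integral_EFin. Qed.

Lemma C_ab_ge0 : (0 <= C_ab P T X a b)%E.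
Proof.
rewrite leNgt; apply/negP => /ereal_inf_lt[_ [H _ <-]]; apply/negP; rewrite -leNgt.
by rewrite unlock; apply: integral_ge0 => w _; rewrite lee_fin sqr_ge0.
Qed.

Lemma C_ab_le xi n (l : 'I_n -> 'rV[R]_d) la : is_path a b xi ->
  (forall v, v \in `[0, 1] -> T (xi v)) -> (forall i, T (l i)) ->
  (forall v, v \in `[0, 1] -> 1 < ip (X (xi v)) (combX l la)) ->
  (C_ab P T X a b <= (ip (combX l la) (combX l la))%:E)%E.
Proof.
move=> pxi Txi Tl H; have gS := field_spaceP gX.
have GY : field_space T X (combX l la).
  by apply: (gspace_sum gS) => i; exact: field_space_point.
apply: ge_ereal_inf; exists (ip (combX l la) (combX l la))%:E => //.
exists (combX l la); last first.
  rewrite ip_sqr expectation_EFin//.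
  by have [_ ? _ _] := gaussian_facts (gS.1 _ GY).
split; last first.
  exists xi; split => // v vI; split; first exact: Txi.
  rewrite /w_H expectation_EFin ?lte_fin; first exact: H.
  by apply: (ip_integrable gS) => //; apply: field_space_point; exact: Txi.
split; first exact: (gspace_measurable gS).
move=> e e0; have [s [sT Ys]] := GY; exists s; split => //.
rewrite -Ys unlock (eq_integral (fun=> 0%E)) ?integral0// => w _.
by rewrite subrr expr0n.
Qed.

(** [H] lies only in the closure of the span, whereas the tilting estimate is applied within the
    span; so only its path and the resulting bound on variances are kept. *)
Lemma C_ab_lt (c : R) : (C_ab P T X a b < c%:E)%E -> exists xi, [/\ is_path a b xi,
  forall v, v \in `[0, 1] -> T (xi v) &
  forall n (l : 'I_n -> 'rV[R]_d) la, (forall i, (xi @` `[0, 1]) (l i)) ->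
     (forall i, 0 <= la i) -> \sum_i la i = 1 -> 1 <= c * ip (combX l la) (combX l la)].
Proof.
have gS := field_spaceP gX.
move=> /ereal_inf_lt[_ [H [[mH HL] [xi [pxi Hxi]]] <-]] Ec.
exists xi; split => //; first by move=> v vI; have [] := Hxi v vI.
move=> n l la lxi la0 la1.
have Tl i : T (l i) by have [v vI <-] := lxi i; have [] := Hxi v vI.
have Gl i : field_space T X (X (l i)) by exact: field_space_point.
have GY : field_space T X (combX l la) by exact: (gspace_sum gS).
set Y := combX l la in GY *.
have [_ iY _ _] := gaussian_facts (gS.1 _ GY).
have mY := gspace_measurable gS GY.
have iH : P.-integrable setT (EFin \o (fun w => H w ^+ 2)).
  apply/integrableP; split; first by apply/measurable_EFinP; exact: measurable_funX.
  under eq_integral do rewrite gee0_abs ?lee_fin ?sqr_ge0//.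
  by move: Ec; rewrite unlock => /lt_trans; apply; rewrite ltry.
have iXH i : P.-integrable setT (EFin \o (fun w => X (l i) w * H w)).
  apply: integrable_mul_sqr => //; first exact: (gspace_measurable gS).
  by have [_ ? _ _] := gaussian_facts (gS.1 _ (Gl i)).
have p1 i : 1 <= \int[P]_w (X (l i) w * H w).
  have [v vI lv] := lxi i; have [_] := Hxi v vI.
  by rewrite lv /w_H expectation_EFin// lte_fin => /ltW.
have [iS eS] := Rintegral_sum la iXH.
have YE : (fun w => \sum_i la i * (X (l i) w * H w)) = (fun w => Y w * H w).
  by apply/funext => w; rewrite /Y mulr_suml; apply: eq_bigr => i _; rewrite mulrA.
rewrite YE in iS eS.
have pY : 1 <= \int[P]_w (Y w * H w).
  rewrite eS -la1; apply: ler_sum => i _.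
  by rewrite -[leLHS]mulr1 ler_wpM2l.
rewrite ip_sqr; apply: (@le_trans _ _ (\int[P]_w (H w ^+ 2) * \int[P]_w (Y w ^+ 2))).
  apply: (quadratic_discriminant pY) => t; apply: Rintegral_quadratic_ge0 => // w.
  by rewrite (_ : _ + _ = (H w - t * Y w) ^+ 2) ?sqr_ge0//; ring.
rewrite ler_wpM2r//; first by rewrite -ip_sqr ip_ge0.
by move: Ec; rewrite expectation_EFin// lte_fin => /ltW.
Qed.

Lemma path_event_log_asymptotics : T a ->
  logratio (Psi_ab P T X a b u) u @[u --> +oo]
        --> (- ((2^-1)%:E * C_ab P T X a b))%E.
Proof.
move=> Ta; have T0 : T !=set0 by exists a.
have mE u := measurable_path_event gX cT (@cX) a b u.
apply: logratio_cvg; first exact: C_ab_ge0.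
- by move=> u; rewrite measure_ge0/= probability_le1//; exact: mE.
- move=> c c0 cC e e0; apply: (path_event_upper gX cT (@cX) T0 _ c0 cC e0).
  exact: C_ab_le.
- move=> c /C_ab_lt[xi [pxi Txi Hc]] e e0.
  have [u0 u01 Hu0] := field_lower gX cT (@cX) pxi Txi Hc e0.
  exists u0 => // u uu0; apply: (Hu0 u _ uu0 (mE u)) => w Hw.
  by exists xi; split => // v vI; split; [exact: Txi|exact: Hw].
Qed.

End PartOne.

(** * Spectral representation *)

Section Spectral.
Context {dO : measure_display} {Omega : measurableType dO} {R : realType}.
Variable P : probability Omega R.
Context {d : nat}.
Variables (X : 'rV[R]_d -> Omega -> R) (F : {finite_measure set (d.-tuple R) -> \bar R}).
Hypothesis gX : centered_gaussian_field P setT X.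
Hypothesis stX : stationary P X.
Hypothesis spF : is_spectral_measure P X F.
Implicit Types (s t : 'rV[R]_d) (x : d.-tuple R).

Local Notation ip := (ip P).
Local Notation combX l la := (fun w => \sum_i la i * X (l i) w).
Local Notation integrableF f := (F.-integrable setT (EFin \o f)).

Lemma covariance_ip s t : covariance P (X s) (X t) = (ip (X s) (X t))%:E.
Proof.
have gS := field_spaceP gX.
have Gs u : field_space setT X (X u) by exact: field_space_point.
have m0 u : fine 'E_P[X u]%E = 0 by have [h _] := gspace_mean0 gS (Gs u); rewrite -h unlock.
rewrite covariance.unlock !m0 -expectation_EFin; last exact: (ip_integrable gS).
congr ('E_P[_])%E; apply/funext => w.
by rewrite -[LHS]/((X s w - 0) * (X t w - 0)) !subr0.
Qed.

Lemma dotvtB s t x : dotvt (t - s) x = dotvt t x - dotvt s x.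
Proof.
by rewrite /dotvt -sumrB; apply: eq_bigr => i _; rewrite !mxE mulrBl.
Qed.

Lemma dotvt_tneg t x : dotvt t (tneg x) = - dotvt t x.
Proof.
by rewrite /dotvt -sumrN; apply: eq_bigr => i _; rewrite tnth_map mulrN.
Qed.

Lemma measurable_dotvt t : measurable_fun setT (@dotvt R d t).
Proof.
apply: measurable_sum => i; apply: measurable_funM => //; exact: measurable_tnth.
Qed.

Lemma measurable_cos_dotvt t : measurable_fun setT (fun x => cos (dotvt t x)).
Proof.
apply: (measurableT_comp _ (measurable_dotvt t)).
apply: continuous_measurable_fun; exact: continuous_cos.
Qed.

Lemma measurable_sin_dotvt t : measurable_fun setT (fun x => sin (dotvt t x)).
Proof.
apply: (measurableT_comp _ (measurable_dotvt t)).
apply: continuous_measurable_fun; exact: continuous_sin.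
Qed.

Lemma bounded1_integrable (f : d.-tuple R -> R) : measurable_fun setT f ->
  (forall x, `|f x| <= 1) -> integrableF f.
Proof.
move=> mf f1; apply: (le_integrable measurableT _ _ (finite_measure_integrable_cst F 1 measurableT)).
  exact/measurable_EFinP.
by move=> x _ /=; rewrite lee_fin normr1.
Qed.

Lemma spectral_cov s t : integrableF (fun x => cos (dotvt (t - s) x)) /\
  \int[F]_x cos (dotvt (t - s) x) = ip (X s) (X t).
Proof.
split; first exact: bounded1_integrable (measurable_cos_dotvt _) (fun=> cos_max _).
by rewrite /Rintegral -(spF.2 (t - s)).1 -stX covariance_ip.
Qed.

Lemma spectral_sin t : integrableF (fun x => sin (dotvt t x)) /\
  \int[F]_x sin (dotvt t x) = 0.
Proof.
split; first exact: bounded1_integrable (measurable_sin_dotvt _) (fun=> sin_max _).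
by rewrite /Rintegral (spF.2 t).2.
Qed.

(** With [sin_comb], the real and imaginary parts of the sum of la_i exp(i (l_i, x)), the spectral
    image of the combination of the X(l_i). *)
Definition cos_comb n (l : 'I_n -> 'rV[R]_d) (la : 'I_n -> R) x :=
  \sum_i la i * cos (dotvt (l i) x).
Definition sin_comb n (l : 'I_n -> 'rV[R]_d) (la : 'I_n -> R) x :=
  \sum_i la i * sin (dotvt (l i) x).

Section Comb.
Variables (n : nat) (l : 'I_n -> 'rV[R]_d) (la : 'I_n -> R).
Local Notation C := (cos_comb l la).
Local Notation S := (sin_comb l la).

Lemma spectral_comb_re t :
  integrableF (fun x => cos (dotvt t x) * C x + sin (dotvt t x) * S x) /\
  \int[F]_x (cos (dotvt t x) * C x + sin (dotvt t x) * S x) = ip (X t) (combX l la).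
Proof.
have gS := field_spaceP gX.
have GX u : field_space setT X (X u) by exact: field_space_point.
have [iS eS] := Rintegral_sum la (fun i => (spectral_cov t (l i)).1).
have E : (fun x => \sum_i la i * cos (dotvt (l i - t) x)) =
    (fun x => cos (dotvt t x) * C x + sin (dotvt t x) * S x).
  apply/funext => x; rewrite !mulr_sumr -big_split/=; apply: eq_bigr => i _.
  by rewrite dotvtB cosB; ring.
rewrite E in iS eS; split => //; rewrite eS ipC (ip_sum gS)//.
by apply: eq_bigr => i _; rewrite (spectral_cov t (l i)).2 ipC.
Qed.

Lemma spectral_comb_im t :
  \int[F]_x (sin (dotvt t x) * C x - cos (dotvt t x) * S x) = 0.
Proof.
have [_ eS] := Rintegral_sum la (fun i => (spectral_sin (t - l i)).1).
have E : (fun x => \sum_i la i * sin (dotvt (t - l i) x)) =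
    (fun x => sin (dotvt t x) * C x - cos (dotvt t x) * S x).
  apply/funext => x; rewrite !mulr_sumr -sumrB; apply: eq_bigr => i _.
  by rewrite dotvtB sinB; ring.
rewrite E in eS; rewrite eS big1// => i _.
by rewrite (spectral_sin (t - l i)).2 mulr0.
Qed.

Lemma spectral_comb_sqr : integrableF (fun x => C x ^+ 2 + S x ^+ 2) /\
  \int[F]_x (C x ^+ 2 + S x ^+ 2) = ip (combX l la) (combX l la).
Proof.
have gS := field_spaceP gX.
have GX u : field_space setT X (X u) by exact: field_space_point.
have [iS eS] := Rintegral_sum la (fun i => (spectral_comb_re (l i)).1).
have E : (fun x => \sum_i la i * (cos (dotvt (l i) x) * C x + sin (dotvt (l i) x) * S x)) =
    (fun x => C x ^+ 2 + S x ^+ 2).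
  apply/funext => x; rewrite !expr2 {2}/cos_comb {2}/sin_comb !mulr_suml -big_split/=.
  by apply: eq_bigr => i _; ring.
rewrite E in iS eS; split => //; rewrite eS (ip_sum gS)//; last exact: (gspace_sum gS).
by apply: eq_bigr => i _; rewrite (spectral_comb_re (l i)).2.
Qed.

Lemma comb_in_HF : in_HF F C S.
Proof.
split; first by apply: measurable_sum => i; apply: measurable_funM => //; exact: measurable_cos_dotvt.
split; first by apply: measurable_sum => i; apply: measurable_funM => //; exact: measurable_sin_dotvt.
split; first by rewrite integral_EFin ?ltry//; exact: spectral_comb_sqr.1.
split => x; first by apply: eq_bigr => i _; rewrite dotvt_tneg cosN.
by rewrite -sumrN; apply: eq_bigr => i _; rewrite dotvt_tneg sinN mulrN.
Qed.

End Comb.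

Variable a : 'rV[R]_d.

Lemma C_a_ge0 : (0 <= C_a F a)%E.
Proof.
rewrite leNgt; apply/negP => /ereal_inf_lt[_ [h _ <-]]; apply/negP; rewrite -leNgt.
by apply: integral_ge0 => w _; rewrite lee_fin addr_ge0// sqr_ge0.
Qed.

Lemma C_a_le xi n (l : 'I_n -> 'rV[R]_d) la : is_path 0 a xi ->
  (forall v, v \in `[0, 1] -> 1 < ip (X (xi v)) (combX l la)) ->
  (C_a F a <= (ip (combX l la) (combX l la))%:E)%E.
Proof.
move=> pxi H.
apply: ge_ereal_inf; exists (ip (combX l la) (combX l la))%:E => //.
exists (cos_comb l la, sin_comb l la); last first.
  by have [iS eS] := spectral_comb_sqr l la; rewrite integral_EFin//= eS.
split; first exact: comb_in_HF.
exists xi; split => // v vI /=; have [iR eR] := spectral_comb_re l la (xi v).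
split; first by rewrite integral_EFin// eR lte_fin; exact: H.
have im := spectral_comb_im l la (xi v).
rewrite integral_EFin ?im//.
have [iS _] := Rintegral_sum la (fun i => (spectral_sin (xi v - l i)).1).
apply: eq_integrable iS => // x _ /=; congr EFin.
rewrite !mulr_sumr -sumrB; apply: eq_bigr => i _.
by rewrite dotvtB sinB; ring.
Qed.

(** Cauchy-Schwarz takes place in the spectral space, so no random variable has to be built from h;
    the real part of the constraint provides the pairing with the trigonometric sums. *)
Lemma C_a_lt (c : R) : (C_a F a < c%:E)%E -> exists2 xi, is_path 0 a xi &
  forall n (l : 'I_n -> 'rV[R]_d) la, (forall i, (xi @` `[0, 1]) (l i)) ->
     (forall i, 0 <= la i) -> \sum_i la i = 1 -> 1 <= c * ip (combX l la) (combX l la).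
Proof.
move=> /ereal_inf_lt[_ [[h1 h2]/= [[m1 [m2 [_ _]]] [xi [pxi Hxi]]] <-]] Ec.
exists xi => // n l la lxi la0 la1.
have iH : integrableF (fun x => h1 x ^+ 2 + h2 x ^+ 2).
  apply/integrableP; split.
    by apply/measurable_EFinP; apply: measurable_funD; exact: measurable_funX.
  under eq_integral do rewrite gee0_abs ?lee_fin ?addr_ge0 ?sqr_ge0//.
  by move: Ec => /lt_trans; apply; rewrite ltry.
have iXH i : integrableF (fun x => cos (dotvt (l i) x) * h1 x + sin (dotvt (l i) x) * h2 x).
  (* The dominating function is 1 + |h|^2, because cos^2 + sin^2 = 1. *)
  have i1 := integrableD measurableT (finite_measure_integrable_cst F 1 measurableT) iH.
  apply: (le_integrable measurableT _ _ i1).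
    apply/measurable_EFinP; apply: measurable_funD; apply: measurable_funM => //.
      exact: measurable_cos_dotvt.
    exact: measurable_sin_dotvt.
  move=> x _ /=; rewrite lee_fin.
  have := cos2Dsin2 (dotvt (l i) x); move: (cos _) (sin _) (h1 x) (h2 x) => p q y z pq.
  rewrite [leRHS]ger0_norm ?addr_ge0 ?sqr_ge0//.
  have := (sqr_ge0 (p - y), sqr_ge0 (p + y), sqr_ge0 (q - z), sqr_ge0 (q + z)).
  move=> [[[s1 s2] s3] s4]; have := (sqr_ge0 y, sqr_ge0 z) => -[s5 s6].
  by rewrite ler_norml; apply/andP; split; lra.
have p1 i : 1 <= \int[F]_x (cos (dotvt (l i) x) * h1 x + sin (dotvt (l i) x) * h2 x).
  have [v vI lv] := lxi i; have [+ _] := Hxi v vI.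
  by rewrite lv integral_EFin// lte_fin => /ltW.
have [iS eS] := Rintegral_sum la iXH.
have [iC eC] := spectral_comb_sqr l la.
have YE : (fun x => \sum_i la i * (cos (dotvt (l i) x) * h1 x + sin (dotvt (l i) x) * h2 x)) =
   (fun x => cos_comb l la x * h1 x + sin_comb l la x * h2 x).
  by apply/funext => x; rewrite !mulr_suml -big_split/=; apply: eq_bigr => i _; ring.
rewrite YE in iS eS.
have pY : 1 <= \int[F]_x (cos_comb l la x * h1 x + sin_comb l la x * h2 x).
  rewrite eS -la1; apply: ler_sum => i _.
  by rewrite -[leLHS]mulr1 ler_wpM2l.
rewrite -eC; apply: (@le_trans _ _ (\int[F]_x (h1 x ^+ 2 + h2 x ^+ 2) *
    \int[F]_x (cos_comb l la x ^+ 2 + sin_comb l la x ^+ 2))).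
  apply: (quadratic_discriminant pY) => t; apply: Rintegral_quadratic_ge0 => // x.
  have := addr_ge0 (sqr_ge0 (h1 x - t * cos_comb l la x)) (sqr_ge0 (h2 x - t * sin_comb l la x)).
  congr (0 <= _); ring.
rewrite ler_wpM2r//; first by rewrite eC ip_ge0.
by move: Ec; rewrite integral_EFin// lte_fin => /ltW.
Qed.

End Spectral.

(** * Paths escaping to infinity *)

Section Escape.
Context {R : realType}.

Lemma compact_norm_le d (r : R) : compact [set t : 'rV[R]_d | `|t| <= r].
Proof.
apply: bounded_closed_compact.
  exists r; split; first exact: num_real.
  by move=> x rx t /= tr; apply: le_trans tr (ltW rx).
rewrite (_ : [set _ | _] = (Num.norm : 'rV[R]_d -> R) @^-1` [set x | x <= r])//.
apply: (continuous_closedP _).1; first exact: norm_continuous.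
exact: closed_le.
Qed.

Lemma path_bounded d (a b : 'rV[R]_d) xi : is_path a b xi ->
  exists N : nat, forall v, v \in `[0, 1] -> `|xi v| <= N%:R.
Proof.
move=> pxi; have [M [_ HM]] := compact_bounded (path_image_compact pxi).
have [N _ HN] := nbhs_infty_gtr M.
exists N => v vI; apply: (HM N%:R); first by apply: (HN N) => /=.
by exists v.
Qed.

Lemma path_norm_IVT d (b : 'rV[R]_d) xi (v1 r : R) : is_path 0 b xi ->
  v1 \in `[0, 1] -> 0 <= r <= `|xi v1| -> exists2 v, v \in `[0, 1] & `|xi v| = r.
Proof.
move=> [cxi [xi0 _]]; rewrite in_itv/= => /andP[v0 v1'] /andP[r0 r1].
have sub : `[0, v1] `<=` `[0, 1].
  by move=> x /=; rewrite !in_itv/= => /andP[-> /le_trans]; apply.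
have cn : {within `[0, v1], continuous (fun v => `|xi v|)}.
  apply: within_continuous_comp; first by move=> x _; exact: norm_continuous.
  exact: continuous_subspaceW cxi.
have [|v vI vE] := IVT v0 cn (v := r); first by rewrite xi0 normr0 min_l ?max_r// r0.
by exists v => //; exact: sub.
Qed.

(** Several crossings may be assigned to the same net point; summing weights over fibres avoids
    asking [p] to be injective. *)
Lemma sum_pushforward n N (p : 'I_N -> 'I_n) (c : R) (f : 'I_n -> R) :
  \sum_i (\sum_(j | p j == i) c) * f i = \sum_j c * f (p j).
Proof.
rewrite [RHS](partition_big p xpredT)//=; apply: eq_bigr => i _.
by rewrite mulr_suml; apply: eq_bigr => j /eqP ->.
Qed.

End Escape.

Section Uncorrelated.
Context {dO : measure_display} {Omega : measurableType dO} {R : realType}.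
Variable P : probability Omega R.
Context {d : nat}.
Variables (T : set 'rV[R]_d) (X : 'rV[R]_d -> Omega -> R).
Hypothesis gX : centered_gaussian_field P T X.

Local Notation ip := (ip P).
Local Notation combX l la := (fun w => \sum_i la i * X (l i) w).

(** In the variance of an average of N + 1 variables the diagonal contributes r / (N + 1) and the
    rest at most e. One-sided bounds on the covariances suffice, which suits the limsup
    condition. *)
Lemma average_variance n N (l : 'I_n -> 'rV[R]_d) (S : {set 'I_n}) (p : 'I_N.+1 -> 'I_n) (r e : R) :
  (forall i, T (l i)) -> (forall j, p j \in S) -> 0 <= e ->
  (forall t, T t -> ip (X t) (X t) <= r) ->
  (forall j k, j != k -> ip (X (l (p j))) (X (l (p k))) <= e) ->
  exists2 la, face_weights S la & ip (combX l la) (combX l la) <= r / N.+1%:R + e.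
Proof.
move=> Tl pS e0 Hr He.
have gS := field_spaceP gX.
have GX i : field_space T X (X (l i)) by exact: field_space_point.
have N0 : (0 : R) < N.+1%:R by [].
have Ni : (0 : R) <= N.+1%:R^-1 by rewrite invr_ge0 ltW.
pose la i := \sum_(j | p j == i) (N.+1%:R^-1 : R).
have combE : combX l la = (fun w => \sum_j N.+1%:R^-1 * X (l (p j)) w).
  by apply/funext => w; rewrite (sum_pushforward p _ (fun i => X (l i) w)).
exists la.
  split.
  - by move=> i; apply: sumr_ge0.
  - have := sum_pushforward p N.+1%:R^-1 (fun=> 1 : R).
    under eq_bigr do rewrite mulr1.
    move=> ->; rewrite sumr_const card_ord mulr1 -[X in X *+ _]mul1r -mulrnAr.
    by rewrite mul1r -mulr_natr mulVf// gt_eqF.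
  - move=> i iS; rewrite /la big1// => j /eqP ji.
    by move: iS; rewrite -ji pS.
rewrite combE; set Y := (fun w => _).
have GY : field_space T X Y by exact: (gspace_sum gS).
rewrite {1}/Y (ip_sum gS)//.
have H j : ip (X (l (p j))) Y <= N.+1%:R^-1 * (r + N%:R * e).
  rewrite ipC (ip_sum gS)// -mulr_sumr ler_wpM2l//.
  rewrite (bigD1 j)//= lerD ?Hr//.
  apply: (@le_trans _ _ (\sum_(k < N.+1 | k != j) e)).
    by apply: ler_sum => k kj; exact: He.
  by rewrite sumr_const cardC1 card_ord/= mulr_natl.
apply: (@le_trans _ _ (\sum_(j < N.+1) N.+1%:R^-1 * (N.+1%:R^-1 * (r + N%:R * e)))).
  by apply: ler_sum => j _; rewrite ler_wpM2l.
rewrite sumr_const card_ord -[leLHS]mulr_natl mulrA mulfV ?gt_eqF// mul1r.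
rewrite mulrDr mulrC lerD2l mulrA ler_piMl// ler_pdivrMl// mulr1 ler_nat//.
Qed.

End Uncorrelated.

(** * The stationary case *)

Section PartTwo.
Context {dO : measure_display} {Omega : measurableType dO} {R : realType}.
Variable P : probability Omega R.
Context {d : nat}.
Variables (X : 'rV[R]_d -> Omega -> R) (F : {finite_measure set (d.-tuple R) -> \bar R}).
Hypothesis gX : centered_gaussian_field P setT X.
Hypothesis cX : forall w, continuous (fun t => X t w).
Hypothesis stX : stationary P X.
Hypothesis spF : is_spectral_measure P X F.
Hypothesis decX : forall e : R, 0 < e -> exists M : R, forall t : 'rV[R]_d,
          M < `|t| -> (cov_fun P X t <= e%:E)%E.
Variable a : 'rV[R]_d.

Local Notation ip := (ip P).
Local Notation combX l la := (fun w => \sum_i la i * X (l i) w).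
Local Notation ball r := [set t : 'rV[R]_d | `|t| <= r].

Lemma restrict_field T : centered_gaussian_field P T X.
Proof. by split => [t _|s _]; [exact: gX.1|exact: gX.2]. Qed.

Lemma restrict_continuous T w : {within T, continuous (fun t => X t w)}.
Proof. exact/continuous_subspaceT. Qed.

Definition free_path_event u : set Omega := [set w | exists xi, is_path 0 a xi /\
        forall v, v \in `[0%R, 1%R] -> u < X (xi v) w].

(** Every path is bounded, so the event is the countable union of the events confined to balls of
    integer radius. *)
Lemma measurable_free_path_event u : measurable (free_path_event u).
Proof.
rewrite (_ : free_path_event u = \bigcup_N path_event (ball N%:R) X 0 a u).
  apply: bigcupT_measurable => N.
  exact: (measurable_path_event (restrict_field _) (@compact_norm_le _ _ _) (@restrict_continuous _)).
apply/seteqP; split => w; last first.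
  by move=> [N _ [xi [pxi H]]]; exists xi; split => // v vI; have [] := H v vI.
move=> [xi [pxi H]]; have [N HN] := path_bounded pxi.
by exists N => //; exists xi; split => // v vI; split; [exact: HN|exact: H].
Qed.

Lemma stationary_ip s t : ip (X s) (X t) = ip (X 0) (X (t - s)).
Proof.
have := stX s t; rewrite /cov_fun !(covariance_ip gX) => -[].
exact.
Qed.

(* An escaping path crosses the spheres of radii M, 2M, .., NM; the field is nearly
   uncorrelated along these crossings, so their average has small variance. *)
Lemma escape_variance_bound (c : R) : 0 <= c -> exists2 r : R, `|a| <= r &
  forall xi v1 n (l : 'I_n -> 'rV[R]_d) (S : {set 'I_n}),
    is_path 0 a xi -> v1 \in `[0, 1] -> r < `|xi v1| ->
    (forall v, v \in `[0, 1] -> `|xi v| <= r -> exists2 i, i \in S & `|xi v - l i| < 1) ->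
    exists2 la, face_weights S la & c * ip (combX l la) (combX l la) <= 1.
Proof.
move=> c0; have c10 : 0 < c + 1 by lra.
(* Half of 1/(c + 1) is allotted to the covariances; N is chosen so that the diagonal takes at most
   the other half. *)
have e0 : 0 < (2 * (c + 1))^-1 by rewrite invr_gt0 mulr_gt0.
have [M0 HM0] := decX e0.
(* Crossings of distinct spheres are at least M apart; replacing them by net points within distance
   1 loses less than 2, which still exceeds M0. The term |a| puts the endpoint inside the ball. *)
pose M := `|M0| + `|a| + 3.
have M3 : 3 <= M by rewrite /M; have := normr_ge0 M0; have := normr_ge0 a; lra.
have MM0 : M0 + 3 <= M by rewrite /M; have := ler_norm M0; have := normr_ge0 a; lra.
have Ma : `|a| <= M by rewrite /M; have := normr_ge0 M0; lra.
set r0 := ip (X 0) (X 0).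
have [N _ HN] := nbhs_infty_gtr (2 * (c + 1) * r0).
have Nr : 2 * (c + 1) * r0 < N.+1%:R by apply: (HN N.+1) => /=.
have N1 : (1 : R) <= N.+1%:R by rewrite ler1n.
exists (N.+1%:R * M); first by nra.
move=> xi v1 n l S pxi v1I rv cov.
have M0' : 0 <= M by lra.
have jN (j : 'I_N.+1) : 0 <= j.+1%:R * M <= N.+1%:R * M.
  by rewrite mulr_ge0//= ler_wpM2r// ler_nat.
have /choice[v Hv] (j : 'I_N.+1) : exists v, v \in `[0, 1] /\ `|xi v| = j.+1%:R * M.
  have /andP[h1 h2] := jN j.
  have [|v vI vE] := @path_norm_IVT _ _ _ _ _ (j.+1%:R * M) pxi v1I; last by exists v.
  by rewrite h1 (le_trans h2)// ltW.
have /choice[p Hp] (j : 'I_N.+1) : exists i, i \in S /\ `|xi (v j) - l i| < 1.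
  have [|i iS il] := cov (v j) (Hv j).1; last by exists i.
  by rewrite (Hv j).2; have /andP[] := jN j.
have far (j k : 'I_N.+1) : (j < k)%N -> M0 < `|l (p k) - l (p j)|.
  move=> jk.
  have h1 : `|xi (v k)| - `|xi (v j)| <= `|xi (v k) - xi (v j)| by exact: lerB_dist.
  have h2 : M <= `|xi (v k)| - `|xi (v j)|.
    rewrite (Hv k).2 (Hv j).2 -mulrBl ler_peMl//.
    by rewrite lerBrDl natr1 ler_nat.
  have h3 : `|xi (v k) - xi (v j)| <= `|xi (v k) - l (p k)| + (`|l (p k) - l (p j)| + `|xi (v j) - l (p j)|).
    rewrite (_ : xi (v k) - xi (v j) = (xi (v k) - l (p k)) + ((l (p k) - l (p j)) - (xi (v j) - l (p j)))).
      by rewrite (le_trans (ler_normD _ _))// lerD2l ler_normB.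
    by rewrite opprB [_ - _ + (l (p j) - _)]addrA subrK addrA subrK.
  have := (Hp j).2; have := (Hp k).2; lra.
have near0 (j k : 'I_N.+1) : j != k -> ip (X (l (p j))) (X (l (p k))) <= (2 * (c + 1))^-1.
  suff H (j' k' : 'I_N.+1) : (j' < k')%N -> ip (X (l (p j'))) (X (l (p k'))) <= (2 * (c + 1))^-1.
    rewrite -val_eqE neq_ltn => /orP[|]; first exact: H.
    by rewrite ipC; exact: H.
  move=> jk; rewrite stationary_ip -lee_fin -(covariance_ip gX).
  exact: HM0 (far _ _ jk).
have var t : setT t -> ip (X t) (X t) <= r0 by rewrite stationary_ip subrr.
have [la fla Hla] := average_variance gX (l := l) (fun=> I) (fun j => (Hp j).1) (ltW e0) var near0.
exists la => //.
have h : r0 / N.+1%:R <= (2 * (c + 1))^-1.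
  rewrite ler_pdivrMr ?(lt_le_trans ltr01)// ler_pdivlMl ?mulr_gt0//; exact: ltW.
apply: (@le_trans _ _ (c * ((2 * (c + 1))^-1 + (2 * (c + 1))^-1))).
  by rewrite ler_wpM2l// (le_trans Hla)// lerD2r.
have -> : (2 * (c + 1))^-1 + (2 * (c + 1))^-1 = (c + 1)^-1 by field; rewrite gt_eqF.
by rewrite ler_pdivrMr// mul1r; lra.
Qed.

(** Paths confined to the ball obey the variational bound, the others the escape bound. Both
    hypotheses see only net points in the ball, so a single compact net handles them together. *)
Lemma free_path_event_upper (c : R) : 0 <= c -> (c%:E < C_a F a)%E ->
  forall eps, 0 < eps -> exists2 u0, 1 <= u0 & forall u, u0 <= u ->
    (P (free_path_event u) <= (expR (- ((c - eps) / 2 * u ^+ 2)))%:E)%E.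
Proof.
move=> c0 cC eps e0.
have [r ar Hr] := escape_variance_bound c0.
pose T := ball r.
have cT : compact T by exact: compact_norm_le.
have T0 : T !=set0 by exists a.
have gT := restrict_field T.
have [eta1 eta10 Heta] := path_variance_bound gT cT (restrict_continuous (T := T)) T0
  (fun xi n l la pxi _ _ => @C_a_le _ _ _ _ _ _ _ gX stX spF a xi n l la pxi) c0 cC.
pose eta := minr eta1 1.
have eta0 : 0 < eta by rewrite lt_min eta10 ltr01.
(* The trace on the ball replaces the whole path, which has no fixed compact set containing it. The
   1 in [eta] is the tolerance of the escape bound. *)
pose good := [set g | exists2 xi, is_path 0 a xi & g = (xi @` `[0, 1]) `&` T].
have [||u0 u01 Hu0] := field_upper gT cT (restrict_continuous (T := T)) (good := good) T0 c0 eta0 _ _ e0.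
- by move=> _ [xi pxi ->] x [].
- move=> _ n l S [xi pxi ->] Tl cov.
  have cov' v : v \in `[0, 1] -> T (xi v) -> exists2 i, i \in S & `|xi v - l i| < eta.
    by move=> vI Tv; apply: cov; split => //; exists v.
  have [Txi|] := pselect (forall v, v \in `[0, 1] -> T (xi v)).
    apply: (Heta xi) => // v vI; have [i iS il] := cov' v vI (Txi v vI).
    by exists i => //; apply: (lt_le_trans il); rewrite ge_min lexx.
  move=> /existsNP[v1 /not_implyP[v1I /negP]]; rewrite -ltNge => rv1.
  apply: (Hr xi v1) => // v vI vr; have [i iS il] := cov' v vI vr.
  by exists i => //; apply: (lt_le_trans il); rewrite ge_min lexx orbT.
exists u0 => // u uu0; apply: (Hu0 u _ uu0 (measurable_free_path_event u)).
move=> w [xi [pxi H]]; exists ((xi @` `[0, 1]) `&` T); first by exists xi.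
by move=> _ [[v vI <-] _]; exact: H.
Qed.

(** One admissible path is enough for the lower bound, and it lies in some ball, where the compact
    estimate applies. *)
Lemma free_path_event_lower (c : R) : (C_a F a < c%:E)%E ->
  forall eps, 0 < eps -> exists2 u0, 1 <= u0 & forall u, u0 <= u ->
    ((expR (- ((c + eps) / 2 * u ^+ 2)))%:E <= P (free_path_event u))%E.
Proof.
move=> /(C_a_lt gX stX spF)[xi pxi Hc] eps e0.
have [N HN] := path_bounded pxi.
have [u0 u01 Hu0] := field_lower (restrict_field _) (@compact_norm_le _ _ _)
  (restrict_continuous (T := ball N%:R)) pxi HN Hc e0.
exists u0 => // u uu0; apply: (Hu0 u _ uu0 (measurable_free_path_event u)) => w Hw.
by exists xi.
Qed.

Lemma free_path_event_log_asymptotics :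
  logratio (Psi_a P X a u) u @[u --> +oo] --> (- ((2^-1)%:E * C_a F a))%E.
Proof.
apply: logratio_cvg; first exact: C_a_ge0.
- move=> u; rewrite measure_ge0/= probability_le1//.
  exact: measurable_free_path_event.
- exact: free_path_event_upper.
- exact: free_path_event_lower.
Qed.
End PartTwo.

Theorem theorem3p1 (R : realType) (d : nat) :
  (* (i) *)
  (forall (dO : measure_display) (Omega : measurableType dO)
          (P : probability Omega R) (T : set 'rV[R]_d)
          (X : 'rV[R]_d -> Omega -> R) (a b : 'rV[R]_d),
      compact T ->
      centered_gaussian_field P T X ->
      (forall w, {within T, continuous (fun t => X t w)}) ->
      T a -> T b -> a != b ->
      (exists xi, is_path a b xi /\ forall v, v \in `[0%R, 1%R] -> T (xi v)) ->
      logratio (Psi_ab P T X a b u) u @[u --> +oo]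
        --> (- ((2^-1)%:E * C_ab P T X a b))%E)
  /\
  (* (ii) *)
  (forall (dO : measure_display) (Omega : measurableType dO)
          (P : probability Omega R) (X : 'rV[R]_d -> Omega -> R)
          (F : {finite_measure set (d.-tuple R) -> \bar R}) (a : 'rV[R]_d),
      centered_gaussian_field P setT X ->
      (forall w, continuous (fun t => X t w)) ->
      stationary P X ->
      is_spectral_measure P X F ->
      (forall e : R, 0 < e -> exists M : R, forall t : 'rV[R]_d,
          M < `|t| -> (cov_fun P X t <= e%:E)%E) ->
      a != 0 ->
      logratio (Psi_a P X a u) u @[u --> +oo]
        --> (- ((2^-1)%:E * C_a F a))%E).
Proof.
split.
  move=> dO Omega P T X a b cT gX cX Ta _ _ _.
  exact: path_event_log_asymptotics gX cT (@cX) Ta.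
move=> dO Omega P X F a gX cX stX spF decX _.
exact: free_path_event_log_asymptotics gX (@cX) stX spF decX a.
Qed.
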